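(* Let $Y(u)\in\mathbb{R}^m_{>0}$ be a solution of $\frac{dY_i}{du}=-Y_iF_i(Y)$, $1\le i\le m$, with $\sum_iY_i(0)\le c_0$, where $c_0$ is as in the context, and let $g_{a,\vec b}(\tau)$, $\tau\in[0,\infty)$, be the corresponding ancient solution of the Ricci flow on the circle bundle $P_Q$. Then: (i) for each $i$ and $\tau\in[0,\infty)$, $$\frac{2n_ip_i}{n_i+1}\,\tau+b_i(0)\le b_i(\tau)\le 2p_i\tau+b_i(0);$$ (ii) $\lim_{\tau\to\infty}a(\tau)$ exists (is finite) and is positive. Geometrically, as $\tau\to\infty$, the radii of the circle fibres of $P_Q$, equipped with the metric $g_{a,\vec b}(\tau)$, increase monotonically to a finite value, and the length-scale on the Kähler–Einstein base factors grows like $\sqrt\tau$; (iii) as $\tau\to\infty$, the rescaled metrics $\tau^{-1}g_{a,\vec b}(\tau)$ on $P_Q$ collapse (in the Gromov–Hausdorff sense) to the Einstein product metric $2\sum_ip_ig_i$ on the base $M_1\times\cdots\times M_m$.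
   Context: For $1\le i\le m$, $(M_i,g_i)$ is a compact Kähler–Einstein manifold of complex dimension $n_i$, $\mathrm{Rc}(g_i)=p_ig_i$ with $p_i$ a positive integer, with Kähler form $\omega_i$, scaled so that $\frac1{2\pi}[\omega_i]$ is integral and represents a torsion-free indivisible class in $H^2(M_i,\mathbb{Z})$. Let $q_1,\dots,q_m$ be nonzero integers and $P_Q\to M_1\times\cdots\times M_m$ the principal circle bundle with Euler class $\frac1{2\pi}\sum_iq_i[\omega_i]$, with principal connection $\sigma$ of curvature form $d\sigma=\sum_iq_i\omega_i$. Consider metrics $g_{a,\vec b}(\tau)=a(\tau)\,\sigma\otimes\sigma+\sum_ib_i(\tau)g_i$, $a,b_i>0$ ($g_i$ pulled back). With $\tau=-t$ the backwards Ricci flow for $g_{a,\vec b}(\tau)$ is $$\frac{da}{d\tau}=\sum_{i}n_iq_i^2\frac{a^2}{b_i^2},\qquad \frac{db_i}{d\tau}=2p_i-q_i^2\frac{a}{b_i}.$$ An ancient solution is one existing for all $t\in(-\infty,T)$ for some finite $T$. Put $Y_i=a/b_i$, $u=\int_0^\tau\frac{d\zeta}{a(\zeta)}$, $E(Y)=\sum_in_iq_i^2Y_i^2$, $F_i(Y)=2p_iY_i-q_i^2Y_i^2-E(Y)$. Then the flow becomes $\frac{d\ln a}{du}=E(Y)$, $\frac{dY_i}{du}=-Y_iF_i(Y)$. Conversely, a solution $Y(u)\in\mathbb{R}^m_{>0}$ and a choice of $a(0)>0$ determine the corresponding $g_{a,\vec b}(\tau)$ by $a(u)=a(0)\exp\int_0^uE(Y(\zeta))d\zeta$,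 $\tau(u)=\int_0^ua(\zeta)d\zeta$, $b_i=a/Y_i$. $c_0>0$ is a constant (which exists) such that every solution $Y(u)\in\mathbb{R}^m_{\ge0}$ with $\sum_iY_i(0)\le c_0$ satisfies $\lim_{u\to\infty}Y(u)=0$, and if $Y(u)\in\mathbb{R}^m_{>0}$ then the corresponding $g_{a,\vec b}(\tau)$ is an ancient solution, defined for all $\tau\ge0$. *)

(* Defs.v *)
From HB Require Import structures.
From mathcomp Require Import all_boot all_order all_algebra.
From mathcomp Require Import all_classical all_reals all_analysis.

Set Implicit Arguments.
Unset Strict Implicit.
Unset Printing Implicit Defensive.

Import Order.TTheory GRing.Theory Num.Theory.
Import numFieldNormedType.Exports.

Local Open Scope classical_set_scope.
Local Open Scope ring_scope.

Section Calculus.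
Context {R : realType}.

Definition pd n (i : 'I_n) (f : 'rV[R]_n -> R) : 'rV[R]_n -> R :=
  fun x => 'D_(delta_mx 0 i) f x.

Fixpoint Ck n (r : nat) (U : set 'rV[R]_n) (f : 'rV[R]_n -> R) : Prop :=
  match r with
  | 0 => forall x, U x -> {for x, continuous f}
  | r'.+1 => (forall x, U x -> differentiable f x) /\
             forall i, Ck r' U (pd i f)
  end.

Definition Ckv n k (r : nat) (U : set 'rV[R]_n) (f : 'rV[R]_n -> 'rV[R]_k) :=
  forall j, Ck r U (fun x => f x 0 j).

End Calculus.

Section Manifolds.
Context {R : realType}.

(* [cmap] and [cinv] are total functions; only their restrictions to [cdom]
   and to [cimg] are meaningful. *)
Record chart (T : Type) (n : nat) := Chart {
  cdom : set T;
  cmap : T -> 'rV[R]_n;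
  cinv : 'rV[R]_n -> T
}.

Definition cimg T n (c : chart T n) : set 'rV[R]_n := cmap c @` cdom c.

(* Every point carries a preferred chart [chart_at]. Through it the tangent
   space at each point is identified with the row vectors 'rV_n, so that
   tensor fields are matrix-valued functions on the manifold. *)
Record atlas (T : Type) (n : nat) := Atlas {
  charts : set (chart T n);
  chart_at : T -> chart T n
}.

Definition is_chart (T : topologicalType) n (c : chart T n) : Prop :=
  [/\ open (cdom c), open (cimg c),
      forall x, cdom c x -> cinv c (cmap c x) = x,
      forall x, cdom c x -> {for x, continuous (cmap c)} &
      forall y, cimg c y -> {for y, continuous (cinv c)}].

Definition overlap T n (c c' : chart T n) : set 'rV[R]_n :=
  cmap c @` (cdom c `&` cdom c').

Definition transition T n (c c' : chart T n) : 'rV[R]_n -> 'rV[R]_n :=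
  cmap c' \o cinv c.

Record is_manifold (T : topologicalType) n (A : atlas T n) : Prop := {
  mfd_hausdorff : hausdorff_space T;
  mfd_countable : @second_countable T;
  mfd_chart : forall c, charts A c -> is_chart c;
  mfd_chart_at : forall x, charts A (chart_at A x) /\ cdom (chart_at A x) x;
  mfd_smooth : forall c c', charts A c -> charts A c' ->
    forall r, Ckv r (overlap c c') (transition c c')
}.

Definition Ck_map_on (T1 T2 : topologicalType) n1 n2
    (A1 : atlas T1 n1) (A2 : atlas T2 n2) (r : nat) (W : set T1)
    (f : T1 -> T2) : Prop :=
  [/\ open W, forall x, W x -> {for x, continuous f} &
      forall c1 c2, charts A1 c1 -> charts A2 c2 ->
        Ckv r (cmap c1 @` (W `&` cdom c1 `&` f @^-1` cdom c2))
          (cmap c2 \o f \o cinv c1)].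

Definition smooth_map_on (T1 T2 : topologicalType) n1 n2
    (A1 : atlas T1 n1) (A2 : atlas T2 n2) (W : set T1) (f : T1 -> T2) : Prop :=
  forall r, Ck_map_on A1 A2 r W f.

Definition smooth_map (T1 T2 : topologicalType) n1 n2
    (A1 : atlas T1 n1) (A2 : atlas T2 n2) (f : T1 -> T2) : Prop :=
  smooth_map_on A1 A2 setT f.

Definition euclid (k : nat) : atlas 'rV[R]_k k :=
  let c := Chart setT id id in Atlas [set c] (fun=> c).

Definition prod_chart T1 T2 n1 n2 (c1 : chart T1 n1) (c2 : chart T2 n2) :
    chart (T1 * T2) (n1 + n2) :=
  Chart (cdom c1 `*` cdom c2)
    (fun z => row_mx (cmap c1 z.1) (cmap c2 z.2))
    (fun y => (cinv c1 (lsubmx y), cinv c2 (rsubmx y))).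

Definition prod_atlas T1 T2 n1 n2 (A1 : atlas T1 n1) (A2 : atlas T2 n2) :
    atlas (T1 * T2) (n1 + n2) :=
  Atlas [set c | exists c1 c2,
           [/\ charts A1 c1, charts A2 c2 & c = prod_chart c1 c2]]
        (fun z => prod_chart (chart_at A1 z.1) (chart_at A2 z.2)).

Definition bigprod_chart m (T : 'I_m -> topologicalType) (d : 'I_m -> nat)
    (c : forall i, chart (T i) (d i)) :
    chart (prod_topology T) (\sum_i d i)%N :=
  Chart [set x : prod_topology T | forall i, cdom (c i) (x i)]
    (fun x => mxrow (fun i => cmap (c i) (x i)))
    (fun y i => cinv (c i) (submxrow y i)).

Definition bigprod_atlas m (T : 'I_m -> topologicalType) (d : 'I_m -> nat)
    (A : forall i, atlas (T i) (d i)) :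
    atlas (prod_topology T) (\sum_i d i)%N :=
  Atlas [set c | exists2 c_ : forall i, chart (T i) (d i),
           forall i, charts (A i) (c_ i) & c = bigprod_chart c_]
        (fun x => bigprod_chart (fun i => chart_at (A i) (x i))).

(* Tangent vectors are rows: the tangent map sends [v] to [v *m tmap x]. *)
Definition tmap T1 T2 n1 n2 (A1 : atlas T1 n1) (A2 : atlas T2 n2)
    (f : T1 -> T2) (x : T1) : 'M[R]_(n1, n2) :=
  'J (cmap (chart_at A2 (f x)) \o f \o cinv (chart_at A1 x))
     (cmap (chart_at A1 x) x).

(* A 1-form is a column [s x], acting by [v |-> v *m s x]; a covariant
   2-tensor is a matrix [h x], acting by [(v, w) |-> v *m h x *m w^T]. *)
Definition pullback1 T1 T2 n1 n2 (A1 : atlas T1 n1) (A2 : atlas T2 n2)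
    (f : T1 -> T2) (s : T2 -> 'cV[R]_n2) (x : T1) : 'cV[R]_n1 :=
  tmap A1 A2 f x *m s (f x).

Definition pullback2 T1 T2 n1 n2 (A1 : atlas T1 n1) (A2 : atlas T2 n2)
    (f : T1 -> T2) (h : T2 -> 'M[R]_n2) (x : T1) : 'M[R]_n1 :=
  tmap A1 A2 f x *m h (f x) *m (tmap A1 A2 f x)^T.

(* Components, in an arbitrary chart [c], at the point of coordinates [y]. *)
Definition change_mx T n (A : atlas T n) (c : chart T n) (y : 'rV[R]_n) :=
  'J (transition c (chart_at A (cinv c y))) y.

Definition coord1 T n (A : atlas T n) (c : chart T n) (s : T -> 'cV[R]_n)
    (y : 'rV[R]_n) : 'cV[R]_n :=
  change_mx A c y *m s (cinv c y).

Definition coord2 T n (A : atlas T n) (c : chart T n) (h : T -> 'M[R]_n)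
    (y : 'rV[R]_n) : 'M[R]_n :=
  change_mx A c y *m h (cinv c y) *m (change_mx A c y)^T.

Definition smooth1 T n (A : atlas T n) (s : T -> 'cV[R]_n) : Prop :=
  forall c, charts A c -> forall r i, Ck r (cimg c) (fun y => coord1 A c s y i 0).

Definition smooth2 T n (A : atlas T n) (h : T -> 'M[R]_n) : Prop :=
  forall c, charts A c -> forall r i j, Ck r (cimg c) (fun y => coord2 A c h y i j).

Definition dform1 T n (A : atlas T n) (s : T -> 'cV[R]_n) (x : T) : 'M[R]_n :=
  let c := chart_at A x in
  \matrix_(i, j) (pd i (fun y => coord1 A c s y j 0) (cmap c x)
                - pd j (fun y => coord1 A c s y i 0) (cmap c x)).

Definition closed2 T n (A : atlas T n) (w : T -> 'M[R]_n) : Prop :=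
  forall x i j k, let c := chart_at A x in
    let W i j := (fun y => coord2 A c w y i j) in
    pd i (W j k) (cmap c x) + pd j (W k i) (cmap c x)
      + pd k (W i j) (cmap c x) = 0.

Definition riemannian T n (A : atlas T n) (h : T -> 'M[R]_n) : Prop :=
  [/\ smooth2 A h, forall x, (h x)^T = h x &
      forall x (v : 'rV[R]_n), v != 0 -> 0 < (v *m h x *m v^T) 0 0].

(* [christoffel G k i j] is Gamma^k_ij for the local metric [G]. *)
Definition christoffel n (G : 'rV[R]_n -> 'M[R]_n) (k i j : 'I_n)
    (y : 'rV[R]_n) : R :=
  2^-1 * \sum_l invmx (G y) k l *
    (pd i (fun z => G z j l) y + pd j (fun z => G z i l) y
     - pd l (fun z => G z i j) y).

Definition ricci_coord n (G : 'rV[R]_n -> 'M[R]_n) (y : 'rV[R]_n) : 'M[R]_n :=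
  let Gam := christoffel G in
  \matrix_(i, j)
    (\sum_k (pd k (Gam k i j) y - pd j (Gam k i k) y)
     + \sum_k \sum_l (Gam k k l y * Gam l i j y - Gam k j l y * Gam l i k y)).

Definition ricci T n (A : atlas T n) (h : T -> 'M[R]_n) (x : T) : 'M[R]_n :=
  ricci_coord (coord2 A (chart_at A x) h) (cmap (chart_at A x) x).

Definition einstein T n (A : atlas T n) (h : T -> 'M[R]_n) (lam : R) : Prop :=
  forall x, ricci A h x = lam *: h x.

Definition speed (T : topologicalType) n (A : atlas T n) (h : T -> 'M[R]_n)
    (s : 'rV[R]_1 -> T) (t : 'rV[R]_1) : R :=
  Num.sqrt (pullback2 (euclid 1) A s h t 0 0).

Definition curve_length (T : topologicalType) n (A : atlas T n)
    (h : T -> 'M[R]_n) (s : 'rV[R]_1 -> T) : \bar R :=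
  (\int[lebesgue_measure]_(t in `[0%R, 1%R]) (speed A h s (const_mx t))%:E)%E.

(* [piecewise_path A h x y l]: some piecewise C^1 curve from [x] to [y] has
   length [l]. *)
Inductive piecewise_path (T : topologicalType) n (A : atlas T n)
    (h : T -> 'M[R]_n) : T -> T -> \bar R -> Prop :=
| Path_seg (s : 'rV[R]_1 -> T) (W : set 'rV[R]_1) :
    (forall t : R, 0 <= t <= 1 -> W (const_mx t)) ->
    Ck_map_on (euclid 1) A 1 W s ->
    piecewise_path A h (s (const_mx 0)) (s (const_mx 1)) (curve_length A h s)
| Path_cat x y z l1 l2 :
    piecewise_path A h x y l1 -> piecewise_path A h y z l2 ->
    piecewise_path A h x z (l1 + l2)%E.

Definition riem_dist (T : topologicalType) n (A : atlas T n)
    (h : T -> 'M[R]_n) (x y : T) : \bar R :=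
  ereal_inf [set l | piecewise_path A h x y l].

Definition hausdorff_le (Z : metricType R) (S1 S2 : set Z) (r : R) : Prop :=
  (forall z, S1 z -> exists2 w, S2 w & mdist z w <= r) /\
  (forall w, S2 w -> exists2 z, S1 z & mdist z w <= r).

(* The infimum, over all isometric embeddings into a common metric space, of
   the Hausdorff distance of the images; +oo if there is no such embedding, in
   particular if [dX] or [dY] is not a genuine metric. *)
Definition GH_dist (X Y : Type) (dX : X -> X -> \bar R) (dY : Y -> Y -> \bar R) :
    \bar R :=
  ereal_inf [set r%:E | r in [set r : R | 0 <= r /\
    exists (Z : metricType R) (f : X -> Z) (g : Y -> Z),
      [/\ forall x x', (mdist (f x) (f x'))%:E = dX x x',
          forall y y', (mdist (g y) (g y'))%:E = dY y y' &
          hausdorff_le (range f) (range g) r]]].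

(* Multiplication by i on C^n = R^n (+) R^n, acting on rows (x, y). *)
Definition J0 n : 'M[R]_(n + n) := block_mx 0 1%:M (- 1%:M) 0.

(* The transition maps satisfy the Cauchy-Riemann equations; the complex
   structure of each tangent space is then [J0 n] in every chart. *)
Definition is_complex_manifold (T : topologicalType) n
    (A : atlas T (n + n)) : Prop :=
  is_manifold A /\
  forall c c', charts A c -> charts A c' -> forall y, overlap c c' y ->
    'J (transition c c') y *m J0 n = J0 n *m 'J (transition c c') y.

(* w(u, v) = g(J u, v) *)
Definition kahler_form T n (g : T -> 'M[R]_(n + n)) (x : T) : 'M[R]_(n + n) :=
  J0 n *m g x.

Record kahler_einstein (T : topologicalType) n (A : atlas T (n + n))
    (g : T -> 'M[R]_(n + n)) (lam : R) : Prop := {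
  ke_complex : is_complex_manifold A;
  ke_nonempty : [set: T] !=set0;
  ke_compact : compact [set: T];
  ke_connected : connected [set: T];
  ke_riemannian : riemannian A g;
  ke_hermitian : forall x, J0 n *m g x *m (J0 n)^T = g x;
  ke_closed : closed2 A (kahler_form g);
  ke_einstein : einstein A g lam
}.

(* The standard k-simplex, with vertices 0, e_0, ..., e_(k-1) in R^k. *)
Definition simplex k : set 'rV[R]_k :=
  [set x | (forall i, 0 <= x 0 i) /\ \sum_i x 0 i <= 1].

Definition bary k (x : 'rV[R]_k) (j : 'I_k.+1) : R :=
  if unlift ord0 j is Some l then x 0 l else 1 - \sum_l x 0 l.

(* The affine map onto the face opposite to the i-th vertex. *)
Definition face k (i : 'I_k.+2) (x : 'rV[R]_k) : 'rV[R]_k.+1 :=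
  \row_j (if unlift i (lift ord0 j) is Some l then bary x l else 0).

Definition singular_simplex (T : topologicalType) k (s : 'rV[R]_k -> T) :=
  {within @simplex k, continuous s}.

Definition smooth_simplex (T : topologicalType) n (A : atlas T n) k
    (s : 'rV[R]_k -> T) : Prop :=
  exists2 W, @simplex k `<=` W & smooth_map_on (euclid k) A W s.

(* Simplices are represented by total maps; a cochain may only depend on their
   restriction to the standard simplex. *)
Definition cochain (T : Type) (V : pzRingType) k (c : ('rV[R]_k -> T) -> V) :=
  forall s s', (forall x, simplex x -> s x = s' x) -> c s = c s'.

Definition cobound (T : Type) (V : pzRingType) k (c : ('rV[R]_k -> T) -> V)
    (s : 'rV[R]_k.+1 -> T) : V :=
  \sum_(i < k.+2) (-1) ^+ i * c (s \o face i).

Definition cocycle2 (T : topologicalType) (c : ('rV[R]_2 -> T) -> int) : Prop :=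
  cochain c /\ forall s : 'rV[R]_3 -> T, singular_simplex s -> cobound c s = 0.

Definition cohomologous2 (T : topologicalType) (c c' : ('rV[R]_2 -> T) -> int) :=
  exists2 b : ('rV[R]_1 -> T) -> int, cochain b &
    forall s : 'rV[R]_2 -> T, singular_simplex s -> c s - c' s = cobound b s.

Definition row2 (x y : R) : 'rV[R]_2 := \row_j (if j == 0 then x else y).

Definition simplex_integral (T : topologicalType) n (A : atlas T n)
    (w : T -> 'M[R]_n) (s : 'rV[R]_2 -> T) : R :=
  \int[lebesgue_measure]_(x in `[0%R, 1%R])
    \int[lebesgue_measure]_(y in `[0%R, (1 - x)%R])
      pullback2 (euclid 2) A s w (row2 x y) 0 1.

(* The de Rham class of the closed 2-form [w] is the image of the class of the
   integral cocycle [c]. *)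
Definition represents (T : topologicalType) n (A : atlas T n)
    (w : T -> 'M[R]_n) (c : ('rV[R]_2 -> T) -> int) : Prop :=
  exists2 b : ('rV[R]_1 -> T) -> R, cochain b &
    forall s : 'rV[R]_2 -> T, smooth_simplex A s ->
      simplex_integral A w s = (c s)%:~R + cobound b s.

Definition integral_indivisible (T : topologicalType) n (A : atlas T n)
    (w : T -> 'M[R]_n) : Prop :=
  exists c : ('rV[R]_2 -> T) -> int,
    [/\ cocycle2 c, represents A w c,
        forall k : int, k != 0 -> ~ cohomologous2 (fun s => k * c s) (fun=> 0) &
        forall (k : int) d, cocycle2 d -> cohomologous2 c (fun s => k * d s) ->
          `|k| = 1].

(* The circle is R / 2 pi Z, acting through [act : R -> P -> P]. *)
Definition locally_trivial (P B : topologicalType) d e (AP : atlas P d)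
    (AB : atlas B e) (prj : P -> B) (act : R -> P -> P) (U : set B) : Prop :=
  exists (s : B -> P) (chi : P -> 'rV[R]_2),
    [/\ smooth_map_on AB AP U s,
        smooth_map_on AP (euclid 2) (prj @^-1` U) chi,
        forall b theta, U b -> prj (act theta (s b)) = b /\
          chi (act theta (s b)) = row2 (cos theta) (sin theta) &
        forall x, U (prj x) -> exists theta, x = act theta (s (prj x))].

Record principal_circle_bundle (P B : topologicalType) d e (AP : atlas P d)
    (AB : atlas B e) (prj : P -> B) (act : R -> P -> P) : Prop := {
  pcb_manifold : is_manifold AP;
  pcb_act0 : forall x, act 0 x = x;
  pcb_actD : forall s t x, act (s + t) x = act s (act t x);
  pcb_act2pi : forall x, act (2 * pi) x = x;
  pcb_act_smooth : smooth_map (prod_atlas (euclid 1) AP) AP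
    (fun z : 'rV[R]_1 * P => act (z.1 0 0) z.2);
  pcb_prj_smooth : smooth_map AP AB prj;
  pcb_trivial : forall b, exists U : set B,
    [/\ open U, U b & locally_trivial AP AB prj act U]
}.

Definition orbit_map (P : Type) (act : R -> P -> P) (x : P) : 'rV[R]_1 -> P :=
  fun t => act (t 0 0) x.

(* Normalized to 1 on the generator of the 2 pi-periodic action, so that, by
   Chern-Weil, the Euler class is the class of the form on the base which
   pulls back to d sigma / (2 pi). *)
Record principal_connection (P : topologicalType) d (AP : atlas P d)
    (act : R -> P -> P) (sigma : P -> 'cV[R]_d) : Prop := {
  conn_smooth : smooth1 AP sigma;
  conn_invariant : forall theta x,
    pullback1 AP AP (act theta) sigma x = sigma x;
  conn_normalized : forall x,
    pullback1 (euclid 1) AP (orbit_map act x) sigma 0 0 0 = 1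
}.

Definition base_metric m (M : 'I_m -> topologicalType) (d : 'I_m -> nat)
    (A : forall i, atlas (M i) (d i)) (g : forall i, M i -> 'M[R]_(d i))
    (b : 'I_m -> R) (x : prod_topology M) : 'M[R]_(\sum_i d i)%N :=
  \sum_i b i *: pullback2 (bigprod_atlas A) (A i)
                  (fun z : prod_topology M => z i) (g i) x.

Definition bundle_metric (P : topologicalType) e (AP : atlas P e)
    m (M : 'I_m -> topologicalType) (d : 'I_m -> nat)
    (A : forall i, atlas (M i) (d i)) (prj : P -> prod_topology M)
    (sigma : P -> 'cV[R]_e) (g : forall i, M i -> 'M[R]_(d i))
    (a : R) (b : 'I_m -> R) (x : P) : 'M[R]_e :=
  a *: (sigma x *m (sigma x)^T)
  + \sum_i b i *: pullback2 AP (A i) (fun z => prj z i) (g i) x.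

Definition fibre_radius (P : topologicalType) d (AP : atlas P d)
    (act : R -> P -> P) (h : P -> 'M[R]_d) (x : P) : \bar R :=
  (curve_length AP h (fun t => orbit_map act x ((2 * pi) *: t))
   * ((2 * pi)^-1)%:E)%E.

End Manifolds.

Section Flow.
Context {R : realType} {m : nat} (n p : 'I_m -> nat) (q : 'I_m -> int).

Definition Efun (y : 'I_m -> R) : R :=
  \sum_i (n i)%:R * (q i)%:~R ^+ 2 * y i ^+ 2.

Definition Ffun (y : 'I_m -> R) (i : 'I_m) : R :=
  2 * (p i)%:R * y i - (q i)%:~R ^+ 2 * y i ^+ 2 - Efun y.

(* A solution on [0, +oo); continuity at 0 makes the equation hold at 0 too,
   for the right derivative. *)
Definition Ysolution (Y : R -> 'I_m -> R) : Prop :=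
  forall i, {within `[0, +oo[, continuous (fun u => Y u i)} /\
    forall u : R, 0 < u ->
      is_derive u 1 (fun v => Y v i) (- (Y u i * Ffun (Y u) i)).

Definition a_of (Y : R -> 'I_m -> R) (a0 : R) (u : R) : R :=
  a0 * expR (\int[lebesgue_measure]_(z in `[0, u]) Efun (Y z)).

Definition tau_of (Y : R -> 'I_m -> R) (a0 : R) (u : R) : R :=
  \int[lebesgue_measure]_(z in `[0, u]) a_of Y a0 z.

Definition corresponding (Y : R -> 'I_m -> R) (a0 : R)
    (a : R -> R) (b : 'I_m -> R -> R) : Prop :=
  forall u : R, 0 <= u -> a (tau_of Y a0 u) = a_of Y a0 u /\
    forall i, b i (tau_of Y a0 u) = a_of Y a0 u / Y u i.

(* The backwards flow, existing for all tau >= 0, i.e. for all t <= 0. *)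
Definition ancient_flow (a : R -> R) (b : 'I_m -> R -> R) : Prop :=
  [/\ forall tau, 0 <= tau -> 0 < a tau /\ forall i, 0 < b i tau,
      {within `[0, +oo[, continuous a} /\
        forall i, {within `[0, +oo[, continuous (b i)},
      forall tau : R, 0 < tau -> is_derive tau 1 a
        (\sum_i (n i)%:R * (q i)%:~R ^+ 2 * (a tau ^+ 2 / b i tau ^+ 2)) &
      forall (tau : R) i, 0 < tau -> is_derive tau 1 (b i)
        (2 * (p i)%:R - (q i)%:~R ^+ 2 * (a tau / b i tau))].

Definition admissible_constant (c0 : R) : Prop :=
  0 < c0 /\
  forall Y, Ysolution Y -> (forall (u : R) i, 0 <= u -> 0 <= Y u i) ->
    \sum_i Y 0 i <= c0 ->
    (forall i, Y u i @[u --> +oo] --> 0) /\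
    ((forall (u : R) i, 0 <= u -> 0 < Y u i) ->
     forall a0 a b, 0 < a0 -> corresponding Y a0 a b -> ancient_flow a b).

End Flow.

(* Main.v *)
(* Flow. If q_i^2 Y_i > 2 p_i / (n_i + 1) at some time, then the equations for
   a and b_i make Y_i = a / b_i stay above this value, against Y -> 0. Hence
   2 p_i - q_i^2 Y_i >= 2 n_i p_i / (n_i + 1), which gives the linear bounds on
   b_i. As d(1/a)/dtau = - sum_i n_i q_i^2 / b_i^2 is then integrable at
   infinity, and a / tau <= const * Y_i is small at some late time, 1/a stays
   away from 0; so the increasing function a is bounded, and b_i / tau tends to
   2 p_i. The orbits of the action have constant speed sqrt a, so the fibre
   radius is sqrt a.

   Einstein metric. In a product chart the base metric is block diagonal, hence
   so is its Ricci tensor; the Ricci tensor of a block does not see the factor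
   2 p_i, so it is p_i g_i, half of the metric.

   Collapse. Let dB be the distance of the base and dP that of the rescaled
   total space. The projection is Lipschitz with constant close to 1; conversely
   a curve of the base lifts horizontally with length multiplied by at most a
   constant close to 1, and the end of the lift is joined to any other point of
   its fibre by an arc of length at most 2 pi sqrt (a / tau). As dB is bounded,
   dP and dB o prj differ uniformly by at most 2 r, with r -> 0. Gluing through
   d(x, y) = inf_x' dP(x, x') + r + dB(prj x', y) then embeds both spaces in a
   metric space where they are at Hausdorff distance at most r. Points are
   separated by these distances because a C^1 bump function, supported in a
   chart, changes along a curve by at most a constant times its length. *)
From HB Require Import structures.
Require Import Defs.
From mathcomp Require Import all_boot all_order all_algebra.
From mathcomp Require Import all_classical all_reals all_analysis.
From mathcomp Require Import ring lra.

Set Implicit Arguments.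
Unset Strict Implicit.
Unset Printing Implicit Defensive.

Import Order.TTheory GRing.Theory Num.Theory.
Import numFieldNormedType.Exports.

Local Open Scope classical_set_scope.
Local Open Scope ring_scope.

(** * Maps of class C^1 *)

Section MatrixContinuity.
Context {R : realType} {V : topologicalType}.

(** An atlas attaches to each point a preferred chart that may jump from one point to the next, so
    the matrices [h x] and [tmap A1 A2 f x] need not vary continuously with [x]. Analysis is
    therefore done on representatives in fixed charts, and being C^1 is a pointwise notion,
    independent of the charts that test it. Lengths are turned into increments [G 1 - G 0] of a
    primitive of the speed. An inequality between quadratic forms gives one between speeds, hence
    one between increments, and an induction on piecewise paths carries it to distances. The
    threshold 2 p_i / ((n_i + 1) q_i^2) is the positive zero of F_i once E is cut down to its i-th
    term n_i q_i^2 Y_i^2; the other terms of E only push Y_i further up, so the threshold is a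
    barrier from above. The limit Y -> 0 is known in the variable u, and tau(u) >= a0 u carries it
    to arbitrarily late times tau. To exclude blow-up of [a], the total decrease of 1/a after time t
    is bounded by a constant over t, and a time is chosen at which 1/a exceeds that amount. *)

Lemma continuous_mxP m n (F : V -> 'M[R]_(m, n)) x :
  {for x, continuous F} <-> forall i j, {for x, continuous (fun z => F z i j)}.
Proof.
split=> [cF i j|cF].
  apply: (@continuous_comp _ _ _ F (fun M : 'M[R]_(m, n) => M i j)) => //.
  exact: coord_continuous.
move=> A /= [P FP PA]; apply: filterS.
  by move=> z Pz; apply: PA; exact: Pz.
apply: (@filter_forall _ 'I_m) => i; apply: (@filter_forall _ 'I_n) => j.
exact: cF i j _ (FP i j).
Qed.

Lemma for_continuousD (f g : V -> R) x :
  {for x, continuous f} -> {for x, continuous g} ->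
  {for x, continuous (fun z => f z + g z)}.
Proof. by move=> cf cg; apply: cvgD; [exact: cf|exact: cg]. Qed.

Lemma for_continuousM (f g : V -> R) x :
  {for x, continuous f} -> {for x, continuous g} ->
  {for x, continuous (fun z => f z * g z)}.
Proof. by move=> cf cg; apply: cvgM; [exact: cf|exact: cg]. Qed.

Lemma for_continuous_sum (I : Type) (r : seq I) (f : I -> V -> R) x :
  (forall i, {for x, continuous (f i)}) ->
  {for x, continuous (fun z => \sum_(i <- r) f i z)}.
Proof.
move=> cf; elim: r => [|i r IH].
  rewrite (_ : (fun z => _) = cst 0); first exact: cst_continuous.
  by apply/funext => z; rewrite big_nil.
rewrite (_ : (fun z => _) = (fun z => f i z + \sum_(i <- r) f i z)).
  by apply: cvgD; [exact: cf|exact: IH].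
by apply/funext => z; rewrite big_cons.
Qed.

Lemma continuous_mulmx m n k (F : V -> 'M[R]_(m, n)) (G : V -> 'M[R]_(n, k)) x :
  {for x, continuous F} -> {for x, continuous G} ->
  {for x, continuous (fun z => F z *m G z)}.
Proof.
move=> /continuous_mxP cF /continuous_mxP cG; apply/continuous_mxP => i j.
rewrite (_ : (fun z => _) = (fun z => \sum_l F z i l * G z l j)).
  by apply: for_continuous_sum => l; apply: cvgM; [exact: cF|exact: cG].
by apply/funext => z; rewrite mxE.
Qed.

Lemma continuous_trmx m n (F : V -> 'M[R]_(m, n)) x :
  {for x, continuous F} -> {for x, continuous (fun z => (F z)^T)}.
Proof.
move=> /continuous_mxP cF; apply/continuous_mxP => i j.
rewrite (_ : (fun z => _) = (fun z => F z j i)); first exact: cF.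
by apply/funext => z; rewrite mxE.
Qed.

End MatrixContinuity.

Section C1Functions.
Context {R : realType}.
Implicit Types n k l : nat.

Lemma near_eq_for_continuous (V W : topologicalType) (F G : V -> W) x :
  (\forall z \near x, F z = G z) -> {for x, continuous F} ->
  {for x, continuous G}.
Proof.
move=> FG cF; rewrite /prop_for /continuous_at.
rewrite -(nbhs_singleton FG) => A /cF FA.
have {}FA : nbhs x (F @^-1` A) by [].
suff : nbhs x (G @^-1` A) by [].
by apply: filterS2 FG FA => z /= <-.
Qed.

(** The differential is the only continuous linear part of a first-order expansion at [x], and such
    an expansion sees only the germ of the map. *)
Lemma near_eq_diff (V W : normedModType R) (F G : V -> W) x :
  (\forall z \near x, F z = G z) -> differentiable F x ->
  differentiable G x /\ 'd F x = 'd G x :> (V -> W).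
Proof.
move=> FG dF.
have cdF : continuous ('d F x) by exact: diff_continuous.
have E : G \o shift x = cst (G x) + 'd F x +o_ 0 id.
  apply/eqaddoP => e e0.
  have H0 := (iffLR (eqaddoP _ _ _ _) (diff_locally dF)) e e0.
  have FG0 : \forall z \near 0, F (z + x) = G (z + x).
    have := FG; rewrite (near_shift 0) /=; apply: filterS => z.
    by rewrite /= subr0.
  have FGx := nbhs_singleton FG.
  near=> z; have Fz : F (z + x) = G (z + x) by near: z.
  have : `|(F \o shift x - (cst (F x) + 'd F x)) z| <= e * `|id z| by near: z.
  by rewrite /= !fctE /= Fz FGx.
have E2 := diff_unique cdF E.
split; last exact: (esym E2).
apply/diff_locallyP; split; first exact: (eq_ind_r (fun f : V -> W => continuous f) cdF E2).
exact: (eq_ind_r (fun f : V -> W => G \o shift x = cst (G x) + f +o_ 0 id) E E2).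
Unshelve. all: by end_near. Qed.

Lemma near_eq_jacobian n k (F G : 'rV[R]_n -> 'rV[R]_k) x :
  (\forall z \near x, F z = G z) -> differentiable F x -> 'J F x = 'J G x.
Proof.
move=> FG dF; have [_ E] := near_eq_diff FG dF.
exact: (congr1 (fun f => lin1_mx f) E).
Qed.

Lemma jacobian_comp n k l (F : 'rV[R]_n -> 'rV[R]_k) (G : 'rV[R]_k -> 'rV[R]_l) x :
  differentiable F x -> differentiable G (F x) ->
  'J (G \o F) x = 'J F x *m 'J G (F x).
Proof.
move=> dF dG; apply/row_matrixP => i.
rewrite !rowE mulmxA !mul_rV_lin1 /= diff_comp //.
Qed.

Lemma jacobian_entry n k (F : 'rV[R]_n -> 'rV[R]_k) x i j :
  differentiable F x -> 'J F x i j = pd i (fun z => F z 0 j) x.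
Proof.
move=> dF; rewrite /pd.
have := deriveEjacobian (delta_mx 0 i) dF; rewrite -rowE => /rowP/(_ j).
rewrite mxE => <-; rewrite derive_mx ?mxE //.
exact: diff_derivable.
Qed.

Lemma jacobian_lin n k (f : {linear 'rV[R]_n -> 'rV[R]_k}) x :
  continuous f -> 'J f x = lin1_mx f.
Proof. by move=> cf; rewrite /jacobian diff_lin. Qed.

Lemma differentiable_mulmxr n k (M : 'M[R]_(n, k)) (x : 'rV[R]_n) :
  differentiable (mulmxr M : 'rV[R]_n -> 'rV[R]_k) x /\ 'J (mulmxr M : 'rV[R]_n -> 'rV[R]_k) x = M.
Proof.
have cM : continuous (mulmxr M : 'rV[R]_n -> 'rV[R]_k).
  by move=> y; apply: (@continuous_mulmx R _ _ _ _ id (cst M)) => //; exact: cst_continuous.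
split; first exact: linear_differentiable.
rewrite jacobian_lin //; apply/row_matrixP => i.
by rewrite rowE mul_rV_lin1 /= -rowE.
Qed.

(* A record rather than a definition, so that unification never unfolds it. *)
Record C1v n k (F : 'rV[R]_n -> 'rV[R]_k) (y : 'rV[R]_n) : Prop := C1vI {
  C1v_nbhs : \forall z \near y,
    differentiable F z /\ {for z, continuous (fun w => 'J F w)} }.

Lemma C1v_differentiable n k (F : 'rV[R]_n -> 'rV[R]_k) y :
  C1v F y -> differentiable F y.
Proof. by move=> /C1v_nbhs/nbhs_singleton[]. Qed.

Lemma C1v_jacobian_continuous n k (F : 'rV[R]_n -> 'rV[R]_k) y :
  C1v F y -> {for y, continuous (fun w => 'J F w)}.
Proof. by move=> /C1v_nbhs/nbhs_singleton[]. Qed.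

Lemma C1v_continuous n k (F : 'rV[R]_n -> 'rV[R]_k) y :
  C1v F y -> {for y, continuous F}.
Proof. by move=> /C1v_differentiable; exact: differentiable_continuous. Qed.

Lemma C1v_near n k (F : 'rV[R]_n -> 'rV[R]_k) y :
  C1v F y -> \forall z \near y, C1v F z.
Proof. by move=> /C1v_nbhs/nbhs_interior; apply: filterS => z; split. Qed.

(** Chart representatives of a composite agree with composites of representatives only near a point;
    this lemma absorbs that discrepancy throughout. *)
Lemma near_eq_C1v n k (F G : 'rV[R]_n -> 'rV[R]_k) y :
  (\forall z \near y, F z = G z) -> C1v F y -> C1v G y.
Proof.
move=> FG /C1v_near CF; split; apply: filterS2 (nbhs_interior FG) CF => z FGz CFz.
split; first exact: (near_eq_diff FGz (C1v_differentiable CFz)).1.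
apply: near_eq_for_continuous (C1v_jacobian_continuous CFz).
apply: filterS2 (nbhs_interior FGz) (C1v_near CFz) => w FGw CFw.
exact: near_eq_jacobian (C1v_differentiable CFw).
Qed.

Lemma C1v_comp n k l (F : 'rV[R]_n -> 'rV[R]_k) (G : 'rV[R]_k -> 'rV[R]_l) y :
  C1v F y -> C1v G (F y) -> C1v (G \o F) y.
Proof.
move=> CF CG; have cF := C1v_continuous CF.
have H : \forall z \near y, C1v F z /\ C1v G (F z).
  near=> z; split; near: z; first exact: C1v_near.
  exact: cF (C1v_near CG).
split; apply: filterS (nbhs_interior H) => z Hz.
have [CFz CGz] := nbhs_singleton Hz.
split.
  by apply: differentiable_comp; apply: C1v_differentiable.
apply: (@near_eq_for_continuous _ _ (fun w => 'J F w *m 'J G (F w))).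
  apply: filterS Hz => w [CFw CGw].
  by rewrite jacobian_comp //; apply: C1v_differentiable.
apply: continuous_mulmx; first exact: C1v_jacobian_continuous.
apply: (@continuous_comp _ _ _ F (fun w => 'J G w)); first exact: C1v_continuous.
exact: C1v_jacobian_continuous.
Unshelve. all: by end_near. Qed.

Lemma C1v_mulmxr n k (M : 'M[R]_(n, k)) y : C1v (mulmxr M : 'rV[R]_n -> 'rV[R]_k) y.
Proof.
split; near=> z; split; first exact: (differentiable_mulmxr M z).1.
rewrite (_ : (fun w => _) = cst M); first exact: cst_continuous.
by apply/funext => w; rewrite (differentiable_mulmxr M w).2.
Unshelve. all: by end_near. Qed.

Lemma jacobian_cst n k (c : 'rV[R]_k) (y : 'rV[R]_n) : 'J (cst c) y = 0.
Proof.
by rewrite /jacobian diff_cst; apply/matrixP => i j; rewrite !mxE.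
Qed.

Lemma C1v_cst n k (c : 'rV[R]_k) (y : 'rV[R]_n) : C1v (cst c) y.
Proof.
split; near=> z; split => //.
rewrite (_ : (fun w => _) = cst 0); first exact: cst_continuous.
by apply/funext => w; rewrite jacobian_cst.
Unshelve. all: by end_near. Qed.

Lemma lin1_mxD n k (f g : 'rV[R]_n -> 'rV[R]_k) :
  lin1_mx (f \+ g) = lin1_mx f + lin1_mx g.
Proof. by apply/matrixP => i j; rewrite !mxE. Qed.

Lemma jacobianD n k (F G : 'rV[R]_n -> 'rV[R]_k) x :
  differentiable F x -> differentiable G x ->
  'J (fun z => F z + G z) x = 'J F x + 'J G x.
Proof.
move=> dF dG; transitivity (lin1_mx ('d F x \+ 'd G x)).
  exact: (congr1 (fun f => lin1_mx f) (diffD dF dG)).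
exact: lin1_mxD.
Qed.

Lemma C1vD n k (F G : 'rV[R]_n -> 'rV[R]_k) y : C1v F y -> C1v G y ->
  C1v (fun z => F z + G z) y.
Proof.
move=> /C1v_near CF /C1v_near CG.
have H : \forall z \near y, C1v F z /\ C1v G z.
  by near=> z; split; near: z.
split; apply: filterS (nbhs_interior H) => z Hz.
have [CFz CGz] := nbhs_singleton Hz.
split; first by apply: differentiableD; apply: C1v_differentiable.
apply: (@near_eq_for_continuous _ _ (fun w => 'J F w + 'J G w)).
  apply: filterS Hz => w [CFw CGw].
  by rewrite jacobianD //; apply: C1v_differentiable.
apply/continuous_mxP => i j.
rewrite (_ : (fun w => _) = (fun w => 'J F w i j + 'J G w i j)).
  apply: for_continuousD.
    exact: ((continuous_mxP _ _).1 (C1v_jacobian_continuous CFz) i j).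
  exact: ((continuous_mxP _ _).1 (C1v_jacobian_continuous CGz) i j).
by apply/funext => w; rewrite mxE.
Unshelve. all: by end_near. Qed.

Lemma C1v_sum n k (I : Type) (r : seq I) (F : I -> 'rV[R]_n -> 'rV[R]_k) y :
  (forall i, C1v (F i) y) ->
  C1v (fun z => \sum_(i <- r) F i z) y.
Proof.
move=> CF; elim: r => [|i r IH].
  apply: near_eq_C1v (C1v_cst 0 y); near=> z.
  by rewrite big_nil.
apply: near_eq_C1v (C1vD (CF i) IH); near=> z.
by rewrite big_cons.
Unshelve. all: by end_near. Qed.

(** Entry point from the coordinatewise [Ckv]. [Ck] includes differentiability of each coordinate,
    so [F] is differentiable as the sum of its coordinates times basis vectors, and its Jacobian
    entries are the continuous partial derivatives. *)
Lemma C1v_coord n k (F : 'rV[R]_n -> 'rV[R]_k) (U : set 'rV[R]_n) y :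
  nbhs y U -> Ckv 1 U F -> C1v F y.
Proof.
move=> Uy CF; split; near=> z.
have Uz : nbhs z U by near: z; exact: nbhs_interior.
have dF w : U w -> differentiable F w.
  move=> Uw.
  have -> : F = \sum_(j < k) (fun z => F z 0 j *: (delta_mx 0 j : 'rV[R]_k)).
    apply/funext => v; rewrite fct_sumE; apply/rowP => l.
    rewrite summxE (bigD1 l) //= !mxE !eqxx mulr1 big1 ?addr0 // => j jl.
    by rewrite !mxE eqxx /= eq_sym (negbTE jl) mulr0.
  apply: differentiable_sum => j; apply: differentiableZl.
  exact: (CF j).1.
split; first by apply: dF; exact: nbhs_singleton Uz.
apply/continuous_mxP => i j.
apply: (@near_eq_for_continuous _ _ (pd i (fun z => F z 0 j))).
  by apply: filterS Uz => w Uw; rewrite jacobian_entry //; exact: dF.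
exact: ((CF j).2 i _ (nbhs_singleton Uz)).
Unshelve. all: by end_near. Qed.

Lemma C1v_Ckv n k (F : 'rV[R]_n -> 'rV[R]_k) (U : set 'rV[R]_n) :
  (forall y, U y -> C1v F y) -> Ckv 1 U F.
Proof.
move=> CF j; split=> [y Uy|i y Uy].
  apply: (@differentiable_comp _ _ _ _ F (fun v : 'rV[R]_k => v 0 j)).
    exact/C1v_differentiable/CF.
  exact: differentiable_coord.
apply: (@near_eq_for_continuous _ _ (fun w => 'J F w i j)).
  apply: filterS (C1v_near (CF _ Uy)) => w CFw.
  by rewrite jacobian_entry //; exact: C1v_differentiable.
by move: i j; apply/continuous_mxP/C1v_jacobian_continuous/CF.
Qed.

End C1Functions.

Global Opaque jacobian.

(** * Manifolds of class C^1 *)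

Section ChartLemmas.
Context {R : realType} {T : topologicalType} {n : nat}.
Variables (c : @chart R T n) (hc : is_chart c).

Lemma chart_nbhs x : cdom c x -> nbhs x (cdom c).
Proof. by move=> cx; case: hc => oc _ _ _ _; apply: open_nbhs_nbhs. Qed.

Lemma cimg_nbhs x : cdom c x -> nbhs (cmap c x) (cimg c).
Proof.
move=> cx; case: hc => _ oc _ _ _; apply: open_nbhs_nbhs; split => //.
by exists x.
Qed.

Lemma cmapK x : cdom c x -> cinv c (cmap c x) = x.
Proof. by move=> cx; case: hc => _ _ H _ _; exact: H. Qed.

Lemma cinvK y : cimg c y -> cmap c (cinv c y) = y.
Proof. by move=> [x cx <-]; rewrite cmapK. Qed.

Lemma cinv_dom y : cimg c y -> cdom c (cinv c y).
Proof. by move=> [x cx <-]; rewrite cmapK. Qed.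

Lemma cmap_continuous x : cdom c x -> {for x, continuous (cmap c)}.
Proof. by move=> cx; case: hc => _ _ _ H _; exact: H. Qed.

Lemma cinv_continuous y : cimg c y -> {for y, continuous (cinv c)}.
Proof. by move=> cy; case: hc => _ _ _ _ H; exact: H. Qed.

Lemma chart_push x (P : set 'rV[R]_n) : cdom c x -> nbhs (cmap c x) P ->
  \forall z \near x, cdom c z /\ P (cmap c z).
Proof.
by move=> cx Px; apply: filterI; [exact: chart_nbhs|exact: cmap_continuous Px].
Qed.

Lemma chart_pull x (Q : set T) : cdom c x -> nbhs x Q ->
  \forall y \near cmap c x, cimg c y /\ Q (cinv c y).
Proof.
move=> cx Qx; apply: filterI; first exact: cimg_nbhs.
have cy : cimg c (cmap c x) by exists x.
by apply: (cinv_continuous cy); rewrite cmapK.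
Qed.

End ChartLemmas.

Section C1Manifolds.
Context {R : realType}.

(** The differentiable part of [is_manifold], cut down to C^1 transitions and stated point by point,
    so that it is easily checked for Euclidean spaces and products. *)
Record C1_manifold (T : topologicalType) n (A : @atlas R T n) : Prop := {
  c1_chart : forall c, charts A c -> is_chart c;
  c1_at : forall x, charts A (chart_at A x) /\ cdom (chart_at A x) x;
  c1_trans : forall c c', charts A c -> charts A c' ->
    forall x, cdom c x -> cdom c' x -> C1v (transition c c') (cmap c x)
}.

Lemma is_manifold_C1 (T : topologicalType) n (A : @atlas R T n) :
  is_manifold A -> C1_manifold A.
Proof.
move=> mA; have hc := mfd_chart mA; split; [exact: hc|exact: mfd_chart_at|].
move=> c c' Ac Ac' x cx c'x; apply: (C1v_coord (U := overlap c c')).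
  apply: filterS (chart_pull (hc _ Ac) cx (chart_nbhs (hc _ Ac') c'x)) => y.
  move=> [cy c'y]; exists (cinv c y); last exact: (cinvK (hc _ Ac)).
  by split => //; exact: cinv_dom (hc _ Ac) _ _.
exact: mfd_smooth mA _ _ Ac Ac' 1%N.
Qed.

(** Unlike [tmap], which reads [f] in the preferred charts of [x] and [f x], the charts stay fixed
    here; this version is continuous in [x] for C^1 maps. *)
Definition locm (T1 T2 : Type) n1 n2 (c1 : @chart R T1 n1) (c2 : @chart R T2 n2)
    (f : T1 -> T2) (x : T1) : 'M[R]_(n1, n2) :=
  'J (cmap c2 \o f \o cinv c1) (cmap c1 x).

Record C1at (T1 T2 : topologicalType) n1 n2 (A1 : @atlas R T1 n1)
    (A2 : @atlas R T2 n2) (f : T1 -> T2) (x : T1) : Prop := C1atI {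
  C1at_continuous : {for x, continuous f};
  C1at_loc : forall c1 c2, charts A1 c1 -> charts A2 c2 ->
    cdom c1 x -> cdom c2 (f x) -> C1v (cmap c2 \o f \o cinv c1) (cmap c1 x)
}.

(** The middle chart cancels only on its domain; continuity of [f] keeps nearby points inside it. *)
Lemma near_locrep_comp (T1 T2 T3 : topologicalType) n1 n2 n3
    (c1 : @chart R T1 n1) (c2 : @chart R T2 n2) (c3 : @chart R T3 n3)
    (f : T1 -> T2) (g : T2 -> T3) x :
  is_chart c1 -> is_chart c2 -> cdom c1 x -> cdom c2 (f x) ->
  {for x, continuous f} ->
  \forall y \near cmap c1 x,
    ((cmap c3 \o g \o cinv c2) \o (cmap c2 \o f \o cinv c1)) y
    = (cmap c3 \o (g \o f) \o cinv c1) y.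
Proof.
move=> h1 h2 d1 d2 cf.
have := chart_pull h1 d1 (cf _ (chart_nbhs h2 d2)); apply: filterS => y [_ c2y].
by rewrite /= cmapK.
Qed.

Section Composition.
Context {T1 T2 T3 : topologicalType} {n1 n2 n3 : nat}.
Context {A1 : @atlas R T1 n1} {A2 : @atlas R T2 n2} {A3 : @atlas R T3 n3}.
Hypotheses (m1 : C1_manifold A1) (m2 : C1_manifold A2).

Lemma C1at_comp (f : T1 -> T2) (g : T2 -> T3) x :
  C1at A1 A2 f x -> C1at A2 A3 g (f x) -> C1at A1 A3 (g \o f) x.
Proof.
move=> [cf Cf] [cg Cg]; split; first exact: continuous_comp.
move=> c1 c3 Ac1 Ac3 d1 d3; have [Ac2 d2] := c1_at m2 (f x).
apply: near_eq_C1v (near_locrep_comp c3 g (c1_chart m1 Ac1) (c1_chart m2 Ac2) d1 d2 cf) _.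
apply: C1v_comp; first exact: Cf.
by rewrite /= (cmapK (c1_chart m1 Ac1)) //; exact: Cg.
Qed.

Lemma locm_comp (f : T1 -> T2) (g : T2 -> T3) x c1 c2 c3 :
  C1at A1 A2 f x -> C1at A2 A3 g (f x) ->
  charts A1 c1 -> charts A2 c2 -> charts A3 c3 ->
  cdom c1 x -> cdom c2 (f x) -> cdom c3 (g (f x)) ->
  locm c1 c3 (g \o f) x = locm c1 c2 f x *m locm c2 c3 g (f x).
Proof.
move=> [cf Cf] [cg Cg] Ac1 Ac2 Ac3 d1 d2 d3.
have C1 := Cf _ _ Ac1 Ac2 d1 d2; have C2 := Cg _ _ Ac2 Ac3 d2 d3.
have E : (cmap c2 \o f \o cinv c1) (cmap c1 x) = cmap c2 (f x).
  by rewrite /= (cmapK (c1_chart m1 Ac1)).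
rewrite /locm -(near_eq_jacobian (near_locrep_comp c3 g (c1_chart m1 Ac1)
  (c1_chart m2 Ac2) d1 d2 cf)).
  by rewrite jacobian_comp ?E //; exact: C1v_differentiable.
by apply: differentiable_comp; rewrite ?E; exact: C1v_differentiable.
Qed.

End Composition.

Lemma C1at_id (T : topologicalType) n (A : @atlas R T n) x :
  C1_manifold A -> C1at A A id x.
Proof. by move=> mA; split => // c1 c2 A1 A2 d1 d2; exact: (c1_trans mA A1 A2 d1 d2). Qed.

Lemma jacobian_id n (y : 'rV[R]_n) : 'J (@idfun 'rV[R]_n) y = 1%:M.
Proof.
rewrite -(differentiable_mulmxr 1%:M y).2; congr ('J _ y).
by apply/funext => z /=; rewrite mulmx1.
Qed.

Lemma locm_id (T : topologicalType) n (c : @chart R T n) x :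
  is_chart c -> cdom c x -> locm c c id x = 1%:M.
Proof.
move=> hc dc; rewrite -(jacobian_id (cmap c x)); apply/esym/near_eq_jacobian => //.
by apply: filterS (cimg_nbhs hc dc) => y cy; rewrite /= (cinvK hc).
Qed.

Section OneChart.
Context {T1 T2 : topologicalType} {n1 n2 : nat}.
Context {A1 : @atlas R T1 n1} {A2 : @atlas R T2 n2}.
Hypotheses (m1 : C1_manifold A1) (m2 : C1_manifold A2).

(** Any other representative is, near the point, the given one sandwiched between two C^1 transition
    maps. *)
Lemma C1at_one (f : T1 -> T2) x c1 c2 : {for x, continuous f} ->
  charts A1 c1 -> charts A2 c2 -> cdom c1 x -> cdom c2 (f x) ->
  C1v (cmap c2 \o f \o cinv c1) (cmap c1 x) -> C1at A1 A2 f x.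
Proof.
move=> cf Ac1 Ac2 d1 d2 Cf; split => // b1 b2 Ab1 Ab2 e1 e2.
have h1 := c1_chart m1 Ac1; have h2 := c1_chart m2 Ac2.
have k1 := c1_chart m1 Ab1; have k2 := c1_chart m2 Ab2.
have S1 := @near_locrep_comp _ _ _ _ _ _ b1 c1 c2 id f x k1 h1 e1 d1 (fun _ H => H).
have S2 := @near_locrep_comp _ _ _ _ _ _ b1 c2 b2 f id x k1 h2 e1 d2 cf.
apply: near_eq_C1v S2 _; apply: C1v_comp.
  apply: near_eq_C1v S1 _; apply: C1v_comp; first exact: (c1_trans m1 Ab1 Ac1).
  by rewrite /= (cmapK k1).
by rewrite /= (cmapK k1) //; exact: (c1_trans m2 Ac2 Ab2).
Qed.

(** Openness of the set of C^1 points is what later provides the open parameter domain demanded by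
    [Ck_map_on]. *)
Lemma C1at_near (f : T1 -> T2) x : C1at A1 A2 f x ->
  \forall z \near x, C1at A1 A2 f z.
Proof.
move=> [cf Cf]; have [Ac1 d1] := c1_at m1 x; have [Ac2 d2] := c1_at m2 (f x).
set c1 := chart_at A1 x in Ac1 d1; set c2 := chart_at A2 (f x) in Ac2 d2.
have h1 := c1_chart m1 Ac1; have h2 := c1_chart m2 Ac2.
have Cn := C1v_near (Cf _ _ Ac1 Ac2 d1 d2).
have N1 := chart_push h1 d1 Cn; have N2 := cf _ (chart_nbhs h2 d2).
have N12 : \forall z \near x, (cdom c1 z /\ C1v (cmap c2 \o f \o cinv c1) (cmap c1 z))
  /\ cdom c2 (f z) by near=> z; split; near: z.
have := nbhs_interior N12; apply: filterS => z Nz.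
have [[d1z Cz] d2z] := nbhs_singleton Nz.
apply: (C1at_one (c1 := c1) (c2 := c2)) => //.
(* Continuity of [f] is assumed at [x] only; at nearby points it is recovered by writing [f] as its
   representative conjugated by the two charts. *)
apply: (@near_eq_for_continuous _ _ (cinv c2 \o ((cmap c2 \o f \o cinv c1) \o cmap c1))).
  by apply: filterS Nz => w [[d1w _] d2w]; rewrite /= (cmapK h1) // (cmapK h2).
have cc1 := cmap_continuous h1 d1z.
apply: continuous_comp; last first.
  by apply: (cinv_continuous h2); exists (f z) => //; rewrite /= (cmapK h1).
by apply: continuous_comp; [exact: cc1|exact: C1v_continuous].
Unshelve. all: by end_near. Qed.

Lemma near_eq_locm (f g : T1 -> T2) x c1 c2 : (\forall z \near x, f z = g z) ->
  C1at A1 A2 f x -> charts A1 c1 -> charts A2 c2 -> cdom c1 x -> cdom c2 (f x) ->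
  locm c1 c2 f x = locm c1 c2 g x.
Proof.
move=> fg [cf Cf] Ac1 Ac2 d1 d2; apply: near_eq_jacobian.
  have N := chart_pull (c1_chart m1 Ac1) d1 fg.
  by apply: filterS N => y [_ /= ->].
exact/C1v_differentiable/Cf.
Qed.

Lemma Ck_map_on_C1at (W : set T1) (f : T1 -> T2) x :
  Ck_map_on A1 A2 1 W f -> W x -> C1at A1 A2 f x.
Proof.
move=> [oW cf Cf] Wx; split; first exact: cf.
move=> c1 c2 Ac1 Ac2 d1 d2; apply: C1v_coord (Cf _ _ Ac1 Ac2).
have h1 := c1_chart m1 Ac1; have h2 := c1_chart m2 Ac2.
have N1 : nbhs x W by apply: open_nbhs_nbhs.
have N2 := cf x Wx _ (chart_nbhs h2 d2).
have N : nbhs x (W `&` f @^-1` cdom c2) by apply: filterI.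
apply: filterS (chart_pull h1 d1 N) => y [cy [Wy c2y]].
exists (cinv c1 y); last exact: cinvK.
by split => //; split => //; exact: cinv_dom.
Qed.

Lemma C1at_Ck_map_on (W : set T1) (f : T1 -> T2) :
  open W -> (forall x, W x -> C1at A1 A2 f x) -> Ck_map_on A1 A2 1 W f.
Proof.
move=> oW Cf; split => // [x Wx|c1 c2 Ac1 Ac2]; first by case: (Cf x Wx).
by apply: C1v_Ckv => _ [x [[Wx d1] d2] <-]; case: (Cf x Wx) => _; exact.
Qed.

Lemma C1at_cst (t : T2) x : C1at A1 A2 (cst t) x.
Proof.
split; first exact: cst_continuous.
move=> c1 c2 _ _ _ _; exact: C1v_cst (cmap c2 t) _.
Qed.

End OneChart.
End C1Manifolds.

(** * Tangent maps and tensors *)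

Section TangentMaps.
Context {R : realType}.

Section Two.
Context {T1 T2 : topologicalType} {n1 n2 : nat}.
Context {A1 : @atlas R T1 n1} {A2 : @atlas R T2 n2}.
Hypotheses (m1 : C1_manifold A1) (m2 : C1_manifold A2).

Lemma tmapE (f : T1 -> T2) x :
  tmap A1 A2 f x = locm (chart_at A1 x) (chart_at A2 (f x)) f x.
Proof. by []. Qed.

Lemma change_mxE c x : charts A1 c -> cdom c x ->
  change_mx A1 c (cmap c x) = locm c (chart_at A1 x) id x.
Proof. by move=> Ac cx; rewrite /change_mx (cmapK (c1_chart m1 Ac)). Qed.

(** The identity read from [c] to the preferred chart and back has product 1 by the chain rule. *)
Lemma change_mx_unit c x : charts A1 c -> cdom c x ->
  change_mx A1 c (cmap c x) \in unitmx.
Proof.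
move=> Ac cx; rewrite change_mxE //; have [Ac' c'x] := c1_at m1 x.
have := locm_comp m1 m1 (C1at_id x m1) (C1at_id x m1) Ac Ac' Ac cx c'x cx.
rewrite locm_id //; last exact: (c1_chart m1).
by move=> E; exact: (mulmx1_unit (esym E)).1.
Qed.

(** Both sides are the Jacobian of [f] read from [c1] to the preferred chart of [f x]: the chain
    rule is applied once with the identity before [f], once with the identity after it. *)
Lemma tmap_change (f : T1 -> T2) x c1 c2 : C1at A1 A2 f x ->
  charts A1 c1 -> charts A2 c2 -> cdom c1 x -> cdom c2 (f x) ->
  change_mx A1 c1 (cmap c1 x) *m tmap A1 A2 f x
  = locm c1 c2 f x *m change_mx A2 c2 (cmap c2 (f x)).
Proof.
move=> Cf Ac1 Ac2 d1 d2; rewrite change_mxE // tmapE.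
have [Ab1 e1] := c1_at m1 x; have [Ab2 e2] := c1_at m2 (f x).
rewrite -(locm_comp m1 m1 (C1at_id x m1) Cf Ac1 Ab1 Ab2 d1 e1 e2).
rewrite /change_mx (cmapK (c1_chart m2 Ac2)) //.
by rewrite -(locm_comp m1 m2 Cf (C1at_id _ m2) Ac1 Ac2 Ab2 d1 d2 e2).
Qed.

End Two.

Lemma tmap_comp (T1 T2 T3 : topologicalType) (n1 n2 n3 : nat)
    (A1 : @atlas R T1 n1) (A2 : @atlas R T2 n2) (A3 : @atlas R T3 n3) f g x :
  C1_manifold A1 -> C1_manifold A2 -> C1_manifold A3 ->
  C1at A1 A2 f x -> C1at A2 A3 g (f x) ->
  tmap A1 A3 (g \o f) x = tmap A1 A2 f x *m tmap A2 A3 g (f x).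
Proof.
move=> m1 m2 m3 Cf Cg.
have [Ab1 e1] := c1_at m1 x; have [Ab2 e2] := c1_at m2 (f x).
have [Ab3 e3] := c1_at m3 (g (f x)).
exact: (locm_comp m1 m2 Cf Cg Ab1 Ab2 Ab3 e1 e2 e3).
Qed.

Lemma tmap_id (T : topologicalType) n (A : @atlas R T n) x :
  C1_manifold A -> tmap A A id x = 1%:M.
Proof. by move=> mA; have [Ac cx] := c1_at mA x; exact: locm_id (c1_chart mA Ac) cx. Qed.

Lemma near_eq_tmap (T1 T2 : topologicalType) (n1 n2 : nat)
    (A1 : @atlas R T1 n1) (A2 : @atlas R T2 n2) (f g : T1 -> T2) x :
  C1_manifold A1 -> C1_manifold A2 -> (\forall z \near x, f z = g z) ->
  C1at A1 A2 f x -> tmap A1 A2 f x = tmap A1 A2 g x.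
Proof.
move=> m1 m2 fg Cf; have [Ab1 e1] := c1_at m1 x; have [Ab2 e2] := c1_at m2 (f x).
rewrite !tmapE -(nbhs_singleton fg).
exact: (near_eq_locm m1 fg Cf Ab1 Ab2 e1 e2).
Qed.

Lemma tmap_cst (T1 T2 : topologicalType) (n1 n2 : nat)
    (A1 : @atlas R T1 n1) (A2 : @atlas R T2 n2) (t : T2) x :
  tmap A1 A2 (cst t) x = 0.
Proof. exact: (jacobian_cst (cmap (chart_at A2 t) t)). Qed.

Lemma pullback2_comp (T1 T2 T3 : topologicalType) (n1 n2 n3 : nat)
    (A1 : @atlas R T1 n1) (A2 : @atlas R T2 n2) (A3 : @atlas R T3 n3) f g h x :
  C1_manifold A1 -> C1_manifold A2 -> C1_manifold A3 ->
  C1at A1 A2 f x -> C1at A2 A3 g (f x) ->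
  pullback2 A1 A3 (g \o f) h x = pullback2 A1 A2 f (pullback2 A2 A3 g h) x.
Proof.
move=> m1 m2 m3 Cf Cg; rewrite /pullback2 (tmap_comp m1 m2 m3 Cf Cg) trmx_mul.
by rewrite !mulmxA.
Qed.

Lemma pullback1_comp (T1 T2 T3 : topologicalType) (n1 n2 n3 : nat)
    (A1 : @atlas R T1 n1) (A2 : @atlas R T2 n2) (A3 : @atlas R T3 n3) f g h x :
  C1_manifold A1 -> C1_manifold A2 -> C1_manifold A3 ->
  C1at A1 A2 f x -> C1at A2 A3 g (f x) ->
  pullback1 A1 A3 (g \o f) h x = pullback1 A1 A2 f (pullback1 A2 A3 g h) x.
Proof. by move=> m1 m2 m3 Cf Cg; rewrite /pullback1 (tmap_comp m1 m2 m3 Cf Cg) mulmxA. Qed.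

(** Continuity is required of the components in a fixed chart, because the values of [s] are written
    in frames that depend on the point. *)
Definition C0tensor1 (T : topologicalType) n (A : @atlas R T n) (s : T -> 'cV[R]_n) (x : T) :=
  forall c, charts A c -> cdom c x -> {for cmap c x, continuous (coord1 A c s)}.

Definition C0tensor2 (T : topologicalType) n (A : @atlas R T n) (h : T -> 'M[R]_n) (x : T) :=
  forall c, charts A c -> cdom c x -> {for cmap c x, continuous (coord2 A c h)}.

Lemma smooth1_C0 (T : topologicalType) n (A : @atlas R T n) s x :
  smooth1 A s -> C0tensor1 A s x.
Proof.
move=> ss c Ac cx; apply/continuous_mxP => i j; rewrite (ord1 j).
by apply: (ss c Ac 0%N i); exists x.
Qed.

Lemma smooth2_C0 (T : topologicalType) n (A : @atlas R T n) h x :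
  smooth2 A h -> C0tensor2 A h x.
Proof.
move=> ss c Ac cx; apply/continuous_mxP => i j.
by apply: (ss c Ac 0%N i j); exists x.
Qed.

Section PullbackCoord.
Context {T1 T2 : topologicalType} {n1 n2 : nat}.
Context {A1 : @atlas R T1 n1} {A2 : @atlas R T2 n2}.
Hypotheses (m1 : C1_manifold A1) (m2 : C1_manifold A2).
Variables (f : T1 -> T2) (x : T1).
Hypothesis Cf : C1at A1 A2 f x.

Lemma coord2_pullback h c1 c2 :
  charts A1 c1 -> charts A2 c2 -> cdom c1 x -> cdom c2 (f x) ->
  coord2 A1 c1 (pullback2 A1 A2 f h) (cmap c1 x)
  = locm c1 c2 f x *m coord2 A2 c2 h (cmap c2 (f x)) *m (locm c1 c2 f x)^T.
Proof.
move=> Ac1 Ac2 d1 d2; rewrite /coord2 /pullback2.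
rewrite (cmapK (c1_chart m1 Ac1)) // (cmapK (c1_chart m2 Ac2)) //.
rewrite !mulmxA (tmap_change m1 m2 Cf Ac1 Ac2 d1 d2).
rewrite -!mulmxA -!trmx_mul; congr (_ *m (_ *m (_ *m _))).
by rewrite (tmap_change m1 m2 Cf Ac1 Ac2 d1 d2).
Qed.

Lemma coord1_pullback s c1 c2 :
  charts A1 c1 -> charts A2 c2 -> cdom c1 x -> cdom c2 (f x) ->
  coord1 A1 c1 (pullback1 A1 A2 f s) (cmap c1 x)
  = locm c1 c2 f x *m coord1 A2 c2 s (cmap c2 (f x)).
Proof.
move=> Ac1 Ac2 d1 d2; rewrite /coord1 /pullback1.
rewrite (cmapK (c1_chart m1 Ac1)) // (cmapK (c1_chart m2 Ac2)) //.
by rewrite !mulmxA (tmap_change m1 m2 Cf Ac1 Ac2 d1 d2).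
Qed.

End PullbackCoord.

Section PullbackC0.
Context {T1 T2 : topologicalType} {n1 n2 : nat}.
Context {A1 : @atlas R T1 n1} {A2 : @atlas R T2 n2}.
Hypotheses (m1 : C1_manifold A1) (m2 : C1_manifold A2).

Lemma locm_continuous (f : T1 -> T2) x c1 c2 : C1at A1 A2 f x ->
  charts A1 c1 -> charts A2 c2 -> cdom c1 x -> cdom c2 (f x) ->
  {for cmap c1 x, continuous (fun y => locm c1 c2 f (cinv c1 y))}.
Proof.
move=> [_ Cf] Ac1 Ac2 d1 d2.
have h1 := c1_chart m1 Ac1.
apply: near_eq_for_continuous (C1v_jacobian_continuous (Cf _ _ Ac1 Ac2 d1 d2)).
apply: filterS (cimg_nbhs h1 d1) => y cy.
by rewrite /locm (cinvK h1 cy).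
Qed.

Lemma coord_comp_continuous (f : T1 -> T2) x c1 c2 k l (F : 'rV[R]_n2 -> 'M[R]_(k, l)) :
  {for x, continuous f} ->
  charts A1 c1 -> charts A2 c2 -> cdom c1 x -> cdom c2 (f x) ->
  {for cmap c2 (f x), continuous F} ->
  {for cmap c1 x, continuous (fun y => F (cmap c2 (f (cinv c1 y))))}.
Proof.
move=> cf Ac1 Ac2 d1 d2 cF.
have h1 := c1_chart m1 Ac1; have h2 := c1_chart m2 Ac2.
have E := cmapK h1 d1.
have ci : {for cmap c1 x, continuous (cinv c1)}.
  by apply: cinv_continuous => //; exists x.
have cfi : {for cmap c1 x, continuous (f \o cinv c1)}.
  by apply: (continuous_comp ci); rewrite E.
have cmfi : {for cmap c1 x, continuous (cmap c2 \o (f \o cinv c1))}.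
  by apply: (continuous_comp cfi); apply: cmap_continuous => //=; rewrite E.
by apply: (continuous_comp cmfi); rewrite /= E.
Qed.

Lemma near_chart_C1at (f : T1 -> T2) x c1 c2 : C1at A1 A2 f x ->
  charts A1 c1 -> charts A2 c2 -> cdom c1 x -> cdom c2 (f x) ->
  \forall y \near cmap c1 x, [/\ cimg c1 y, C1at A1 A2 f (cinv c1 y) &
     cdom c2 (f (cinv c1 y))].
Proof.
move=> Cf Ac1 Ac2 d1 d2.
have h1 := c1_chart m1 Ac1; have h2 := c1_chart m2 Ac2.
have N1 := C1at_near m1 m2 Cf.
have N2 := C1at_continuous Cf (chart_nbhs h2 d2).
have N : nbhs x (C1at A1 A2 f `&` f @^-1` cdom c2) by apply: filterI.
by apply: filterS (chart_pull h1 d1 N) => y [cy [Cy c2y]]; split.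
Qed.

Lemma pullback2_C0 (f : T1 -> T2) h x : C1at A1 A2 f x ->
  C0tensor2 A2 h (f x) -> C0tensor2 A1 (pullback2 A1 A2 f h) x.
Proof.
move=> Cf ch c1 Ac1 d1; have [Ac2 d2] := c1_at m2 (f x).
set c2 := chart_at A2 (f x) in Ac2 d2.
have h1 := c1_chart m1 Ac1; have h2 := c1_chart m2 Ac2.
pose L y := locm c1 c2 f (cinv c1 y).
apply: (@near_eq_for_continuous _ _ (fun y => L y *m
  coord2 A2 c2 h (cmap c2 (f (cinv c1 y))) *m (L y)^T)).
  apply: filterS (near_chart_C1at Cf Ac1 Ac2 d1 d2) => y [cy Cy c2y].
  have := coord2_pullback m1 m2 Cy h Ac1 Ac2 (cinv_dom h1 cy) c2y.
  by rewrite (cinvK h1 cy) => ->.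
have cL : {for cmap c1 x, continuous L} by exact: locm_continuous.
apply: continuous_mulmx; last exact: continuous_trmx cL.
apply: (continuous_mulmx cL).
exact: coord_comp_continuous (C1at_continuous Cf) Ac1 Ac2 d1 d2 (ch _ Ac2 d2).
Qed.

Lemma pullback1_C0 (f : T1 -> T2) s x : C1at A1 A2 f x ->
  C0tensor1 A2 s (f x) -> C0tensor1 A1 (pullback1 A1 A2 f s) x.
Proof.
move=> Cf ch c1 Ac1 d1; have [Ac2 d2] := c1_at m2 (f x).
set c2 := chart_at A2 (f x) in Ac2 d2.
have h1 := c1_chart m1 Ac1; have h2 := c1_chart m2 Ac2.
pose L y := locm c1 c2 f (cinv c1 y).
apply: (@near_eq_for_continuous _ _ (fun y => L y *m
  coord1 A2 c2 s (cmap c2 (f (cinv c1 y))))).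
  apply: filterS (near_chart_C1at Cf Ac1 Ac2 d1 d2) => y [cy Cy c2y].
  have := coord1_pullback m1 m2 Cy s Ac1 Ac2 (cinv_dom h1 cy) c2y.
  by rewrite (cinvK h1 cy) => ->.
have cL : {for cmap c1 x, continuous L} by exact: locm_continuous.
apply: (continuous_mulmx cL).
exact: coord_comp_continuous (C1at_continuous Cf) Ac1 Ac2 d1 d2 (ch _ Ac2 d2).
Qed.

End PullbackC0.

Lemma C0tensor2D (T : topologicalType) n (A : @atlas R T n) h k x :
  C0tensor2 A h x -> C0tensor2 A k x -> C0tensor2 A (fun z => h z + k z) x.
Proof.
move=> ch ck c Ac cx; apply/continuous_mxP => i j.
rewrite (_ : (fun z => _) = (fun z => coord2 A c h z i j + coord2 A c k z i j)).
  apply: for_continuousD.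
    exact: ((continuous_mxP _ _).1 (ch c Ac cx) i j).
  exact: ((continuous_mxP _ _).1 (ck c Ac cx) i j).
by apply/funext => z; rewrite /coord2 mulmxDr mulmxDl mxE.
Qed.

Lemma C0tensor2Z (T : topologicalType) n (A : @atlas R T n) a h x :
  C0tensor2 A h x -> C0tensor2 A (fun z => a *: h z) x.
Proof.
move=> ch c Ac cx; apply/continuous_mxP => i j.
rewrite (_ : (fun z => _) = (fun z => cst a z * coord2 A c h z i j)).
  apply: for_continuousM; first exact: cst_continuous.
  exact: ((continuous_mxP _ _).1 (ch c Ac cx) i j).
by apply/funext => z; rewrite /coord2 -scalemxAr -scalemxAl mxE.
Qed.

Lemma C0tensor2_sum (T : topologicalType) n (A : @atlas R T n) (I : Type) (r : seq I) h x :
  (forall i, C0tensor2 A (h i) x) -> C0tensor2 A (fun z => \sum_(i <- r) h i z) x.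
Proof.
move=> ch; elim: r => [|i r IH].
  move=> c Ac cx; rewrite (_ : coord2 _ _ _ = cst 0); first exact: cst_continuous.
  by apply/funext => z; rewrite /coord2 big_nil mulmx0 mul0mx.
rewrite (_ : (fun z => _) = (fun z => h i z + \sum_(i <- r) h i z)).
  exact: (C0tensor2D (ch i) IH).
by apply/funext => z; rewrite big_cons.
Qed.

Lemma C0tensor1_square (T : topologicalType) n (A : @atlas R T n) (s : T -> 'cV[R]_n) x :
  C0tensor1 A s x -> C0tensor2 A (fun z => s z *m (s z)^T) x.
Proof.
move=> cs c Ac cx.
rewrite (_ : coord2 _ _ _ = fun z => coord1 A c s z *m (coord1 A c s z)^T).
  apply: continuous_mulmx; first exact: cs.
  by apply: continuous_trmx; exact: cs.
by apply/funext => z; rewrite /coord2 /coord1 trmx_mul !mulmxA.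
Qed.

Section Euclid.
Context {k : nat}.

Lemma euclid_manifold : C1_manifold (@euclid R k).
Proof.
split => [c -> | x | c c' -> -> x _ _].
- split => /=; rewrite ?/cimg /= ?image_id; try exact: openT.
  + by [].
  + by move=> x _ A0.
  + by move=> x _ A0.
- by split.
- apply: near_eq_C1v (C1v_mulmxr 1%:M _); near=> z.
  by rewrite /= mulmx1.
Unshelve. all: by end_near. Qed.

Lemma coord2_euclid h y :
  coord2 (@euclid R k) (Chart setT id id) h y = h y.
Proof.
have E : change_mx (@euclid R k) (Chart setT id id) y = 1%:M by exact: jacobian_id.
by rewrite /coord2 E mul1mx trmx1 mulmx1.
Qed.

Lemma coord1_euclid s y :
  coord1 (@euclid R k) (Chart setT id id) s y = s y.
Proof.
have E : change_mx (@euclid R k) (Chart setT id id) y = 1%:M by exact: jacobian_id.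
by rewrite /coord1 E mul1mx.
Qed.

End Euclid.

Lemma C1at_euclid n k (F : 'rV[R]_n -> 'rV[R]_k) y :
  C1v F y <-> C1at (@euclid R n) (@euclid R k) F y.
Proof.
split=> [CF|[_ CF]]; last exact: (CF (Chart setT id id) (Chart setT id id)).
split; first exact: C1v_continuous.
by move=> c1 c2 -> -> _ _; exact: CF.
Qed.

Lemma C0tensor2_euclid k (h : 'rV[R]_k -> 'M[R]_k) x :
  C0tensor2 (@euclid R k) h x -> {for x, continuous h}.
Proof.
move=> /(_ (Chart setT id id) erefl I) /=.
by rewrite (_ : coord2 _ _ _ = h)//; apply/funext => y; rewrite coord2_euclid.
Qed.

Lemma C0tensor1_euclid k (s : 'rV[R]_k -> 'cV[R]_k) x :
  C0tensor1 (@euclid R k) s x -> {for x, continuous s}.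
Proof.
move=> /(_ (Chart setT id id) erefl I) /=.
by rewrite (_ : coord1 _ _ _ = s)//; apply/funext => y; rewrite coord1_euclid.
Qed.

End TangentMaps.

Global Opaque locm.

(** * Product manifolds *)

Section BlockRows.
Context {R : realType}.

(** Extracting and assembling blocks become right multiplications by constant matrices, so that
    continuity and Jacobians follow from the case of [mulmxr]. *)
Lemma lsubmxE m n1 n2 (y : 'M[R]_(m, n1 + n2)) : lsubmx y = y *m col_mx 1%:M 0.
Proof. by rewrite -{2}[y]hsubmxK mul_row_col mulmx1 mulmx0 addr0. Qed.

Lemma rsubmxE m n1 n2 (y : 'M[R]_(m, n1 + n2)) : rsubmx y = y *m col_mx 0 1%:M.
Proof. by rewrite -{2}[y]hsubmxK mul_row_col mulmx1 mulmx0 add0r. Qed.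

Lemma row_mxE m n1 n2 (a : 'M[R]_(m, n1)) (b : 'M[R]_(m, n2)) :
  row_mx a b = a *m row_mx 1%:M 0 + b *m row_mx 0 1%:M.
Proof. by rewrite !mul_mx_row !mulmx1 !mulmx0 add_row_mx addr0 add0r. Qed.

Lemma submxrowE m k (d : 'I_k -> nat) (y : 'M[R]_(m, \sum_i d i)) j :
  submxrow y j = y *m submxrow 1%:M j.
Proof. by rewrite mul_submxrow mulmx1. Qed.

Lemma mxrowE m k (d : 'I_k -> nat) (F : forall i, 'M[R]_(m, d i)) :
  \mxrow_i F i = \sum_i F i *m submxcol 1%:M i.
Proof.
rewrite -mul_mxrow_mxcol (_ : \mxcol_i _ = 1%:M) ?mulmx1 //.
by rewrite submxcolK.
Qed.

Lemma continuous_mulmxr (V : topologicalType) m n k (F : V -> 'M[R]_(m, n)) (M : 'M[R]_(n, k)) x :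
  {for x, continuous F} -> {for x, continuous (fun z => F z *m M)}.
Proof. by move=> cF; apply: (continuous_mulmx cF); exact: cst_continuous. Qed.

Lemma C1v_postmul n k l (F : 'rV[R]_n -> 'rV[R]_k) (M : 'M[R]_(k, l)) y :
  C1v F y -> C1v (fun z => F z *m M) y /\ 'J (fun z => F z *m M) y = 'J F y *m M.
Proof.
move=> CF; split; first exact: (C1v_comp CF (C1v_mulmxr M (F y))).
have := jacobian_comp (C1v_differentiable CF) (differentiable_mulmxr M (F y)).1.
by rewrite (differentiable_mulmxr M (F y)).2.
Qed.

Lemma C1v_row_mx n k1 k2 (F : 'rV[R]_n -> 'rV[R]_k1) (G : 'rV[R]_n -> 'rV[R]_k2) y :
  C1v F y -> C1v G y -> C1v (fun z => row_mx (F z) (G z)) y /\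
  'J (fun z => row_mx (F z) (G z)) y = row_mx ('J F y) ('J G y).
Proof.
move=> CF CG.
have [C1 J1] := C1v_postmul (row_mx 1%:M (0 : 'M[R]_(k1, k2))) CF.
have [C2 J2] := C1v_postmul (row_mx (0 : 'M[R]_(k2, k1)) 1%:M) CG.
rewrite (_ : (fun z => _) = (fun z => F z *m row_mx 1%:M 0 + G z *m row_mx 0 1%:M)).
  split; first exact: C1vD C1 C2.
  rewrite jacobianD ?J1 ?J2 -?row_mxE //; first exact: C1v_differentiable C1.
  exact: C1v_differentiable C2.
by apply/funext => z; exact: row_mxE.
Qed.

Lemma C1v_mxrow n k (d : 'I_k -> nat) (F : forall i, 'rV[R]_n -> 'rV[R]_(d i)) y :
  (forall i, C1v (F i) y) -> C1v (fun z => \mxrow_i F i z) y.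
Proof.
move=> CF.
have CS := C1v_sum (index_enum 'I_k)
  (fun i => (C1v_postmul (submxcol 1%:M i) (CF i)).1).
apply: near_eq_C1v CS; near=> z.
by rewrite mxrowE.
Unshelve. all: by end_near. Qed.

End BlockRows.

Section BinaryProduct.
Context {R : realType} {T1 T2 : topologicalType} {n1 n2 : nat}.
Context {A1 : @atlas R T1 n1} {A2 : @atlas R T2 n2}.
Hypotheses (m1 : C1_manifold A1) (m2 : C1_manifold A2).

Lemma for_continuous_pair (V : topologicalType) (f : V -> T1) (g : V -> T2) x :
  {for x, continuous f} -> {for x, continuous g} ->
  {for x, continuous (fun z => (f z, g z))}.
Proof. by move=> cf cg; apply: cvg_pair; [exact: cf|exact: cg]. Qed.

Lemma for_continuous_fst (x : T1 * T2) : {for x, continuous fst}.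
Proof. exact: cvg_fst. Qed.

Lemma for_continuous_snd (x : T1 * T2) : {for x, continuous snd}.
Proof. exact: cvg_snd. Qed.

Lemma cimg_prod_chart (c1 : @chart R T1 n1) (c2 : @chart R T2 n2) :
  cimg (prod_chart c1 c2) = [set y | cimg c1 (lsubmx y) /\ cimg c2 (rsubmx y)].
Proof.
apply/seteqP; split=> [_ [[x1 x2] [/= d1 d2] <-]|y [[x1 d1 e1] [x2 d2 e2]]].
  by split; rewrite /= ?row_mxKl ?row_mxKr; [exists x1|exists x2].
by exists (x1, x2) => //=; rewrite e1 e2 hsubmxK.
Qed.

Lemma prod_is_chart (c1 : @chart R T1 n1) (c2 : @chart R T2 n2) :
  is_chart c1 -> is_chart c2 -> is_chart (prod_chart c1 c2).
Proof.
move=> h1 h2; have [op1 oi1 k1 cm1 ci1] := h1; have [op2 oi2 k2 cm2 ci2] := h2.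
have cl (y : 'rV[R]_(n1 + n2)) : {for y, continuous (@lsubmx R 1 n1 n2)}.
  rewrite (_ : @lsubmx R 1 n1 n2 = fun z => z *m col_mx 1%:M 0).
    by apply: continuous_mulmxr => A0.
  by apply/funext => z; exact: lsubmxE.
have cr (y : 'rV[R]_(n1 + n2)) : {for y, continuous (@rsubmx R 1 n1 n2)}.
  rewrite (_ : @rsubmx R 1 n1 n2 = fun z => z *m col_mx 0 1%:M).
    by apply: continuous_mulmxr => A0.
  by apply/funext => z; exact: rsubmxE.
split.
- apply: (openI (A := fst @^-1` cdom c1) (B := snd @^-1` cdom c2)).
  + by apply: (open_comp (f := @fst T1 T2)) op1 => y _; exact: for_continuous_fst.
  + by apply: (open_comp (f := @snd T1 T2)) op2 => y _; exact: for_continuous_snd.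
- rewrite cimg_prod_chart; apply: openI.
  + by apply: (open_comp (f := @lsubmx R 1 n1 n2)) oi1 => y _; exact: cl.
  + by apply: (open_comp (f := @rsubmx R 1 n1 n2)) oi2 => y _; exact: cr.
- by move=> [x1 x2] [/= d1 d2]; rewrite row_mxKl row_mxKr k1 // k2.
- move=> [x1 x2] [/= d1 d2].
  rewrite (_ : (fun z => _) = fun z : T1 * T2 => cmap c1 z.1 *m row_mx 1%:M 0
    + cmap c2 z.2 *m row_mx 0 1%:M); last by apply/funext => z; exact: row_mxE.
  apply/continuous_mxP => i j.
  rewrite (_ : (fun z => _) = fun z : T1 * T2 => (cmap c1 z.1 *m row_mx 1%:M 0) i j
    + (cmap c2 z.2 *m row_mx 0 1%:M) i j); last by apply/funext => z; rewrite mxE.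
  apply: for_continuousD.
    apply: (iffLR (continuous_mxP _ _)); apply: continuous_mulmxr.
    apply: (@continuous_comp _ _ _ (@fst T1 T2) (cmap c1)); last exact: cm1.
    exact: for_continuous_fst.
  apply: (iffLR (continuous_mxP _ _)); apply: continuous_mulmxr.
  apply: (@continuous_comp _ _ _ (@snd T1 T2) (cmap c2)); last exact: cm2.
  exact: for_continuous_snd.
- rewrite cimg_prod_chart => y [d1 d2]; apply: for_continuous_pair.
    by apply: (@continuous_comp _ _ _ (@lsubmx R 1 n1 n2) (cinv c1)); [exact: cl|exact: ci1].
  by apply: (@continuous_comp _ _ _ (@rsubmx R 1 n1 n2) (cinv c2)); [exact: cr|exact: ci2].
Qed.

Lemma prod_manifold : C1_manifold (prod_atlas A1 A2).
Proof.
split.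
- move=> c [c1 [c2 [Ac1 Ac2 ->]]].
  by apply: prod_is_chart; [exact: c1_chart m1 _ Ac1|exact: c1_chart m2 _ Ac2].
- move=> [x1 x2]; have [Ac1 d1] := c1_at m1 x1; have [Ac2 d2] := c1_at m2 x2.
  by split; [exists (chart_at A1 x1), (chart_at A2 x2)|split].
- move=> c c' [c1 [c2 [Ac1 Ac2 ->]]] [c1' [c2' [Ac1' Ac2' ->]]].
  move=> [x1 x2] [/= d1 d2] [/= d1' d2'].
  have C1 := c1_trans m1 Ac1 Ac1' d1 d1'; have C2 := c1_trans m2 Ac2 Ac2' d2 d2'.
  have Cl := C1v_mulmxr (col_mx 1%:M (0 : 'M[R]_(n2, n1))) (row_mx (cmap c1 x1) (cmap c2 x2)).
  have Cr := C1v_mulmxr (col_mx (0 : 'M[R]_(n1, n2)) 1%:M) (row_mx (cmap c1 x1) (cmap c2 x2)).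
  have E1 : transition c1 c1' \o @lsubmx R 1 n1 n2 = transition c1 c1' \o mulmxr (col_mx 1%:M 0).
    by apply/funext => z; rewrite /= -lsubmxE.
  have E2 : transition c2 c2' \o @rsubmx R 1 n1 n2 = transition c2 c2' \o mulmxr (col_mx 0 1%:M).
    by apply/funext => z; rewrite /= -rsubmxE.
  apply: (C1v_row_mx (F := transition c1 c1' \o @lsubmx R 1 n1 n2)
    (G := transition c2 c2' \o @rsubmx R 1 n1 n2) _ _).1.
    by rewrite E1; apply: (C1v_comp Cl); rewrite /= -lsubmxE row_mxKl.
  by rewrite E2; apply: (C1v_comp Cr); rewrite /= -rsubmxE row_mxKr.
Qed.

(** The preferred chart of a product point is the product of the preferred charts, so the tangent
    map is exactly the row of the two tangent maps, with no change of frame. *)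
Lemma C1at_pair (T0 : topologicalType) n0 (A0 : @atlas R T0 n0) (m0 : C1_manifold A0)
    (f : T0 -> T1) (g : T0 -> T2) x :
  C1at A0 A1 f x -> C1at A0 A2 g x ->
  C1at A0 (prod_atlas A1 A2) (fun z => (f z, g z)) x /\
  tmap A0 (prod_atlas A1 A2) (fun z => (f z, g z)) x
  = row_mx (tmap A0 A1 f x) (tmap A0 A2 g x).
Proof.
move=> Cf Cg.
have [Ac0 d0] := c1_at m0 x; have [Ac1 d1] := c1_at m1 (f x).
have [Ac2 d2] := c1_at m2 (g x).
have [CP JP] := C1v_row_mx (C1at_loc Cf Ac0 Ac1 d0 d1) (C1at_loc Cg Ac0 Ac2 d0 d2).
split; last exact: JP.
apply: (C1at_one m0 prod_manifold (c1 := chart_at A0 x)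
  (c2 := prod_chart (chart_at A1 (f x)) (chart_at A2 (g x)))) => //.
- by apply: for_continuous_pair; [exact: C1at_continuous Cf|exact: C1at_continuous Cg].
- by exists (chart_at A1 (f x)), (chart_at A2 (g x)).
Qed.

End BinaryProduct.

Section BigProduct.
Context {R : realType} {k : nat} {M : 'I_k -> topologicalType} {d : 'I_k -> nat}.
Context {A : forall i, @atlas R (M i) (d i)}.
Hypothesis mA : forall i, C1_manifold (A i).

Lemma for_continuous_prod (V : topologicalType) (F : V -> prod_topology M) x :
  (forall i, {for x, continuous (fun z => F z i)}) -> {for x, continuous F}.
Proof.
move=> cF; apply/cvg_sup => i U [_ [[W oW <-] /= WF] sWU].
apply: filterS sWU _; apply: (cF i W).
exact: open_nbhs_nbhs.
Qed.

Lemma for_continuous_proj i (x : prod_topology M) :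
  {for x, continuous (fun z : prod_topology M => z i)}.
Proof. exact: proj_continuous. Qed.

Lemma cimg_bigprod_chart (c : forall i, @chart R (M i) (d i)) :
  cimg (bigprod_chart c) = [set y | forall i, cimg (c i) (submxrow y i)].
Proof.
apply/seteqP; split=> [_ [x dx <-] i|y H].
  by rewrite /= mxrowK; exists (x i) => //; exact: dx.
pose x : prod_topology M := fun i => sval (cid2 (H i)).
have Hx i : cdom (c i) (x i) /\ cmap (c i) (x i) = submxrow y i.
  by rewrite /x; case: cid2 => z /=.
exists x; first by move=> i; case: (Hx i).
rewrite -[RHS]submxrowK /=; apply/eq_mxrow => i; exact: (Hx i).2.
Qed.

Lemma submxrow_continuous i (y : 'rV[R]_(\sum_i d i)) :
  {for y, continuous (fun z : 'rV[R]_(\sum_i d i) => submxrow z i)}.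
Proof.
rewrite (_ : (fun z => _) = fun z => z *m submxrow 1%:M i).
  by apply: continuous_mulmxr => A0.
by apply/funext => z; exact: submxrowE.
Qed.

Lemma open_forall_ord (V : topologicalType) (U : 'I_k -> set V) :
  (forall i, open (U i)) -> open [set x | forall i, U i x].
Proof.
move=> oU; rewrite openE => x Ux; apply: (@filter_forall _ 'I_k) => i.
by apply: open_nbhs_nbhs; split.
Qed.

Lemma bigprod_is_chart (c : forall i, @chart R (M i) (d i)) :
  (forall i, is_chart (c i)) -> is_chart (bigprod_chart c).
Proof.
move=> hc; split.
- apply: open_forall_ord => i; have [oi _ _ _ _] := hc i.
  by apply: (open_comp (f := fun z : prod_topology M => z i)) oi => y _; exact: for_continuous_proj.
- rewrite cimg_bigprod_chart; apply: open_forall_ord => i; have [_ oi _ _ _] := hc i.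
  by apply: (open_comp (f := fun z : 'rV[R]_(\sum_i d i) => submxrow z i)) oi => y _; exact: submxrow_continuous.
- move=> x dx; apply: functional_extensionality_dep => i /=.
  by rewrite mxrowK (cmapK (hc i)).
- move=> x dx; apply/continuous_mxP => i j.
  rewrite (_ : (fun z => _) = fun z : prod_topology M =>
    \sum_l (cmap (c l) (z l) *m submxcol 1%:M l) i j).
    apply: for_continuous_sum => l; apply: (iffLR (continuous_mxP _ _)).
    apply: continuous_mulmxr.
    apply: (@continuous_comp _ _ _ (fun z : prod_topology M => z l) (cmap (c l))).
      exact: for_continuous_proj.
    exact: cmap_continuous (hc l) _ (dx l).
  by apply/funext => z; rewrite /= mxrowE summxE.
- rewrite cimg_bigprod_chart => y dy; apply: for_continuous_prod => i.
  apply: (@continuous_comp _ _ _ (fun z : 'rV[R]_(\sum_i d i) => submxrow z i) (cinv (c i))).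
    exact: submxrow_continuous.
  exact: cinv_continuous (hc i) _ (dy i).
Qed.

Lemma bigprod_manifold : C1_manifold (bigprod_atlas A).
Proof.
split.
- by move=> c [c_ Ac ->]; apply: bigprod_is_chart => i; exact: c1_chart (mA i) _ (Ac i).
- move=> x; split; first by exists (fun i => chart_at (A i) (x i)) => // i; case: (c1_at (mA i) (x i)).
  by move=> i; case: (c1_at (mA i) (x i)).
- move=> _ _ [c Ac ->] [c' Ac' ->] x dx dx'.
  apply: (C1v_mxrow (F := fun i z => transition (c i) (c' i) (submxrow z i))) => i.
  rewrite (_ : (fun z => _) = transition (c i) (c' i) \o mulmxr (submxrow 1%:M i)).
    apply: C1v_comp; first exact: C1v_mulmxr.
    rewrite /= -submxrowE mxrowK.
    exact: c1_trans (mA i) _ _ (Ac i) (Ac' i) _ (dx i) (dx' i).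
  by apply/funext => z; rewrite /= -submxrowE.
Qed.

Lemma locrep_proj (c : forall i, @chart R (M i) (d i)) i (x : prod_topology M) :
  (forall i, is_chart (c i)) -> (forall i, cdom (c i) (x i)) ->
  \forall y \near cmap (bigprod_chart c) x,
    (mulmxr (submxrow 1%:M i) : 'rV[R]_(\sum_i d i) -> 'rV[R]_(d i)) y
    = (cmap (c i) \o (fun z : prod_topology M => z i) \o cinv (bigprod_chart c)) y.
Proof.
move=> hc dx; have := cimg_nbhs (bigprod_is_chart hc) dx; apply: filterS => y.
by rewrite cimg_bigprod_chart => cy; rewrite /= (cinvK (hc i)) // -submxrowE.
Qed.

Lemma C1at_proj i (x : prod_topology M) :
  C1at (bigprod_atlas A) (A i) (fun z : prod_topology M => z i) x.
Proof.
have [[c Ac Ec] dx] := c1_at bigprod_manifold x.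
rewrite Ec in dx.
apply: (C1at_one bigprod_manifold (mA i) (c1 := bigprod_chart c) (c2 := c i)) => //.
- exact: for_continuous_proj.
- by exists c.
- by apply: near_eq_C1v (C1v_mulmxr _ _); apply: locrep_proj => // j; exact: c1_chart (mA j) _ (Ac j).
Qed.

Lemma locm_proj (c : forall i, @chart R (M i) (d i)) i (x : prod_topology M) :
  (forall i, is_chart (c i)) -> (forall i, cdom (c i) (x i)) ->
  locm (bigprod_chart c) (c i) (fun z : prod_topology M => z i) x = submxrow 1%:M i.
Proof.
move=> hc dx; rewrite -(differentiable_mulmxr (submxrow 1%:M i) (cmap (bigprod_chart c) x)).2.
apply/esym/near_eq_jacobian; first exact: locrep_proj.
exact: (differentiable_mulmxr _ _).1.
Qed.

Lemma tmap_proj i (x : prod_topology M) :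
  tmap (bigprod_atlas A) (A i) (fun z : prod_topology M => z i) x = submxrow 1%:M i.
Proof.
apply: (locm_proj (c := fun i => chart_at (A i) (x i))) => j; have [Aj dj] := c1_at (mA j) (x j) => //.
exact: c1_chart (mA j) _ Aj.
Qed.

End BigProduct.

(** * Lengths of paths *)

Section Primitives.
Context {R : realType}.
Implicit Types (f g F G : R -> R) (a b t : R).

(** The derivative is two-sided at the end points as well, so [G] must be defined and differentiable
    slightly beyond the interval. *)
Definition primitive f G a b := forall t, a <= t <= b -> is_derive t 1 G (f t).

Lemma is_derive_continuous F t (l : R) : is_derive t 1 F l -> {for t, continuous F}.
Proof.
move=> [dF _]; apply: differentiable_continuous.
exact/derivable1_diffP.
Qed.

Lemma for_within_continuous f a b :
  (forall t, a <= t <= b -> {for t, continuous f}) -> {within `[a, b], continuous f}.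
Proof.
move=> cf; apply: continuous_in_subspaceT => t; rewrite inE /= in_itv /=.
exact: cf.
Qed.

Lemma primitive_le f g F G a b : a <= b -> primitive f F a b -> primitive g G a b ->
  (forall t, a <= t <= b -> f t <= g t) -> F b - F a <= G b - G a.
Proof.
move=> ab pF pG fg.
have pD t : a <= t <= b -> is_derive t 1 (G - F) (g t - f t).
  by move=> tab; have := pF t tab; have := pG t tab; move=> ? ?; exact: is_deriveB.
have := @ger0_derive1_le_cc _ (G - F) a b.
have sub t : t \in `]a, b[ -> a <= t <= b.
  by rewrite in_itv /= => /andP[/ltW-> /ltW->].
have dD t : t \in `]a, b[ -> derivable (G - F) t 1 by move=> /sub/pD[].
have pos t : t \in `]a, b[ -> 0 <= derive1 (G - F) t.
  by move=> /sub tab; have [_ D] := pD t tab; rewrite derive1E D subr_ge0 fg.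
have cD : {within `[a, b], continuous (G - F)}.
  by apply: derivable_within_continuous => t; rewrite in_itv /= => /pD[].
move=> /(_ dD pos cD a b).
rewrite !in_itv /= !lexx ab => /(_ isT isT isT).
by rewrite !fctE; lra.
Qed.

Lemma integral_primitive f G a b : a < b -> {within `[a, b], continuous f} ->
  primitive f G a b ->
  (\int[lebesgue_measure]_(t in `[a, b]) (f t)%:E = (G b - G a)%:E)%E.
Proof.
move=> ab cf pG; rewrite (continuous_FTC2 ab cf (F := G)) ?EFinB //.
  have cG t : a <= t <= b -> {for t, continuous G}.
    by move=> /pG; exact: is_derive_continuous.
  split.
  - by move=> t; rewrite in_itv /= => /andP[/ltW at_ /ltW tb]; have [] := pG t; rewrite ?at_.
  - by apply: cvg_at_right_filter; apply: cG; rewrite lexx ltW.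
  - by apply: cvg_at_left_filter; apply: cG; rewrite lexx ltW.
move=> t; rewrite in_itv /= => /andP[/ltW at_ /ltW tb]; rewrite derive1E.
by have [] := pG t; rewrite ?at_.
Qed.

Definition clamp a b t : R := Num.max a (Num.min t b).

Lemma clamp_itv a b t : a <= b -> a <= clamp a b t <= b.
Proof. by move=> ab; rewrite /clamp le_max lexx /= ge_max ab ge_min lexx orbT. Qed.

Lemma clamp_id a b t : a <= t <= b -> clamp a b t = t.
Proof. by move=> /andP[at_ tb]; rewrite /clamp min_l // max_r. Qed.

Lemma clamp_continuous a b : continuous (clamp a b).
Proof.
move=> t; apply: (@continuous_max R R (cst a) (id \min cst b) t).
  exact: cst_continuous.
by apply: (@continuous_min R R id (cst b) t) => [A0|]//; exact: cst_continuous.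
Qed.

Lemma clamp_comp_continuous f a b : a <= b -> {within `[a, b], continuous f} ->
  continuous (f \o clamp a b).
Proof.
move=> ab /subspace_continuousP cf t A /= Af.
have cab : `[a, b]%classic (clamp a b t) by rewrite /= in_itv /= clamp_itv.
have H := @clamp_continuous a b t _ (cf _ cab A Af).
suff : nbhs t ((f \o clamp a b) @^-1` A) by [].
have {}H : nbhs t (fun u => `[a, b]%classic (clamp a b u) -> A (f (clamp a b u))) by exact: H.
apply: filterS H => u; apply.
by rewrite /= in_itv /= clamp_itv.
Qed.

(** [f] is frozen outside the interval by [clamp], and the integral starts at [a - 1]; this leaves
    room on both sides for two-sided derivatives at [a] and [b]. *)
Lemma primitive_extension f a b : a <= b -> {within `[a, b], continuous f} ->
  exists fe G : R -> R, [/\ continuous fe,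
    forall t, a <= t <= b -> fe t = f t &
    forall t, a - 1 < t < b + 1 -> is_derive t 1 G (fe t)].
Proof.
move=> ab cf; have cfe := clamp_comp_continuous ab cf.
exists (f \o clamp a b), (fun t => \int[lebesgue_measure]_(u in `[a - 1, t]) (f \o clamp a b) u).
split=> // [t tab|t /andP[at_ tb]]; first by rewrite /= clamp_id.
have ifb : lebesgue_measure.-integrable `[a - 1, b + 1] (EFin \o (f \o clamp a b)).
  apply: continuous_compact_integrable; first exact: segment_compact.
  exact: continuous_subspaceT.
have [dF F't] := @continuous_FTC1_closed _ (f \o clamp a b) (a - 1) t (b + 1) tb ifb at_ (cfe t).
set G := (fun x : R => _) in dF F't *.
have {}F't : derive1 G t = (f \o clamp a b) t by exact: F't.
by move: G dF F't => G dF <-; rewrite derive1E; exact: derivableP.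
Qed.

Lemma primitive_exists f a b : a <= b -> {within `[a, b], continuous f} ->
  exists G, primitive f G a b.
Proof.
move=> ab cf; have [fe [G [_ E dG]]] := primitive_extension ab cf.
exists G => t /[dup] tab /E <-; apply: dG.
by move: tab => /andP[? ?]; lra.
Qed.

Lemma primitive_affine f G a b al be : primitive f G a b ->
  a <= al <= b -> a <= be <= b ->
  primitive (fun t => (be - al) * f (al + (be - al) * t)) (fun t => G (al + (be - al) * t)) 0 1.
Proof.
move=> pG ha hb t t01.
have tt : a <= al + (be - al) * t <= b by move: ha hb t01 => /andP[? ?] /andP[? ?] /andP[? ?]; nra.
have D1 : is_derive t 1 (fun t => al + (be - al) * t) (be - al).
  have := is_deriveD (is_derive_cst al t 1) (is_deriveZ (be - al) (is_derive_id t (1 : R))).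
  by rewrite add0r scaler1.
have := is_derive1_comp (f := G) (g := fun t => al + (be - al) * t) (pG _ tt) D1.
by rewrite mulrC.
Qed.

End Primitives.

Section Paths.
Context {R : realType} {T : topologicalType} {n : nat}.
Context {A : @atlas R T n} {h : T -> 'M[R]_n}.
Hypothesis mA : C1_manifold A.
Hypothesis ch : forall x, C0tensor2 A h x.
Implicit Types (s : 'rV[R]_1 -> T) (t : R).

Definition C1curve s := forall t : R, 0 <= t <= 1 -> C1at (euclid 1) A s (const_mx t).

Lemma const_mx_continuous : continuous (fun t : R => const_mx t : 'rV[R]_1).
Proof.
move=> t; apply/continuous_mxP => i j.
by rewrite (_ : (fun z => _) = id) //; apply/funext => z; rewrite mxE.
Qed.

Lemma speed_continuous s t : C1at (euclid 1) A s (const_mx t) ->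
  {for t, continuous (fun u => speed A h s (const_mx u))}.
Proof.
move=> Cs.
have /C0tensor2_euclid c0 := pullback2_C0 euclid_manifold mA Cs (@ch _).
have c1 : {for t, continuous (fun u : R => pullback2 (euclid 1) A s h (const_mx u))}.
  by apply: continuous_comp; [exact: const_mx_continuous|exact: c0].
have c2 := (continuous_mxP _ _).1 c1 0 0.
by apply: (continuous_comp c2); exact: sqrt_continuous.
Qed.

Lemma curve_length_primitive s : C1curve s ->
  exists2 G, primitive (fun t => speed A h s (const_mx t)) G 0 1 &
    curve_length A h s = (G 1 - G 0)%:E.
Proof.
move=> Cs.
have cw : {within `[0, 1], continuous (fun t => speed A h s (const_mx t))}.
  by apply: for_within_continuous => t /Cs; exact: speed_continuous.
have [G pG] := primitive_exists ler01 cw.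
by exists G => //; exact: integral_primitive ltr01 cw pG.
Qed.

Lemma curve_lengthE s G : C1curve s ->
  primitive (fun t => speed A h s (const_mx t)) G 0 1 ->
  curve_length A h s = (G 1 - G 0)%:E.
Proof.
move=> Cs pG; apply: integral_primitive ltr01 _ pG.
by apply: for_within_continuous => t /Cs; exact: speed_continuous.
Qed.

Lemma speed_ge0 s x : 0 <= speed A h s x.
Proof. exact: sqrtr_ge0. Qed.

Definition affine1 (al be : R) (v : 'rV[R]_1) : 'rV[R]_1 :=
  const_mx al + (be - al) *: v.

Lemma affine1_const al be t : affine1 al be (const_mx t) = const_mx (al + (be - al) * t).
Proof. by apply/rowP => i; rewrite !mxE. Qed.

Lemma affine1E al be : affine1 al be = fun v => cst (const_mx al) v + v *m (be - al)%:M.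
Proof. by apply/funext => v; rewrite mul_mx_scalar. Qed.

Lemma C1v_affine1 al be y : C1v (affine1 al be) y.
Proof.
rewrite affine1E; apply: C1vD; first exact: C1v_cst.
exact: (C1v_mulmxr (be - al)%:M y).
Qed.

Lemma jacobian_affine1 al be y : 'J (affine1 al be) y = (be - al)%:M.
Proof.
rewrite affine1E jacobianD.
- by rewrite jacobian_cst add0r; exact: (differentiable_mulmxr (be - al)%:M y).2.
- exact: C1v_differentiable (C1v_cst _ _).
- exact: (differentiable_mulmxr (be - al)%:M y).1.
Qed.

Lemma affine_itv (al be t : R) : 0 <= al <= 1 -> 0 <= be <= 1 -> 0 <= t <= 1 ->
  0 <= al + (be - al) * t <= 1.
Proof. by move=> /andP[? ?] /andP[? ?] /andP[? ?]; nra. Qed.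

Lemma C1curve_affine s al be : C1curve s -> 0 <= al <= 1 -> 0 <= be <= 1 ->
  C1curve (s \o affine1 al be).
Proof.
move=> Cs ha hb t t01; apply: (C1at_comp euclid_manifold euclid_manifold).
  by apply/C1at_euclid; exact: C1v_affine1.
by rewrite affine1_const; apply: Cs; exact: affine_itv.
Qed.

Lemma speed_affine s al be t : C1curve s -> 0 <= al <= 1 -> 0 <= be <= 1 -> 0 <= t <= 1 ->
  speed A h (s \o affine1 al be) (const_mx t)
  = `|be - al| * speed A h s (const_mx (al + (be - al) * t)).
Proof.
move=> Cs ha hb t01; rewrite /speed.
have C1 : C1at (euclid 1) (euclid 1) (affine1 al be) (const_mx t).
  by apply/C1at_euclid; exact: C1v_affine1.
have C2 : C1at (euclid 1) A s (affine1 al be (const_mx t)).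
  by rewrite affine1_const; apply: Cs; exact: affine_itv.
rewrite (pullback2_comp _ euclid_manifold euclid_manifold mA C1 C2).
rewrite {1}/pullback2 (_ : tmap _ _ _ _ = (be - al)%:M); last exact: jacobian_affine1.
rewrite tr_scalar_mx mul_mx_scalar mul_scalar_mx affine1_const scalerA mxE -expr2.
by rewrite sqrtrM ?sqr_ge0 // sqrtr_sqr.
Qed.

(** The order of [al] and [be] is free: one formula covers restriction to a subinterval, used for
    lifting piece by piece, and reversal, used for the symmetry of the distance. *)
Lemma C1curve_affine_length s G al be : C1curve s ->
  primitive (fun t => speed A h s (const_mx t)) G 0 1 ->
  0 <= al <= 1 -> 0 <= be <= 1 ->
  curve_length A h (s \o affine1 al be) = `|G be - G al|%:E.
Proof.
move=> Cs pG ha hb; have pG' := primitive_affine pG ha hb.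
have Cs' := C1curve_affine Cs ha hb.
have [ab|/ltW ba] := leP al be.
  rewrite (curve_lengthE (G := fun t => G (al + (be - al) * t)) Cs').
    rewrite mulr0 addr0 mulr1 [al + _]addrC subrK ger0_norm // subr_ge0.
    have p0 : primitive (fun=> 0 : R) (fun=> 0) al be by move=> t _; exact: is_derive_cst.
    have pGab : primitive (fun t => speed A h s (const_mx t)) G al be.
      by move=> t; move: ha hb => /andP[? ?] /andP[? ?] /andP[? ?]; apply: pG; lra.
    have := primitive_le ab p0 pGab; rewrite subrr subr_ge0; apply.
    by move=> t _; exact: speed_ge0.
  move=> t t01; rewrite speed_affine // ger0_norm ?subr_ge0 //.
  exact: pG'.
rewrite (curve_lengthE (G := fun t => - G (al + (be - al) * t)) Cs').
  rewrite mulr0 addr0 mulr1 [al + _]addrC subrK.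
  have -> : - G be - - G al = G al - G be by ring.
  rewrite distrC ger0_norm // subr_ge0.
  have p0 : primitive (fun=> 0 : R) (fun=> 0) be al by move=> t _; exact: is_derive_cst.
  have pGab : primitive (fun t => speed A h s (const_mx t)) G be al.
    by move=> t; move: ha hb => /andP[? ?] /andP[? ?] /andP[? ?]; apply: pG; lra.
  have := primitive_le ba p0 pGab; rewrite subrr subr_ge0; apply.
  by move=> t _; exact: speed_ge0.
move=> t t01; rewrite speed_affine // ler0_norm ?subr_le0 // mulNr.
by apply: is_deriveN; exact: pG'.
Qed.

(** The open set required by [Path_seg] is the set of all parameters at which [s] is C^1. *)
Lemma path_seg s : C1curve s ->
  piecewise_path A h (s (const_mx 0)) (s (const_mx 1)) (curve_length A h s).
Proof.
move=> Cs; apply: (@Path_seg _ _ _ A h s [set z | C1at (euclid 1) A s z]).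
  by move=> t; exact: Cs.
apply: C1at_Ck_map_on => //.
by rewrite openE => z /(C1at_near euclid_manifold mA).
Qed.

(** Induction on paths with the segment case restated for [C1curve], which hides the open domain
    [W]. *)
Lemma path_ind_C1 (Q : T -> T -> \bar R -> Prop) :
  (forall s, C1curve s -> Q (s (const_mx 0)) (s (const_mx 1)) (curve_length A h s)) ->
  (forall x y z l1 l2, piecewise_path A h x y l1 -> Q x y l1 ->
    piecewise_path A h y z l2 -> Q y z l2 -> Q x z (l1 + l2)%E) ->
  forall x y l, piecewise_path A h x y l -> Q x y l.
Proof.
move=> Qs Qc x y l; elim=> [s W WI CW|x0 y0 z0 l1 l2 p1 q1 p2 q2]; last exact: Qc q2.
apply: Qs => t /WI; exact: Ck_map_on_C1at euclid_manifold mA _ _ _ CW.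
Qed.

Lemma path_real x y l : piecewise_path A h x y l -> exists2 r : R, 0 <= r & l = r%:E.
Proof.
move: x y l; apply: path_ind_C1 => [s Cs|x y z l1 l2 _ [r1 r10 ->] _ [r2 r20 ->]].
  have [G pG ->] := curve_length_primitive Cs; exists (G 1 - G 0) => //.
  have p0 : primitive (fun=> 0 : R) (fun=> 0) 0 1 by move=> t _; exact: is_derive_cst.
  have := primitive_le ler01 p0 pG; rewrite subrr; apply.
  by move=> t _; exact: speed_ge0.
by exists (r1 + r2); rewrite ?addr_ge0 // EFinD.
Qed.

Lemma path_refl x : piecewise_path A h x x 0%E.
Proof.
have Cs : C1curve (cst x) by move=> t _; exact: C1at_cst.
have := path_seg Cs; rewrite (curve_lengthE (G := cst 0) Cs) ?subrr //.
move=> t _; rewrite /speed /pullback2 tmap_cst !mul0mx mxE sqrtr0.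
exact: is_derive_cst.
Qed.

Lemma path_sym x y l : piecewise_path A h x y l -> piecewise_path A h y x l.
Proof.
move: x y l; apply: path_ind_C1 => [s Cs|x y z l1 l2 _ p1 _ p2].
  have [G pG ->] := curve_length_primitive Cs.
  have i0 : 0 <= (0 : R) <= 1 by rewrite lexx ler01.
  have i1 : 0 <= (1 : R) <= 1 by rewrite lexx ler01.
  have := path_seg (C1curve_affine Cs i1 i0).
  rewrite (C1curve_affine_length Cs pG i1 i0) distrC ger0_norm.
    by rewrite /= !affine1_const mulr0 mulr1 addr0 sub0r subrr.
  have p0 : primitive (fun=> 0 : R) (fun=> 0) 0 1 by move=> t _; exact: is_derive_cst.
  have := primitive_le ler01 p0 pG; rewrite subrr; apply.
  by move=> t _; exact: speed_ge0.
by rewrite addeC; exact: Path_cat p2 p1.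
Qed.

Local Open Scope ereal_scope.
Notation d := (riem_dist A h).

Lemma dist_le_path x y l : piecewise_path A h x y l -> d x y <= l.
Proof. by move=> p; apply: ereal_inf_lbound. Qed.

Lemma le_dist x y c : (forall l, piecewise_path A h x y l -> c <= l) -> c <= d x y.
Proof. by move=> H; apply: le_ereal_inf_tmp => l; exact: H. Qed.

Lemma dist_ge0 x y : 0 <= d x y.
Proof. by apply: le_dist => l /path_real[r r0 ->]; rewrite lee_fin. Qed.

Lemma dist_refl x : d x x = 0.
Proof. by apply/eqP; rewrite eq_le dist_ge0 andbT; apply: dist_le_path; exact: path_refl. Qed.

Lemma dist_sym x y : d x y = d y x.
Proof.
by apply/eqP; rewrite eq_le; apply/andP; split; apply: le_dist => l /path_sym; exact: dist_le_path.
Qed.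

Lemma dist_triangle x y z : d x z <= d x y + d y z.
Proof.
have yz0 := dist_ge0 y z; have xy0 := dist_ge0 x y.
have H l : piecewise_path A h x y l -> d x z <= l + d y z.
  move=> p1; have [r r0 E] := path_real p1; rewrite E in p1 *.
  rewrite addeC -leeBlDr //; apply: le_dist => l2 p2; rewrite leeBlDr //.
  by apply: dist_le_path; rewrite addeC; exact: Path_cat p1 p2.
(* Moving [d y z] across the inequality requires it to be finite; if it is not, the right-hand side
   is infinite. *)
have [yzfin|] := boolP (d y z \is a fin_num); last first.
  rewrite ge0_fin_numE // -leNgt leye_eq => /eqP ->.
  by rewrite addey ?leey // gt_eqF // (lt_le_trans _ xy0) // ltNy0.
by rewrite -leeBlDr //; apply: le_dist => l p; rewrite leeBlDr //; exact: H.
Qed.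

Lemma dist_path_finite x y l : piecewise_path A h x y l -> d x y \is a fin_num.
Proof.
move=> p; rewrite ge0_fin_numE ?dist_ge0 //.
by apply: le_lt_trans (dist_le_path p) _; have [r _ ->] := path_real p; exact: ltey.
Qed.

End Paths.

(** * Comparison of distances *)

Section QuadraticForms.
Context {R : realType}.

Lemma near_dist_lt (V : normedModType R) (y0 : V) (r : R) : 0 < r ->
  \forall y \near y0, `|y - y0| < r.
Proof.
by move=> r0; apply/nbhs_normP; exists r => // z; rewrite /ball_ /= distrC.
Qed.

Definition quad n (G : 'M[R]_n) (v : 'rV[R]_n) : R := (v *m G *m v^T) 0 0.

Lemma quadZ n (G : 'M[R]_n) a v : quad G (a *: v) = a ^+ 2 * quad G v.
Proof. by rewrite /quad -!scalemxAl linearZ /= -scalemxAr scalerA mxE expr2. Qed.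

Lemma quadZl n (G : 'M[R]_n) a v : quad (a *: G) v = a * quad G v.
Proof. by rewrite /quad -scalemxAr -scalemxAl mxE. Qed.

Lemma quadD n (G H : 'M[R]_n) v : quad (G + H) v = quad G v + quad H v.
Proof. by rewrite /quad mulmxDr mulmxDl mxE. Qed.

Lemma quad_sum n (I : Type) (r : seq I) (G : I -> 'M[R]_n) v :
  quad (\sum_(i <- r) G i) v = \sum_(i <- r) quad (G i) v.
Proof.
elim: r => [|i r IH]; first by rewrite !big_nil /quad mulmx0 mul0mx mxE.
by rewrite !big_cons quadD IH.
Qed.

Lemma quad_pull n k (L : 'M[R]_(n, k)) (G : 'M[R]_k) v :
  quad (L *m G *m L^T) v = quad G (v *m L).
Proof. by rewrite /quad trmx_mul !mulmxA. Qed.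

Lemma quad_continuous (V : topologicalType) n (F : V -> 'M[R]_n) (w : V -> 'rV[R]_n) x :
  {for x, continuous F} -> {for x, continuous w} ->
  {for x, continuous (fun z => quad (F z) (w z))}.
Proof.
move=> cF cw.
have c1 : {for x, continuous (fun z => w z *m F z)} by exact: continuous_mulmx.
have c2 : {for x, continuous (fun z => (w z)^T)} by exact: continuous_trmx.
exact: ((continuous_mxP _ _).1 (continuous_mulmx c1 c2) 0 0).
Qed.

(** Joint continuity at [(y0, 0)], where the form vanishes; it makes all short enough coordinate
    segments have length at most 1. *)
Lemma quad_le_near n (F : 'rV[R]_n -> 'M[R]_n) y0 : {for y0, continuous F} ->
  exists2 r : R, 0 < r & forall y w, `|y - y0| < r -> `|w| < r -> quad (F y) w < 1.
Proof.
move=> cF.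
pose q (z : 'rV[R]_n * 'rV[R]_n) := quad (F z.1) z.2.
have cq : {for (y0, 0), continuous q}.
  apply: quad_continuous; last exact: for_continuous_snd.
  apply: (@continuous_comp _ _ _ (@fst 'rV[R]_n 'rV[R]_n) F); last exact: cF.
  exact: for_continuous_fst.
have q0 : q (y0, 0) < 1 by rewrite /q /quad /= trmx0 mulmx0 mxE.
have /nbhs_normP[r /= r0 H] := cq _ (lt_nbhsl q0).
exists r => // y w yr wr.
have Hyw : ball_ Num.Def.normr (y0, 0 : 'rV[R]_n) r (y, w).
  rewrite /ball_ /= prod_normE /= gt_max /= sub0r normrN wr andbT distrC.
  exact: yr.
exact: (H _ Hyw).
Qed.

Lemma sphere_compact n : compact [set v : 'rV[R]_n | `|v| = 1].
Proof.
apply: bounded_closed_compact.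
  by exists 1; split => // M M1 v /= ->; exact: ltW.
apply: (@closed_comp _ _ (fun v : 'rV[R]_n => `|v|) [set x | x = 1]).
  by move=> v _; exact: norm_continuous.
exact: closed_eq.
Qed.

(** For one unit vector [v], continuity gives a bound valid near [(y0, v)]. Compactness of the unit
    sphere makes it uniform, with the candidate [la] treated as a parameter tending to 0 from the
    right; homogeneity then reaches all [w]. *)
Lemma quad_ge_near n (F : 'rV[R]_n -> 'M[R]_n) y0 : {for y0, continuous F} ->
  (forall v, v != 0 -> 0 < quad (F y0) v) ->
  exists2 la : R, 0 < la & \forall y \near y0, forall w, la * `|w| ^+ 2 <= quad (F y) w.
Proof.
move=> cF pF.
have /compact_near_coveringP nc := @sphere_compact n.
have [la la0 H] : exists2 la : R, 0 < la &
    \forall y \near y0, forall v, `|v| = 1 -> la < quad (F y) v.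
  have := nc _ (filter_prod (nbhs y0) (at_right (0 : R))) (fun yl v => yl.2 < quad (F yl.1) v) _.
  have K : (forall x : 'rV[R]_n, [set v | `|v| = 1] x ->
    \forall x' \near x & i \near filter_prod (nbhs y0) (at_right (0:R)), i.2 < quad (F i.1) x').
    move=> v /= v1.
    have v0 : v != 0 by rewrite -normr_gt0 v1.
    pose q (z : 'rV[R]_n * 'rV[R]_n) := quad (F z.1) z.2.
    have cq : {for (y0, v), continuous q}.
      apply: quad_continuous; last exact: for_continuous_snd.
      apply: (@continuous_comp _ _ _ (@fst 'rV[R]_n 'rV[R]_n) F); last exact: cF.
      exact: for_continuous_fst.
    have q0 : q (y0, v) / 2 < q (y0, v) by have := pF v v0; rewrite -/(q (y0, v)); lra.
    have [[U V] /= [Uy Vv] UV] := cq _ (lt_nbhsr q0).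
    exists (V, U `*` [set l | l < q (y0, v) / 2]) => /=.
      split => //; exists (U, [set l | l < q (y0, v) / 2]) => //=; split => //.
      by apply: nbhs_right_lt; have := pF v v0; rewrite -/(q (y0, v)) => ?; rewrite divr_gt0.
    move=> [v' [y' l']] /= [Vv' [Uy' ll]].
    by apply: lt_trans ll _; apply: (UV (y', v')).
  move=> /(_ _ K) [[U L] /= [Uy L0] UL].
  have : \forall l \near (0:R)^'+, L l /\ 0 < l.
    by apply: filterI => //; exact: nbhs_right_gt.
  move=> /filter_ex[la [Lla la0]]; exists la => //.
  by apply: filterS Uy => y Uy' v v1; apply: (UL (y, la)).
exists la => //; apply: filterS H => y Hy w.
have [->|w0] := eqVneq w 0; first by rewrite /quad normr0 expr0n mulr0 trmx0 mulmx0 mxE.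
have nw : 0 < `|w| by rewrite normr_gt0.
have E : w = `|w| *: (`|w|^-1 *: w) by rewrite scalerA divff ?gt_eqF // scale1r.
rewrite {2}E quadZ mulrC ler_wpM2l ?sqr_ge0 // ltW //; apply: Hy.
by rewrite normrZ ger0_norm ?invr_ge0 ?ltW // mulVf ?gt_eqF.
Qed.

End QuadraticForms.

Section PathMap.
Context {R : realType} {T1 T2 : topologicalType} {n1 n2 : nat}.
Context {A1 : @atlas R T1 n1} {A2 : @atlas R T2 n2}.
Context {h1 : T1 -> 'M[R]_n1} {h2 : T2 -> 'M[R]_n2}.
Hypotheses (m1 : C1_manifold A1) (m2 : C1_manifold A2).
Hypotheses (ch1 : forall x, C0tensor2 A1 h1 x) (ch2 : forall x, C0tensor2 A2 h2 x).

Lemma speedE (T : topologicalType) n (A : @atlas R T n) h s t :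
  speed A h s t = Num.sqrt (quad (h (s t)) (tmap (euclid 1) A s t)).
Proof. by []. Qed.

(** The hypothesis says that [f] multiplies the norm of tangent vectors by at most [K]; images of
    curves are then at most [K] times as long. *)
Lemma path_map (f : T1 -> T2) (K : R) : 0 <= K -> (forall x, C1at A1 A2 f x) ->
  (forall x v, quad (pullback2 A1 A2 f h2 x) v <= K ^+ 2 * quad (h1 x) v) ->
  forall x y l, piecewise_path A1 h1 x y l ->
  exists2 l', piecewise_path A2 h2 (f x) (f y) l' & (l' <= K%:E * l)%E.
Proof.
move=> K0 Cf Hf; apply: (path_ind_C1 m1) => [s Cs|x y z l1 l2 p1 [k1 q1 E1] p2 [k2 q2 E2]].
  have Cfs : C1curve (A := A2) (f \o s).
    by move=> t t01; exact: C1at_comp euclid_manifold m1 _ _ _ (Cs t t01) (Cf _).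
  exists (curve_length A2 h2 (f \o s)).
    by have := path_seg (h := h2) m2 Cfs.
  have [G1 pG1 ->] := curve_length_primitive m1 ch1 Cs.
  have [G2 pG2 ->] := curve_length_primitive m2 ch2 Cfs.
  rewrite -EFinM lee_fin.
  have pK : primitive (fun t => K * speed A1 h1 s (const_mx t)) (fun t => K * G1 t) 0 1.
    by move=> t /pG1 ?; exact: is_deriveZ.
  rewrite mulrBr; apply: (primitive_le ler01 pG2 pK) => t t01.
  rewrite speedE (tmap_comp euclid_manifold m1 m2 (Cs t t01) (Cf _)).
  rewrite -quad_pull -/(pullback2 A1 A2 f h2 (s (const_mx t))).
  apply: le_trans (ler_wsqrtr (Hf _ _)) _.
  by rewrite sqrtrM ?sqr_ge0 // sqrtr_sqr ger0_norm.
exists (k1 + k2)%E; first exact: Path_cat q1 q2.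
have [r1 r10 e1] := path_real m1 ch1 p1; have [r2 r20 e2] := path_real m1 ch1 p2.
by rewrite ge0_muleDr ?e1 ?e2 ?lee_fin // -e1 -e2; exact: leeD.
Qed.

Lemma dist_map (f : T1 -> T2) (K : R) : 0 <= K -> (forall x, C1at A1 A2 f x) ->
  (forall x v, quad (pullback2 A1 A2 f h2 x) v <= K ^+ 2 * quad (h1 x) v) ->
  forall x y l, piecewise_path A1 h1 x y l ->
  (riem_dist A2 h2 (f x) (f y) <= K%:E * l)%E.
Proof.
move=> K0 Cf Hf x y l p; have [l' p' ll] := path_map K0 Cf Hf p.
exact: le_trans (dist_le_path p') ll.
Qed.

End PathMap.

(** * Short paths in a chart, path-connectedness and boundedness of the distance *)

Section LocalBound.
Context {R : realType} {T : topologicalType} {n : nat}.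
Context {A : @atlas R T n} {h : T -> 'M[R]_n}.
Hypothesis mA : C1_manifold A.
Hypothesis ch : forall x, C0tensor2 A h x.

Lemma C1at_cinv c y : charts A c -> cimg c y -> C1at (euclid n) A (cinv c) y.
Proof.
move=> Ac cy; have hc := c1_chart mA Ac.
apply: (C1at_one euclid_manifold mA (c1 := Chart setT id id) (c2 := c)) => //.
- exact: cinv_continuous hc _ cy.
- exact: cinv_dom hc _ cy.
apply: near_eq_C1v (C1v_mulmxr 1%:M _).
have ncy : nbhs y (cimg c).
  by have := cimg_nbhs hc (cinv_dom hc cy); rewrite (cinvK hc cy).
by apply: filterS ncy => z cz; rewrite /= mulmx1 (cinvK hc cz).
Qed.

Lemma pullback2_cinv c y : charts A c -> cimg c y ->
  pullback2 (euclid n) A (cinv c) h y = coord2 A c h y.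
Proof. by []. Qed.

Definition segment (y w : 'rV[R]_n) (v : 'rV[R]_1) : 'rV[R]_n := cst y v + v *m w.

Lemma segment_const y w t : segment y w (const_mx t) = y + t *: w.
Proof.
by rewrite /segment; congr (_ + _); apply/rowP => i; rewrite !mxE big_ord1 !mxE.
Qed.

Lemma C1v_segment y w v : C1v (segment y w) v.
Proof. by apply: C1vD; [exact: C1v_cst|exact: (C1v_mulmxr w v)]. Qed.

Lemma jacobian_segment y w v : 'J (segment y w) v = w.
Proof.
rewrite jacobianD.
- by rewrite jacobian_cst add0r; exact: (differentiable_mulmxr w v).2.
- exact: C1v_differentiable (C1v_cst _ _).
- exact: (differentiable_mulmxr w v).1.
Qed.

Lemma chart_segment_path c y w : charts A c ->
  (forall t : R, 0 <= t <= 1 -> cimg c (y + t *: w)) ->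
  (forall t : R, 0 <= t <= 1 -> quad (coord2 A c h (y + t *: w)) w <= 1) ->
  exists2 l, piecewise_path A h (cinv c y) (cinv c (y + w)) l & (l <= 1)%E.
Proof.
move=> Ac ci qi.
have CS t : C1at (euclid 1) (euclid n) (segment y w) (const_mx t).
  by apply/C1at_euclid; exact: C1v_segment.
have CC t : 0 <= t <= 1 -> C1at (euclid n) A (cinv c) (segment y w (const_mx t)).
  by move=> t01; rewrite segment_const; apply: C1at_cinv => //; exact: ci.
have Cs : C1curve (A := A) (cinv c \o segment y w).
  by move=> t t01; exact: C1at_comp euclid_manifold euclid_manifold _ _ _ (CS t) (CC t t01).
exists (curve_length A h (cinv c \o segment y w)).
  by have := path_seg (h := h) mA Cs; rewrite /= !segment_const scale0r addr0 scale1r.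
have [G pG ->] := curve_length_primitive mA ch Cs.
have p1 : primitive (fun=> 1 : R) id 0 1 by move=> t _; exact: is_derive_id.
have := primitive_le ler01 pG p1; rewrite subr0 lee_fin; apply => t t01.
rewrite speedE (tmap_comp euclid_manifold euclid_manifold mA (CS t) (CC t t01)).
rewrite -quad_pull.
rewrite -/(pullback2 (euclid n) A (cinv c) h (segment y w (const_mx t))).
rewrite (_ : tmap _ _ _ _ = w); last exact: jacobian_segment.
rewrite -[leRHS]sqrtr1; apply: ler_wsqrtr.
by rewrite segment_const pullback2_cinv //; [exact: qi|exact: ci].
Qed.

(** The bound 1 is arbitrary: any bound uniform on a neighbourhood serves for connecting points and
    for bounding the diameter. *)
Lemma near_path x0 : \forall x \near x0,
  exists2 l, piecewise_path A h x0 x l & (l <= 1)%E.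
Proof.
have [Ac cx] := c1_at mA x0; set c := chart_at A x0 in Ac cx.
have hc := c1_chart mA Ac.
have [r1 r10 Hq] := quad_le_near (@ch x0 c Ac cx).
have /nbhs_normP[r2 /= r20 Hc] := cimg_nbhs hc cx.
set y0 := cmap c x0 in Hq Hc *.
have N : \forall y \near y0, `|y - y0| < r1 /\ `|y - y0| < r2.
  have N1 := near_dist_lt y0 r10; have N2 := near_dist_lt y0 r20.
  near=> y; split; near: y.
    exact: N1.
  exact: N2.
have := chart_push hc cx N; apply: filterS => x [dx [l1 l2]].
have [||l p ll] := @chart_segment_path c y0 (cmap c x - y0) Ac.
- move=> t /andP[t0 t1]; apply: Hc; rewrite /ball_ /= opprD addrA subrr add0r normrN.
  rewrite normrZ ger0_norm //; apply: le_lt_trans l2.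
  by rewrite ler_piMl.
- move=> t /andP[t0 t1]; apply/ltW/Hq => //.
  rewrite addrAC subrr add0r normrZ ger0_norm //; apply: le_lt_trans l1.
  by rewrite ler_piMl.
exists l => //.
by move: p; rewrite addrC subrK !(cmapK hc).
Unshelve. all: by end_near. Qed.

Hypothesis cT : connected [set: T].

(** By [near_path], the set of points joined to [x] and its complement are both open. *)
Lemma path_connected x y : exists l, piecewise_path A h x y l.
Proof.
pose E : set T := [set z | exists l, piecewise_path A h x z l].
have oE : open E.
  rewrite openE => z [l p]; have := near_path z; apply: filterS => z' [l' p' _].
  by exists (l + l')%E; exact: Path_cat p p'.
have oC : open (~` E).
  rewrite openE => z nz; have := near_path z; apply: filterS => z' [l' p' _] [l p].
  by apply: nz; exists (l + l')%E; apply: Path_cat p (path_sym mA ch p').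
have ET : E = setT.
  apply: cT => //; first by exists x, 0%E; exact: path_refl.
  - by exists E => //; rewrite setTI.
  - by exists E; rewrite ?setTI //; rewrite -[E]setCK; exact: open_closedC.
have : E y by rewrite ET.
by [].
Qed.

Hypothesis kT : compact [set: T].

Lemma dist_bounded : exists K : R, forall x y, (riem_dist A h x y <= K%:E)%E.
Proof.
have [[x0 _]|T0] := pselect ([set: T] !=set0); last first.
  by exists 0 => x; exfalso; apply: T0; exists x.
have [K HK] : exists K : R, forall y, (riem_dist A h x0 y <= K%:E)%E.
  have /compact_near_coveringP nc := kT.
  have := nc R (pinfty_nbhs R) (fun K y => (riem_dist A h x0 y <= K%:E)%E) _.
  have H : (forall x : T, [set: T] x -> \forall x' \near x & i \near +oo,
      (riem_dist A h x0 x' <= i%:E)%E).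
    (* Near [x] the distance to [x0] is at most [r + 1]: a path of length [r] to [x], then a short
       one of length at most 1. *)
    move=> x _; have [l p] := path_connected x0 x.
    have [r r0 e] := path_real mA ch p; rewrite e in p.
    exists ([set x' | exists2 l, piecewise_path A h x x' l & (l <= 1)%E], [set K | r + 1 <= K]).
      by split => /=; [exact: near_path|apply: nbhs_pinfty_ge; exact: num_real].
    move=> [x' K] /= [[l' p' l1] rK].
    apply: le_trans (dist_le_path (Path_cat p p')) _.
    by apply: le_trans (leeD2l _ l1) _; rewrite -EFinD lee_fin.
  by move=> /(_ _ H) /filter_ex[K HK]; exists K => y; exact: HK.
exists (K + K) => x y; apply: le_trans (dist_triangle mA ch x x0 y) _.
by rewrite EFinD leeD // (dist_sym mA ch).
Qed.

End LocalBound.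

(** * Separation of points *)

Section Separation.
Context {R : realType}.

Lemma is_derive_quadratic_bound (f : R -> R) (u l : R) :
  (forall k : R, `|f (u + k) - f u - l * k| <= k ^+ 2) -> is_derive u 1 f l.
Proof.
move=> H.
have C : (fun k : R => k^-1 *: (f (k *: 1 + u) - f u)) @ 0^' --> l.
  apply/cvgrPdist_le => e e0; near=> k.
  have k0 : k != 0 by near: k; exact: nbhs_dnbhs_neq.
  have ke : `|k| <= e by near: k; apply: dnbhs0_le.
  have E : l - k^-1 *: (f (k *: 1 + u) - f u) = - (k^-1 * (f (u + k) - f u - l * k)).
    by rewrite /GRing.scale /= mulr1 [k + u]addrC; field.
  rewrite E normrN normrM normfV ler_pdivrMl ?normr_gt0 //.
  apply: le_trans (H k) _; rewrite -[leLHS]ger0_norm ?sqr_ge0 // expr2 normrM.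
  by rewrite ler_wpM2l.
split; first by apply/cvg_ex; exists l.
exact: cvg_lim C.
Unshelve. all: by end_near. Qed.

(** Squaring smooths the corner of the positive part: the first-order remainder is at most k^2, also
    when [u] and [u + k] have opposite signs. *)
Lemma is_derive_sqmax (u : R) :
  is_derive u 1 (fun u => Num.max 0 u ^+ 2) (2 * Num.max 0 u).
Proof.
apply: is_derive_quadratic_bound => k.
have [u0|u0] := leP 0 u; have [uk|uk] := leP 0 (u + k).
- by rewrite (_ : _ - _ - _ = k ^+ 2) ?ger0_norm ?sqr_ge0 //; ring.
- by rewrite ler_norml; apply/andP; split; nra.
- by rewrite ler_norml; apply/andP; split; nra.
- by rewrite expr0n /= mulr0 mul0r !subr0 normr0 sqr_ge0.
Qed.

Lemma is_derive_const_mx (f : 'rV[R]_1 -> R) t l :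
  is_derive (const_mx t) (delta_mx 0 0) f l ->
  is_derive t 1 (fun u => f (const_mx u)) l.
Proof.
have E : (fun k : R => k^-1 *: (f (const_mx (k *: 1 + t)) - f (const_mx t))) =
  (fun k : R => k^-1 *: (f (k *: delta_mx 0 0 + const_mx t) - f (const_mx t))).
  apply/funext => k; congr (_ *: (f _ - _)); apply/rowP => i.
  by rewrite !mxE !ord1 eqxx.
move=> [df Df]; split; first by move: df; rewrite /derivable -E.
by rewrite -Df /derive -E.
Qed.

Lemma is_derive_curve n (F : 'rV[R]_1 -> 'rV[R]_n) t k :
  differentiable F (const_mx t) ->
  is_derive t 1 (fun u => F (const_mx u) 0 k) ('J F (const_mx t) 0 k).
Proof.
move=> dF; apply: (is_derive_const_mx (f := fun v => F v 0 k)).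
rewrite jacobian_entry // /pd; apply: derivableP; apply: diff_derivable.
apply: (@differentiable_comp _ _ _ _ F (fun v : 'rV[R]_n => v 0 k)) => //.
exact: differentiable_coord.
Qed.

Lemma le_sqrt_div (la x q : R) : 0 < la -> 0 <= x -> la * x ^+ 2 <= q ->
  x <= Num.sqrt q / Num.sqrt la.
Proof.
move=> la0 x0 H; rewrite ler_pdivlMr ?sqrtr_gt0 //.
rewrite -[x in x * _](ger0_norm x0) -sqrtr_sqr -sqrtrM ?sqr_ge0 //.
by apply: ler_wsqrtr; rewrite mulrC.
Qed.

(** The norm of ['rV_n] is the maximum norm, which is not differentiable; the bump function is built
    from this Euclidean square instead. *)
Definition sqnorm n (v : 'rV[R]_n) : R := \sum_k v 0 k ^+ 2.

Lemma sqnorm_ge0 n (v : 'rV[R]_n) : 0 <= sqnorm v.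
Proof. by apply: sumr_ge0 => k _; exact: sqr_ge0. Qed.

Lemma sqnorm_coord n (v : 'rV[R]_n) k : v 0 k ^+ 2 <= sqnorm v.
Proof.
by rewrite /sqnorm (bigD1 k) //= lerDl; apply: sumr_ge0 => l _; exact: sqr_ge0.
Qed.

Lemma sqnorm_gt0 n (v : 'rV[R]_n) : v != 0 -> 0 < sqnorm v.
Proof.
move=> v0; have [k vk] : exists k, v 0 k != 0.
  apply/not_existsP => H; move: v0 => /eqP; apply; apply/rowP => k; rewrite mxE.
  by apply/eqP/negPn/negP; exact: H.
by apply: lt_le_trans (sqnorm_coord v k); rewrite exprn_even_gt0.
Qed.

Lemma le_coord_norm n (v : 'rV[R]_n) k : `|v 0 k| <= `|v|.
Proof. by rewrite [leRHS]/Num.norm /= mx_normrE; exact: (le_bigmax _ _ (0, k)). Qed.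

Lemma norm_lt_sqnorm n (v : 'rV[R]_n) (r : R) : 0 < r -> sqnorm v <= r ^+ 2 -> `|v| <= r.
Proof.
move=> r0 H; rewrite [leLHS]/Num.norm /= mx_normrE; apply: bigmax_le; first exact: ltW.
move=> [i k] _ /=; rewrite ord1.
have : `|v 0 k| ^+ 2 <= r ^+ 2.
  by rewrite -normrX ger0_norm ?sqr_ge0 //; exact: le_trans (sqnorm_coord v k) H.
by rewrite ler_sqr // nnegrE ltW.
Qed.

Lemma sum_dot_le n (u w : 'rV[R]_n) (r : R) : 0 <= r -> `|u| <= r ->
  \sum_k 2 * u 0 k * w 0 k <= n%:R * (2 * r * `|w|).
Proof.
move=> r0 ur; apply: (@le_trans _ _ (\sum_(k < n) 2 * r * `|w|)); last first.
  by rewrite sumr_const card_ord -[leLHS]mulr_natl.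
apply: ler_sum => k _.
have a1 := le_coord_norm w k; have a2 := le_trans (le_coord_norm u k) ur.
apply: le_trans (ler_norm _) _; rewrite !normrM ger0_norm //.
by apply: ler_pM => //; rewrite ler_wpM2l.
Qed.

(** Here 2 g S is the rate of decrease of the bump along a curve of speed [s]: g <= r^2, coordinates
    are at most [r], and the coordinate velocity [W] is at most s / sqrt la. The product gives 4 r^3
    N / sqrt la; the summand 1 keeps the constant positive even for N = 0. *)
Lemma bump_bound (r g s la S W : R) (N : nat) : 0 <= r -> 0 <= g -> g <= r ^+ 2 -> 0 <= s ->
  0 < la -> S <= N%:R * (2 * r * W) -> W <= s / Num.sqrt la ->
  2 * g * S <= (4 * r ^+ 3 * N%:R / Num.sqrt la + 1) * s.
Proof.
move=> r0 g0 gr s0 la0 HS HW.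
have sla : 0 <= s / Num.sqrt la by rewrite divr_ge0 ?sqrtr_ge0.
apply: (@le_trans _ _ (2 * g * (N%:R * (2 * r * (s / Num.sqrt la))))).
  rewrite ler_wpM2l ?mulr_ge0 //; apply: le_trans HS _.
  by rewrite !ler_wpM2l ?mulr_ge0.
apply: (@le_trans _ _ (2 * r ^+ 2 * (N%:R * (2 * r * (s / Num.sqrt la))))).
  by rewrite ler_wpM2r ?ler_wpM2l // !mulr_ge0.
have -> : 2 * r ^+ 2 * (N%:R * (2 * r * (s / Num.sqrt la))) =
  4 * r ^+ 3 * N%:R / Num.sqrt la * s by ring.
by rewrite [leRHS]mulrDl mul1r lerDl.
Qed.

Context {T : topologicalType} {n : nat} {A : @atlas R T n} {h : T -> 'M[R]_n}.
Hypothesis mA : C1_manifold A.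
Hypothesis ch : forall x, C0tensor2 A h x.
Hypothesis hT : hausdorff_space T.

(** In the preferred chart the function is the squared positive part of r^2 - |y - y0|^2, extended
    by 0. A one-sided bound on its derivative is enough, since only a drop from the peak at [x0] has
    to be paid for by length. *)
Lemma bump x0 : (forall v, v != 0 -> 0 < quad (h x0) v) ->
  exists (phi : T -> R) (C : R), [/\ 0 < C, forall y, y <> x0 -> phi y < phi x0 &
    forall s t, C1at (euclid 1) A s (const_mx t) ->
      exists2 D, is_derive t 1 (fun u => phi (s (const_mx u))) D &
        - D <= C * speed A h s (const_mx t)].
Proof.
move=> ph; have [Ac cx] := c1_at mA x0; set c := chart_at A x0 in Ac cx.
have hc := c1_chart mA Ac; set y0 := cmap c x0.
(* At its own base point the preferred chart gives the identity change of frame, so the coordinate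
   matrix there is [h x0] itself. *)
have pG v : v != 0 -> 0 < quad (coord2 A c h y0) v.
  move=> v0; rewrite /coord2 /y0 (cmapK hc) // change_mxE // locm_id //.
  by rewrite mul1mx trmx1 mulmx1; exact: ph.
have [la la0 Hla] := quad_ge_near (@ch x0 c Ac cx) pG.
have /nbhs_normP[e /= e0 He] : nbhs y0 [set y | cimg c y /\
    forall w, la * `|w| ^+ 2 <= quad (coord2 A c h y) w].
  by apply: filterI => //; exact: cimg_nbhs.
pose r := e / 2; have r0 : 0 < r by rewrite divr_gt0.
have Hr y : sqnorm (y - y0) <= r ^+ 2 -> cimg c y /\
    forall w, la * `|w| ^+ 2 <= quad (coord2 A c h y) w.
  move=> /(norm_lt_sqnorm r0) yr; apply: He; rewrite /ball_ /= distrC.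
  by apply: le_lt_trans yr _; rewrite /r; lra.
pose psi (y : 'rV[R]_n) := Num.max 0 (r ^+ 2 - sqnorm (y - y0)) ^+ 2.
pose phi z := if `[< cdom c z >] then psi (cmap c z) else 0.
(* The support is compact, hence closed in the Hausdorff space [T]. So a point outside the chart has
   a neighbourhood on which the function is 0, and the extension by 0 stays differentiable along
   curves. *)
pose K := cinv c @` [set y | sqnorm (y - y0) <= r ^+ 2].
have Kc : closed K.
  apply: compact_closed => //; apply: continuous_compact.
    by apply: continuous_in_subspaceT => y; rewrite inE /= => /Hr[cy _]; exact: cinv_continuous.
  apply: bounded_closed_compact.
    exists (`|y0| + r); split; first exact: num_real.
    move=> M HM y /(norm_lt_sqnorm r0) yr; apply/ltW; apply: le_lt_trans HM.
    by rewrite -[y](subrK y0) addrC (le_trans (ler_normD _ _)) // lerD2l.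
  apply: (@closed_comp _ _ (fun y : 'rV[R]_n => sqnorm (y - y0)) [set x | x <= r ^+ 2]).
    move=> y _; apply: for_continuous_sum => k.
    rewrite (_ : (fun z => _) = (fun z : 'rV[R]_n => (z 0 k + cst (- y0 0 k) z) * (z 0 k + cst (- y0 0 k) z))).
      by apply: for_continuousM; apply: for_continuousD;
        [exact: coord_continuous|exact: cst_continuous|exact: coord_continuous|exact: cst_continuous].
    by apply/funext => z; rewrite expr2 !mxE.
  exact: closed_le.
have phiK z : ~ K z -> phi z = 0.
  move=> nK; rewrite /phi; case: asboolP => // cz; rewrite /psi max_l ?expr0n //.
  rewrite subr_le0 leNgt; apply/negP => H; apply: nK; exists (cmap c z).
    exact: ltW.
  exact: cmapK.
pose C := 4 * r ^+ 3 * n%:R / Num.sqrt la + 1.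
have C0 : 0 < C.
  by rewrite /C ltr_wpDl // divr_ge0 ?sqrtr_ge0 // mulr_ge0 // mulr_ge0 // exprn_ge0 // ltW.
exists phi, C; split => //.
  move=> y yx0.
  have -> : phi x0 = (r ^+ 2) ^+ 2.
    rewrite /phi asboolT // /psi subrr /sqnorm big1 ?subr0 ?max_r ?sqr_ge0 //.
    by move=> k _; rewrite mxE expr0n.
  rewrite /phi; case: asboolP => [cy|_]; last by rewrite exprn_even_gt0 //= sqrf_eq0 gt_eqF.
  have sy : 0 < sqnorm (cmap c y - y0).
    apply: sqnorm_gt0; rewrite subr_eq0; apply/eqP => E; apply: yx0.
    by rewrite -(cmapK hc cy) E /y0 cmapK.
  rewrite /psi ltr_sqr ?nnegrE ?le_max ?lexx ?sqr_ge0 //.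
  by rewrite gt_max exprn_gt0 //= ltrBlDr ltrDl.
move=> s t Cs; set v := const_mx t in Cs *.
have spd0 := speed_ge0 (A := A) (h := h) s v.
have cs := C1at_continuous Cs.
have ccm := @const_mx_continuous R t.
have [cst_|ncst] := pselect (cdom c (s v)); last first.
  exists 0; last by rewrite oppr0 mulr_ge0 // ltW.
  have nK : ~ K (s v).
    by move=> [y /Hr[cy _] E]; apply: ncst; rewrite -E; exact: cinv_dom.
  have N : nbhs (s v) (~` K) by apply: open_nbhs_nbhs; split => //; exact: closed_openC.
  have N' : nbhs t (fun u : R => ~ K (s (const_mx u))) := ccm _ (cs _ N).
  apply: (near_eq_is_derive (f := cst 0)).
  by apply: filterS N' => u /= /phiK ->.
pose F := cmap c \o s.
have CF : C1v F v by exact: (C1at_loc Cs (c1 := Chart setT id id) (c2 := c)).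
have dF := C1v_differentiable CF.
pose w : 'rV[R]_n := 'J F v.
pose gg u := r ^+ 2 - sqnorm (F (const_mx u) - y0).
have dk k : is_derive t 1 (fun u => (F (const_mx u) - y0) 0 k ^+ 2)
    (2 * (F v - y0) 0 k * w 0 k).
  have d1 := is_derive_curve k dF.
  have d2 : is_derive t 1 (fun u => (F (const_mx u) - y0) 0 k) (w 0 k).
    rewrite (_ : (fun u => _) = (fun u => F (const_mx u) 0 k + cst (- y0 0 k) u)).
      by have := is_deriveD d1 (is_derive_cst (- y0 0 k) t 1); rewrite addr0.
    by apply/funext => u; rewrite !mxE.
  have := is_deriveM d2 d2.
  rewrite (_ : _ + _ = 2 * (F v - y0) 0 k * w 0 k) //.
  by rewrite /GRing.scale /=; ring.
have dg : is_derive t 1 gg (- \sum_k 2 * (F v - y0) 0 k * w 0 k).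
  have := is_deriveB (is_derive_cst (r ^+ 2) t 1) (is_derive_sum dk).
  rewrite sub0r; congr is_derive; apply/funext => u.
  by rewrite /gg /sqnorm !fctE fct_sumE.
exists (2 * Num.max 0 (gg t) * (- \sum_k 2 * (F v - y0) 0 k * w 0 k)).
  apply: (near_eq_is_derive (f := (fun u => Num.max 0 u ^+ 2) \o gg)).
  - have N' : nbhs t (fun u : R => cdom c (s (const_mx u))) :=
      ccm _ (cs _ (chart_nbhs hc cst_)).
    apply: filterS N' => u /= cu.
    by rewrite /phi asboolT.
  - by have := is_derive1_comp (is_derive_sqmax (gg t)) dg.
have [g0|g0] := leP (gg t) 0.
  by rewrite mulr0 mul0r oppr0 mulr_ge0 // ltW.
rewrite mulrN opprK.
have sq : sqnorm (F v - y0) <= r ^+ 2 by move: g0; rewrite /gg subr_gt0 => /ltW.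
have [cF laF] := Hr _ sq.
have g1 : gg t <= r ^+ 2 by rewrite /gg lerBlDr lerDl sqnorm_ge0.
have spdE : speed A h s v = Num.sqrt (quad (coord2 A c h (F v)) w).
  have := coord2_pullback euclid_manifold mA Cs h (c1 := Chart setT id id) (c2 := c) erefl Ac I cst_.
  rewrite coord2_euclid /= => E.
  by rewrite /speed E.
have wl : `|w| <= speed A h s v / Num.sqrt la.
  by rewrite spdE; exact: le_sqrt_div la0 (normr_ge0 w) (laF w).
have S := sum_dot_le w (ltW r0) (norm_lt_sqnorm r0 sq).
exact: bump_bound (ltW r0) (ltW g0) g1 spd0 la0 S wl.
Qed.

Lemma dist_gt0 x0 y : (forall v, v != 0 -> 0 < quad (h x0) v) -> y <> x0 ->
  (0 < riem_dist A h x0 y)%E.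
Proof.
move=> ph yx0; have [phi [C [C0 phy H]]] := bump ph.
suff : forall x z l, piecewise_path A h x z l -> ((phi x - phi z)%:E <= C%:E * l)%E.
  move=> Hl; apply: (@lt_le_trans _ _ ((phi x0 - phi y) / C)%:E).
    by rewrite lte_fin divr_gt0 // subr_gt0; exact: phy.
  apply: le_dist => l /[dup] p /Hl; have [rr r0 ->] := path_real mA ch p.
  by rewrite -EFinM !lee_fin ler_pdivrMr // mulrC.
apply: (path_ind_C1 mA) => [s Cs|a1 a2 a3 l1 l2 p1 q1 p2 q2].
  have [G pG ->] := curve_length_primitive mA ch Cs.
  have [D HD] : exists D : R -> R, forall t : R, 0 <= t <= 1 ->
      is_derive t 1 (fun u => phi (s (const_mx u))) (D t) /\
      - D t <= C * speed A h s (const_mx t).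
    have : forall t : R, exists D : R, 0 <= t <= 1 ->
      is_derive t 1 (fun u => phi (s (const_mx u))) D /\
      - D <= C * speed A h s (const_mx t).
      move=> t; have [t01|nt] := pselect (0 <= t <= 1); last by exists 0.
      by have [D d1 d2] := H _ _ (Cs t t01); exists D.
    by move=> /boolp.choice[D HD]; exists D.
  have p1 : primitive (fun t => - D t) (fun u => - phi (s (const_mx u))) 0 1.
    by move=> t /HD[? _]; exact: is_deriveN.
  have p2 : primitive (fun t => C * speed A h s (const_mx t)) (fun t => C * G t) 0 1.
    by move=> t /pG ?; exact: is_deriveZ.
  have := primitive_le ler01 p1 p2; rewrite -EFinM lee_fin mulrBr => /(_ _).
  by rewrite opprK addrC => -> // t /HD[].
have [r1 r10 e1] := path_real mA ch p1; have [r2 r20 e2] := path_real mA ch p2.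
by move: q1 q2; rewrite e1 e2 -EFinD -!EFinM !lee_fin; lra.
Qed.

End Separation.

(** * Lifting curves to the circle bundle *)

Section RealChain.
Context {R : realType}.

(** Induction along [0, 1], in place of a subdivision by a Lebesgue number: the supremum of the [t]
    reachable from 0 is itself reachable and can be passed unless it is 1. *)
Lemma real_chain (L : R -> R -> Prop) :
  (forall a b c, 0 <= a <= b -> b <= c <= 1 -> L a b -> L b c -> L a c) ->
  (forall t, 0 <= t <= 1 -> exists2 de : R, 0 < de & forall a b, 0 <= a <= b -> b <= 1 ->
    `|a - t| < de -> `|b - t| < de -> L a b) -> L 0 1.
Proof.
move=> Lt Ll.
pose S := [set t : R | 0 <= t <= 1 /\ L 0 t].
have S0 : S 0.
  split; first by rewrite lexx ler01.
  have [|de de0 H] := Ll 0; first by rewrite lexx ler01.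
  by apply: H; rewrite ?lexx ?ler01 // subrr normr0.
have hS : has_sup S.
  by split; [exists 0|exists 1 => t [/andP[_ t1] _]].
have s01 : 0 <= sup S <= 1.
  apply/andP; split; first exact: ub_le_sup hS.2 _ S0.
  by apply: ge_sup => //; [exists 0|move=> t [/andP[_ t1] _]].
have [de de0 H] := Ll _ s01.
have [t [t01 Lt0] ts] := sup_adherent de0 hS.
have tle : t <= sup S by apply: ub_le_sup hS.2 _ _.
have [/andP[t0 t1] /andP[s0 s1]] := (t01, s01).
have L0 u : t <= u -> u <= 1 -> `|u - sup S| < de -> S u.
  move=> tu u1 us; split; first by rewrite u1 (le_trans t0).
  apply: (Lt 0 t u) => //; rewrite ?lexx ?tu //.
  by apply: H; rewrite ?t0 //; rewrite ltr_norml; apply/andP; split; lra.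
(* A reachable point beyond the supremum, unless the cut at 1 is active; the half keeps it inside
   the neighbourhood given by the local hypothesis. *)
pose u := Num.min 1 (sup S + de / 2).
have u1 : u <= 1 by rewrite /u ge_min lexx.
have us : sup S <= u by rewrite /u le_min s1 /=; lra.
have u2 : u <= sup S + de / 2 by rewrite /u ge_min lexx orbT.
have Su : S u.
  by apply: L0 => //; [exact: le_trans us|rewrite ltr_norml; apply/andP; split; lra].
have us2 : u <= sup S by apply: ub_le_sup hS.2 _ Su.
have <- : u = 1.
  apply/min_idPl; have [//|h] := leP 1 (sup S + de / 2).
  by move: us2; rewrite /u (min_idPr (ltW h)); lra.
by case: Su.
Qed.

End RealChain.

Section RealFunctions.
Context {R : realType}.

Lemma is_derive_coord00 (th : R -> R) (v : 'rV[R]_1) (l : R) :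
  is_derive (v 0 0) 1 th l -> is_derive v (delta_mx 0 0) (fun w : 'rV[R]_1 => th (w 0 0)) l.
Proof.
have E : (fun k : R => k^-1 *: (th (k *: 1 + v 0 0) - th (v 0 0))) =
  (fun k : R => k^-1 *: (th ((k *: delta_mx 0 0 + v) 0 0) - th (v 0 0))).
  by apply/funext => k; rewrite !mxE eqxx.
move=> [dth Dth]; split; first by move: dth; rewrite /derivable E.
by rewrite -Dth /derive E.
Qed.

(** Curves are parametrized by ['rV_1], while the angle of a horizontal lift is a primitive on the
    real line; this transports it. *)
Lemma C1v_real (th fe : R -> R) (a b t : R) : continuous fe -> a < t < b ->
  (forall u, a < u < b -> is_derive u 1 th (fe u)) ->
  C1v (fun v : 'rV[R]_1 => const_mx (th (v 0 0)) : 'rV[R]_1) (const_mx t) /\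
  'J (fun v : 'rV[R]_1 => const_mx (th (v 0 0)) : 'rV[R]_1) (const_mx t) = (fe t)%:M.
Proof.
move=> cfe tab dth.
pose F (v : 'rV[R]_1) : 'rV[R]_1 := const_mx (th (v 0 0)).
pose U := [set v : 'rV[R]_1 | a < v 0 0 < b].
have E j : (fun z => F z 0 j) = (fun w : 'rV[R]_1 => th (w 0 0)).
  by apply/funext => z; rewrite mxE.
have Ut : nbhs (const_mx t : 'rV[R]_1) U.
  have co : {for (const_mx t : 'rV[R]_1), continuous (fun M : 'rV[R]_1 => M 0 0)}.
    exact: coord_continuous.
  apply: (co [set u | a < u < b]); rewrite mxE.
  by apply: near_in_itvoo; rewrite in_itv.
have CF : Ckv 1 U F.
  move=> j; rewrite E; split=> [v Uv|i].
    apply: (@differentiable_comp _ _ _ _ (fun w : 'rV[R]_1 => w 0 0) th).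
      exact: differentiable_coord.
    by apply/derivable1_diffP; case: (dth _ Uv).
  rewrite ord1 => v Uv.
  have Un : \forall w \near v, U w.
    have co : {for v, continuous (fun M : 'rV[R]_1 => M 0 0)} by exact: coord_continuous.
    apply: (co [set u | a < u < b]).
    by apply: near_in_itvoo; rewrite in_itv.
  apply: (@near_eq_for_continuous _ _ (fun w : 'rV[R]_1 => fe (w 0 0))).
    by apply: filterS Un => w /dth /is_derive_coord00[_ <-].
  apply: (@continuous_comp _ _ _ (fun w : 'rV[R]_1 => w 0 0) fe); last exact: cfe.
  exact: coord_continuous.
have C1 := C1v_coord Ut CF; split => //.
apply/matrixP => i j; rewrite jacobian_entry; last exact: C1v_differentiable C1.
rewrite !ord1 E /pd mxE eqxx mulr1n.
have ttab : a < (const_mx t : 'rV[R]_1) 0 0 < b by rewrite mxE.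
by have [_ ->] := is_derive_coord00 (dth _ ttab); rewrite mxE.
Qed.

End RealFunctions.

(** * The base metric, and topological properties of the product *)

Section BaseMetric.
Unset Implicit Arguments.
Context {R : realType} {m : nat} {M : 'I_m -> topologicalType} {d : 'I_m -> nat}.
Context {A : forall i, @atlas R (M i) (d i)} {g : forall i, M i -> 'M[R]_(d i)}.
Set Implicit Arguments.
Hypothesis mA : forall i, C1_manifold (A i).
Hypothesis cg : forall i x, C0tensor2 (A i) (g i) x.
Hypothesis pg : forall i x v, v != 0 -> 0 < quad (g i x) v.

Lemma quad0 n (G : 'M[R]_n) : quad G 0 = 0.
Proof. by rewrite /quad !mul0mx mxE. Qed.

Lemma quad_ge0 i x v : 0 <= quad (g i x) v.
Proof. by have [->|/pg/ltW //] := eqVneq v 0; rewrite quad0. Qed.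

Lemma quad_base b (y : prod_topology M) w :
  quad (base_metric A g b y) w = \sum_i b i * quad (g i (y i)) (submxrow w i).
Proof.
rewrite /base_metric quad_sum; apply: eq_bigr => i _.
by rewrite quadZl /pullback2 quad_pull tmap_proj // -submxrowE.
Qed.

Lemma base_C0 b y : C0tensor2 (bigprod_atlas A) (base_metric A g b) y.
Proof.
apply: C0tensor2_sum => i; apply: C0tensor2Z.
apply: pullback2_C0 (bigprod_manifold mA) (mA i) _ _ _ (C1at_proj mA i y) _.
exact: cg.
Qed.

Lemma quad_base_gt0 b y w : (forall i, 0 < b i) -> w != 0 ->
  0 < quad (base_metric A g b y) w.
Proof.
move=> b0 w0; rewrite quad_base.
have [i wi] : exists i, submxrow w i != 0.
  apply/not_existsP => H; move: w0 => /eqP; apply; apply/mxrowP => j.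
  by rewrite submxrow0; apply/eqP/negPn/negP; exact: H.
rewrite (bigD1 i) //=; apply: ltr_pwDl; first by rewrite mulr_gt0 // pg.
by apply: sumr_ge0 => j _; rewrite mulr_ge0 ?quad_ge0 // ltW.
Qed.

Lemma quad_base_le b c K y w : (forall i, b i <= K * c i) ->
  quad (base_metric A g b y) w <= K * quad (base_metric A g c y) w.
Proof.
move=> H; rewrite !quad_base mulr_sumr; apply: ler_sum => i _.
by rewrite mulrA ler_wpM2r // quad_ge0.
Qed.

Lemma prod_connected : (forall i, connected [set: M i]) ->
  connected [set: prod_topology M].
Proof.
move=> cM.
have [[x _]|T0] := pselect ([set: prod_topology M] !=set0); last first.
  rewrite (_ : [set: _] = set0); first exact: connected0.
  by apply/seteqP; split => // x _; exfalso; apply: T0; exists x.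
suff E y : connected_component [set: prod_topology M] x y.
  rewrite (_ : [set: _] = connected_component [set: prod_topology M] x).
    exact: component_connected.
  by apply/seteqP; split => // y _; exact: E.
(* Coordinates are changed from [x] to [y] one at a time; consecutive points lie in a connected copy
   of one factor. *)
pose z k : prod_topology M := fun i => if (i < k)%N then y i else x i.
have H k : connected_component [set: prod_topology M] x (z k).
  elim: k => [|k IH].
    rewrite (_ : z 0%N = x); first exact: connected_component_refl.
    by apply: functional_extensionality_dep => i.
  apply: connected_component_trans IH _.
  have [km|mk] := ltnP k m; last first.
    rewrite (_ : z k.+1 = z k); first exact: connected_component_refl.
    apply: functional_extensionality_dep => i; rewrite /z.
    by rewrite !(leq_trans (ltn_ord i)) // ltnW.
  pose j := Ordinal km.
  pose F : M j -> prod_topology M := dfwith (z k) j.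
  have cI : connected (F @` [set: M j]).
    apply: connected_continuous_connected (cM j) _.
    by apply: continuous_subspaceT; exact: dfwith_continuous.
  exists (F @` [set: M j]).
    split => //; exists (z k j) => //.
    by apply: functional_extensionality_dep => i; rewrite /F; case: dfwithP.
  exists (y j) => //; apply: functional_extensionality_dep => i.
  rewrite /F; case: dfwithP => [|l jl]; first by rewrite /z /= leqnn.
  have lk : (l != k :> nat) by apply: contra jl => /eqP E; apply/eqP/val_inj.
  have E : (l < k.+1)%N = (l < k)%N by rewrite ltnS [LHS]leq_eqVlt (negbTE lk).
  by rewrite /z E.
have := H m; rewrite (_ : z m = y) //.
by apply: functional_extensionality_dep => i; rewrite /z ltn_ord.
Qed.

Lemma prod_compact : (forall i, compact [set: M i]) -> compact [set: prod_topology M].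
Proof.
move=> kM; have := tychonoff kM; congr (@compact _ _).
by apply/seteqP; split.
Qed.

Lemma prod_hausdorff : (forall i, hausdorff_space (M i)) -> hausdorff_space (prod_topology M).
Proof. exact: hausdorff_product. Qed.

End BaseMetric.

(** * The circle bundle: orbits, fibres, and horizontal lifts *)

Section Bundle.
Unset Implicit Arguments.
Context {R : realType} {m : nat} {M : 'I_m -> topologicalType} {d : 'I_m -> nat}.
Context {A : forall i, @atlas R (M i) (d i)} {g : forall i, M i -> 'M[R]_(d i)}.
Context {P : topologicalType} {AP : @atlas R P (\sum_i d i).+1}.
Context {prj : P -> prod_topology M} {act : R -> P -> P}.
Context {sigma : P -> 'cV[R]_(\sum_i d i).+1}.
Set Implicit Arguments.
Hypothesis mA : forall i, C1_manifold (A i).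
Hypothesis cg : forall i x, C0tensor2 (A i) (g i) x.
Hypothesis pg : forall i x v, v != 0 -> 0 < quad (g i x) v.
Notation B := (bigprod_atlas A).
Hypothesis pcb : principal_circle_bundle AP B prj act.
Hypothesis pcon : principal_connection AP act sigma.

Let mP : C1_manifold AP := is_manifold_C1 (pcb_manifold pcb).
Let mB : C1_manifold B := bigprod_manifold mA.
Let mE := @euclid_manifold R 1.
Let mEP := prod_manifold mE mP.

Lemma C1at_prj x : C1at AP B prj x.
Proof. exact: Ck_map_on_C1at mP mB _ _ _ (pcb_prj_smooth pcb 1%N) I. Qed.

Lemma C1at_prji i x : C1at AP (A i) (fun z => prj z i) x.
Proof. exact: (C1at_comp mP mB (C1at_prj x) (C1at_proj mA i (prj x))). Qed.

Lemma C1at_actmap z : C1at (prod_atlas (euclid 1) AP) AP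
  (fun z : 'rV[R]_1 * P => act (z.1 0 0) z.2) z.
Proof. exact: Ck_map_on_C1at mEP mP _ _ _ (pcb_act_smooth pcb 1%N) I. Qed.

Lemma tmap_actmap (T0 : topologicalType) n0 (A0 : @atlas R T0 n0) (u : T0 -> 'rV[R]_1)
    (f : T0 -> P) x : C1_manifold A0 -> C1at A0 (euclid 1) u x -> C1at A0 AP f x ->
  C1at A0 AP (fun z => act (u z 0 0) (f z)) x /\
  tmap A0 AP (fun z => act (u z 0 0) (f z)) x =
  row_mx (tmap A0 (euclid 1) u x) (tmap A0 AP f x) *m
    tmap (prod_atlas (euclid 1) AP) AP (fun z : 'rV[R]_1 * P => act (z.1 0 0) z.2) (u x, f x).
Proof.
move=> m0 Cu Cf; have [CP TP] := C1at_pair mE mP m0 Cu Cf.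
split; first exact: (C1at_comp m0 mEP CP (C1at_actmap _)).
by rewrite -TP; exact: (tmap_comp m0 mEP mP CP (C1at_actmap _)).
Qed.

Lemma C1at_act th x : C1at AP AP (act th) x.
Proof.
have := (tmap_actmap mP (C1at_cst (A1 := AP) (A2 := euclid 1) (const_mx th) x) (C1at_id x mP)).1.
by congr (C1at _ _ _ _); apply/funext => z; rewrite /= mxE.
Qed.

Lemma C1at_orbit x t : C1at (euclid 1) AP (orbit_map act x) t.
Proof. exact: (tmap_actmap mE (C1at_id t mE) (C1at_cst x t)).1. Qed.

(** The product rule for the action: its differential is evaluated on each factor by freezing the
    other argument. *)
Lemma tmap_act_split (T0 : topologicalType) n0 (A0 : @atlas R T0 n0) (u : T0 -> 'rV[R]_1)
    (f : T0 -> P) x : C1_manifold A0 -> C1at A0 (euclid 1) u x -> C1at A0 AP f x ->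
  tmap A0 AP (fun z => act (u z 0 0) (f z)) x =
  tmap A0 (euclid 1) u x *m tmap (euclid 1) AP (orbit_map act (f x)) (u x) +
  tmap A0 AP f x *m tmap AP AP (act (u x 0 0)) (f x).
Proof.
move=> m0 Cu Cf; rewrite (tmap_actmap m0 Cu Cf).2.
set D := tmap (prod_atlas _ _) _ _ _.
have E1 : tmap (euclid 1) AP (orbit_map act (f x)) (u x) = row_mx 1%:M 0 *m D.
  have [_] := tmap_actmap mE (C1at_id (u x) mE) (C1at_cst (A1 := euclid 1) (A2 := AP) (f x) (u x)).
  by rewrite tmap_id // tmap_cst.
have E2 : tmap AP AP (act (u x 0 0)) (f x) = row_mx 0 1%:M *m D.
  have [_] := tmap_actmap mP (C1at_cst (A1 := AP) (A2 := euclid 1) (u x) (f x)) (C1at_id (f x) mP).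
  by rewrite tmap_id // tmap_cst.
by rewrite E1 E2 !mulmxA -mulmxDl -row_mxE.
Qed.

(** The connection is normalized only at parameter 0; the group law moves [t] to 0, the orbit of [x]
    being a translate of the orbit of [act (t 0 0) x]. *)
Lemma pullback1_orbit x t : pullback1 (euclid 1) AP (orbit_map act x) sigma t 0 0 = 1.
Proof.
pose tr : 'rV[R]_1 -> 'rV[R]_1 := affine1 (- t 0 0) (1 - t 0 0).
have trt : tr t = 0.
  by apply/rowP => i; rewrite /tr /affine1 !mxE !ord1; ring.
have E : orbit_map act x = orbit_map act (act (t 0 0) x) \o tr.
  apply/funext => u; rewrite /orbit_map /= -(pcb_actD pcb); congr (act _ x).
  by rewrite /tr /affine1 !mxE; ring.
have Ct : C1at (euclid 1) (euclid 1) tr t by apply/C1at_euclid; exact: C1v_affine1.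
rewrite E (pullback1_comp _ mE mE mP Ct (C1at_orbit _ _)).
rewrite /pullback1 (_ : tmap _ _ tr _ = 1%:M).
  by rewrite mul1mx trt; exact: (conn_normalized pcon).
have -> : 1%:M = (1 - t 0 0 - - t 0 0)%:M :> 'M[R]_1 by congr (_%:M); ring.
exact: jacobian_affine1.
Qed.

(** By local triviality [x] lies on the orbit of the section point over [prj x], and that entire
    orbit lies over [prj x]. *)
Lemma prj_act th x : prj (act th x) = prj x.
Proof.
have [U [_ Ux [s [chi [_ _ H1 H2]]]]] := pcb_trivial pcb (prj x).
have [th0 E] := H2 _ Ux.
rewrite {1}E -(pcb_actD pcb).
exact: (H1 (prj x) (th + th0) Ux).1.
Qed.

Lemma same_fibre x x' : prj x = prj x' -> exists th, x' = act th x.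
Proof.
move=> E; have [U [_ Ux [s [chi [_ _ H1 H2]]]]] := pcb_trivial pcb (prj x).
have [th0 E0] := H2 _ Ux; have := H2 x'; rewrite -E => /(_ Ux)[th1 E1].
exists (th1 - th0).
by rewrite {1}E0 -(pcb_actD pcb) subrK.
Qed.

Lemma local_section b : exists U (s : prod_topology M -> P), [/\ open U, U b,
  forall c, U c -> C1at B AP s c & forall c, U c -> prj (s c) = c].
Proof.
have [U [oU Ub [s [chi [ss _ H1 H2]]]]] := pcb_trivial pcb b.
exists U, s; split => // c Uc.
  exact: Ck_map_on_C1at mB mP _ _ _ (ss 1%N) Uc.
by have [] := H1 c 0 Uc; rewrite (pcb_act0 pcb).
Qed.

Lemma prj_surjective b : exists x, prj x = b.
Proof. by have [U [s [_ Ub _ H]]] := local_section b; exists (s b); exact: H. Qed.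

Lemma tmap_prj_orbit x t : tmap (euclid 1) AP (orbit_map act x) t *m
  tmap AP B prj (orbit_map act x t) = 0.
Proof.
rewrite -(tmap_comp mE mP mB (C1at_orbit x t) (C1at_prj _)).
rewrite (_ : prj \o _ = cst (prj x)); first exact: tmap_cst.
by apply/funext => u; exact: prj_act.
Qed.

(** The metric splits into a vertical part, measured by the connection, and the base metric of the
    projected vector; every comparison with the base starts here. *)
Lemma quad_bundle a b x v : quad (bundle_metric AP A prj sigma g a b x) v =
  a * (v *m sigma x) 0 0 ^+ 2 + quad (base_metric A g b (prj x)) (v *m tmap AP B prj x).
Proof.
rewrite /bundle_metric quadD quadZl; congr (a * _ + _).
  by rewrite /quad mulmxA -mulmxA -trmx_mul mxE big_ord1 [in X in _ * X]mxE.
rewrite quad_base // quad_sum; apply: eq_bigr => i _.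
rewrite quadZl /pullback2 quad_pull; congr (_ * quad _ _).
have -> : tmap AP (A i) (fun z => prj z i) x = tmap AP B prj x *m submxrow 1%:M i.
  rewrite -(tmap_proj mA i (prj x)).
  exact: (tmap_comp mP mB (mA i) (C1at_prj x) (C1at_proj mA i (prj x))).
by rewrite mulmxA -submxrowE.
Qed.

Lemma bundle_C0 a b x : C0tensor2 AP (bundle_metric AP A prj sigma g a b) x.
Proof.
apply: C0tensor2D.
  by apply: C0tensor2Z; apply: C0tensor1_square; apply: smooth1_C0; exact: conn_smooth pcon.
apply: C0tensor2_sum => i; apply: C0tensor2Z.
by apply: pullback2_C0 mP (mA i) _ _ _ (C1at_prji i x) _; exact: cg.
Qed.

(** A vertical vector is a multiple of the orbit direction, on which [sigma] is 1; being horizontal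
    too, it vanishes. This makes the bundle metric positive definite. *)
Lemma kernel_prj x (v : 'rV[R]_(\sum_i d i).+1) : v *m tmap AP B prj x = 0 ->
  v *m sigma x = 0 -> v = 0.
Proof.
move=> vD vs; set D := tmap AP B prj x in vD.
have [U [s [oU Ub Cs Hs]]] := local_section (prj x).
have [th Eth] := same_fibre (esym (Hs _ Ub) : prj x = prj (s (prj x))).
have Cs' := Cs _ Ub.
have ex : act (- th) (s (prj x)) = x.
  by rewrite Eth -(pcb_actD pcb) addNr (pcb_act0 pcb).
pose s' := act (- th) \o s.
have C's : C1at B AP s' (prj x) by exact: C1at_comp mB mP _ _ _ Cs' (C1at_act _ _).
(* The section, rotated to pass through [x], gives a left inverse of [D]. So [D] has full rank, and
   its kernel has dimension 1 because the total space has one dimension more than the base. *)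
have E1 : tmap B AP s' (prj x) *m D = 1%:M.
  rewrite -(tmap_id (prj x) mB) /D -[in tmap AP B prj _]ex.
  rewrite -(tmap_comp mB mP mB C's (C1at_prj _)); apply/esym.
  apply: (near_eq_tmap mB mB) (C1at_id _ mB).
  have : nbhs (prj x) U by apply: open_nbhs_nbhs.
  by apply: filterS => c Uc; rewrite /= prj_act Hs.
have rD : \rank D = (\sum_i d i)%N.
  apply/eqP; rewrite eqn_leq rank_leq_col /=.
  by have := mxrankM_maxr (tmap B AP s' (prj x)) D; rewrite E1 mxrank1.
have rk : \rank (kermx D) = 1%N by rewrite mxrank_ker rD subSnn.
pose w := tmap (euclid 1) AP (orbit_map act x) 0.
have o0 : orbit_map act x 0 = x by rewrite /orbit_map mxE (pcb_act0 pcb).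
have wD : w *m D = 0 by have := tmap_prj_orbit x 0; rewrite o0.
have ws : (w *m sigma x) 0 0 = 1 by have := pullback1_orbit x 0; rewrite /pullback1 o0.
have w0 : w != 0 by apply/eqP => E; move: ws; rewrite E mul0mx mxE => /eqP; rewrite eq_sym oner_eq0.
have vk : (v <= kermx D)%MS by apply/sub_kermxP.
have wk : (w <= kermx D)%MS by apply/sub_kermxP.
have kw : (kermx D <= w)%MS.
  by have := (mxrank_leqif_sup wk).2; rewrite rk rank_rV w0 /= => <-.
have /sub_rVP[c vc] := submx_trans vk kw.
move: vs; rewrite vc -scalemxAl => /matrixP/(_ 0 0).
by rewrite mxE ws mxE mulr1 => ->; rewrite scale0r.
Qed.

Lemma quad_bundle_gt0 a b x v : 0 < a -> (forall i, 0 < b i) -> v != 0 ->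
  0 < quad (bundle_metric AP A prj sigma g a b x) v.
Proof.
move=> a0 b0 v0; rewrite quad_bundle.
have q0 w : 0 <= quad (base_metric A g b (prj x)) w.
  by have [->|/(quad_base_gt0 mA pg (prj x) b0)/ltW //] := eqVneq w 0; rewrite quad0.
have [E|w0] := eqVneq (v *m tmap AP B prj x) 0; last first.
  apply: ltr_wpDl; first by rewrite mulr_ge0 ?sqr_ge0 // ltW.
  exact: quad_base_gt0.
apply: ltr_pwDl => //; rewrite mulr_gt0 // exprn_even_gt0 //=.
apply/eqP => vs; move: v0; rewrite (kernel_prj E) ?eqxx //.
by apply/matrixP => i j; rewrite !ord1 vs mxE.
Qed.

Section FixedCoefficients.
Variables (a : R) (b : 'I_m -> R).
Hypotheses (a0 : 0 < a) (b0 : forall i, 0 < b i).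
Notation hP := (bundle_metric AP A prj sigma g a b).

Lemma orbit_affineE x al : (fun t => orbit_map act x (al *: t)) =
  orbit_map act x \o affine1 0 al.
Proof.
apply/funext => t /=; congr (orbit_map act x _).
by apply/rowP => i; rewrite !mxE subr0 add0r.
Qed.

Lemma orbit_curve x al : C1curve (A := AP) (orbit_map act x \o affine1 0 al).
Proof.
move=> t _; apply: (C1at_comp mE mE) (C1at_orbit x _).
by apply/C1at_euclid; exact: C1v_affine1.
Qed.

Lemma orbit_length x al :
  curve_length AP hP (orbit_map act x \o affine1 0 al) = (`|al| * Num.sqrt a)%:E.
Proof.
rewrite (curve_lengthE mP (@bundle_C0 a b) (G := fun t => (`|al| * Num.sqrt a) * t) (orbit_curve x al)).
  by rewrite mulr1 mulr0 subr0.
move=> t t01.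
have C1 : C1at (euclid 1) (euclid 1) (affine1 0 al) (const_mx t).
  by apply/C1at_euclid; exact: C1v_affine1.
have tE : tmap (euclid 1) (euclid 1) (affine1 0 al) (const_mx t) = al%:M.
  by rewrite -[X in X%:M]subr0; exact: jacobian_affine1.
set y := affine1 0 al (const_mx t).
have -> : speed AP hP (orbit_map act x \o affine1 0 al) (const_mx t) = `|al| * Num.sqrt a.
  rewrite speedE (tmap_comp mE mE mP C1 (C1at_orbit x _)) tE mul_scalar_mx quadZ.
  rewrite quad_bundle tmap_prj_orbit quad0 addr0.
  have -> : (tmap (euclid 1) AP (orbit_map act x) y *m sigma (orbit_map act x y)) 0 0 = 1.
    exact: pullback1_orbit.
  by rewrite expr1n mulr1 sqrtrM ?sqr_ge0 // sqrtr_sqr.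
have := is_deriveZ (`|al| * Num.sqrt a) (is_derive_id t (1 : R)).
by rewrite /GRing.scale /= mulr1.
Qed.

Lemma fibre_radiusE x : fibre_radius AP act hP x = (Num.sqrt a)%:E.
Proof.
rewrite /fibre_radius orbit_affineE orbit_length -EFinM; congr (_%:E).
have p2 : 0 < 2 * pi :> R by rewrite mulr_gt0 // pi_gt0.
by rewrite gtr0_norm // mulrAC divff ?mul1r // gt_eqF.
Qed.

Lemma vertical_path x th : piecewise_path AP hP x (act th x) (`|th| * Num.sqrt a)%:E.
Proof.
have := path_seg (h := hP) mP (orbit_curve x th); rewrite orbit_length /=.
by rewrite !affine1_const mulr0 mulr1 addr0 subr0 add0r /orbit_map !mxE (pcb_act0 pcb).
Qed.

Lemma act_2pi_nat k x : act (2 * pi * k%:R) x = x.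
Proof.
elim: k => [|k IH]; first by rewrite mulr0 (pcb_act0 pcb).
by rewrite -(natr1 k) [X in act X]mulrDr mulr1 addrC (pcb_actD pcb) IH (pcb_act2pi pcb).
Qed.

Lemma act_2pi_int (k : int) x : act (2 * pi * k%:~R) x = x.
Proof.
case: k => k; first exact: act_2pi_nat.
rewrite NegzE mulrNz mulrN -{1}(act_2pi_nat k.+1 x) -(pcb_actD pcb) addNr.
exact: (pcb_act0 pcb).
Qed.

Lemma fibre_path x x' : prj x = prj x' ->
  exists2 l, piecewise_path AP hP x x' l & (l <= (2 * pi * Num.sqrt a)%:E)%E.
Proof.
move=> /same_fibre[th ->].
have p2 : 0 < 2 * pi :> R by rewrite mulr_gt0 // pi_gt0.
(* Whole turns act trivially, so the angle is reduced modulo 2 pi to lie between 0 and 2 pi. *)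
pose k := Num.floor (th / (2 * pi)).
pose th' := th - 2 * pi * k%:~R.
have E : act th x = act th' x.
  by rewrite -[in LHS](subrK (2 * pi * k%:~R) th) (pcb_actD pcb) act_2pi_int.
have /andP[k1 k2] := floor_itv (th / (2 * pi)).
exists (`|th'| * Num.sqrt a)%:E; first by rewrite E; exact: vertical_path.
rewrite lee_fin ler_wpM2r ?sqrtr_ge0 //.
have h1 : 2 * pi * k%:~R <= th by rewrite mulrC -ler_pdivlMr.
have h2 : th < 2 * pi * k%:~R + 2 * pi.
  by move: k2; rewrite ltr_pdivrMr // intrD mulrDl mul1r mulrC.
by rewrite ler_norml /th'; apply/andP; split; lra.
Qed.

Section Lift.
Variables (c : 'I_m -> R) (K : R).
Hypotheses (K0 : 0 <= K) (bc : forall i, b i <= K ^+ 2 * c i).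
Notation hB := (base_metric A g c).

Let cB y : C0tensor2 B hB y.
Proof. exact: base_C0. Qed.

(* The horizontal lift of [s], which stays over a trivializing set, is
   [act (th t) (sec (s t))], where [th] is a primitive of minus the connection
   form along [sec \o s]. *)
Lemma local_lift (s : 'rV[R]_1 -> prod_topology M) U sec x :
  C1curve (A := B) s -> open U -> (forall t : R, 0 <= t <= 1 -> U (s (const_mx t))) ->
  (forall y, U y -> C1at B AP sec y) -> (forall y, U y -> prj (sec y) = y) ->
  prj x = s (const_mx 0) ->
  exists x' l, [/\ prj x' = s (const_mx 1), piecewise_path AP hP x x' l &
    (l <= K%:E * curve_length B hB s)%E].
Proof.
move=> Cs oU Us Csec Hsec xs.
pose z := sec \o s.
have Cz t : 0 <= t <= 1 -> C1at (euclid 1) AP z (const_mx t).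
  by move=> t01; exact: (C1at_comp mE mB (Cs t t01) (Csec _ (Us t t01))).
pose f t := - (pullback1 (euclid 1) AP z sigma (const_mx t)) 0 0.
have cf t : 0 <= t <= 1 -> {for t, continuous f}.
  move=> t01; have cs1 : C0tensor1 AP sigma (z (const_mx t)).
    by apply: smooth1_C0; exact: conn_smooth pcon.
  have c1 := C0tensor1_euclid (pullback1_C0 mE mP (Cz t t01) cs1).
  have c2 : {for t, continuous (fun u : R => pullback1 (euclid 1) AP z sigma (const_mx u))}.
    by apply: continuous_comp; [exact: const_mx_continuous|exact: c1].
  have c3 := (continuous_mxP _ _).1 c2 0 0.
  by move=> W; rewrite /f; have := cvgN c3; exact.
have i0 : 0 <= (0 : R) <= 1 by rewrite lexx ler01.
have i1 : 0 <= (1 : R) <= 1 by rewrite lexx ler01.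
(* The connection form along [z] is controlled on [0, 1] only; the extension makes the angle C^1 on
   a neighbourhood of it. *)
have [fe [G [cfe Efe dG]]] := primitive_extension ler01 (for_within_continuous cf).
have [th0 Eth0] : exists th0, x = act th0 (z (const_mx 0)).
  by apply: same_fibre; rewrite xs /z /= Hsec //; exact: Us.
pose th u := G u - G 0 + th0.
have dth (u : R) : - 1 < u < 2 -> is_derive u 1 th (fe u).
  move=> /andP[u1 u2].
  have d1 : is_derive u 1 G (fe u) by apply: dG; apply/andP; split; lra.
  have := is_deriveD d1 (is_derive_cst (th0 - G 0) u 1); rewrite addr0.
  by congr is_derive; apply/funext => v; rewrite !fctE /th; ring.
pose TH (v : 'rV[R]_1) : 'rV[R]_1 := const_mx (th (v 0 0)).
have CTH t : 0 <= t <= 1 -> C1v TH (const_mx t) /\ 'J TH (const_mx t) = (fe t)%:M.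
  move=> /andP[t0 t1]; apply: C1v_real cfe _ dth.
  by apply/andP; split; lra.
have CTHe t (t01 : 0 <= t <= 1) : C1at (euclid 1) (euclid 1) TH (const_mx t).
  by apply/C1at_euclid; case: (CTH t t01).
pose zt v := act (TH v 0 0) (z v).
have Czt : C1curve (A := AP) zt.
  by move=> t t01; exact: (tmap_actmap mE (CTHe t t01) (Cz t t01)).1.
have prjzt t : 0 <= t <= 1 -> \forall v \near (const_mx t : 'rV[R]_1), (prj \o zt) v = s v.
  move=> t01.
  have N : nbhs (const_mx t : 'rV[R]_1) (s @^-1` U).
    exact: C1at_continuous (Cs t t01) _ (open_nbhs_nbhs (conj oU (Us t t01))).
  by apply: filterS N => v Uv; rewrite /= /zt prj_act /z /= Hsec.
have zt0 : zt (const_mx 0) = x.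
  by rewrite /zt /TH !mxE /th subrr add0r -Eth0.
exists (zt (const_mx 1)), (curve_length AP hP zt); split.
- by have := nbhs_singleton (prjzt 1 i1).
- by rewrite -{1}zt0; exact: path_seg.
have [G1 pG1 ->] := curve_length_primitive mP (@bundle_C0 a b) Czt.
have [G2 pG2 ->] := curve_length_primitive mB (@cB) Cs.
rewrite -EFinM lee_fin.
have pK : primitive (fun t => K * speed B hB s (const_mx t)) (fun t => K * G2 t) 0 1.
  by move=> t /pG2 ?; exact: is_deriveZ.
rewrite mulrBr; apply: (primitive_le ler01 pG1 pK) => t t01.
rewrite !speedE quad_bundle.
have E1 : tmap (euclid 1) AP zt (const_mx t) *m tmap AP B prj (zt (const_mx t)) =
    tmap (euclid 1) B s (const_mx t).
  rewrite -(tmap_comp mE mP mB (Czt t t01) (C1at_prj _)).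
  apply: (near_eq_tmap mE mB (prjzt t t01)).
  exact: C1at_comp mE mP _ _ _ (Czt t t01) (C1at_prj _).
(* Horizontality: rotating contributes the derivative [fe t] of the angle, and by invariance of
   [sigma] the curve [z] contributes its own connection form, whose opposite is [fe t]. *)
have E2 : (tmap (euclid 1) AP zt (const_mx t) *m sigma (zt (const_mx t))) 0 0 = 0.
  rewrite (tmap_act_split mE (CTHe t t01) (Cz t t01)).
  have -> : tmap (euclid 1) (euclid 1) TH (const_mx t) = (fe t)%:M by exact: (CTH t t01).2.
  rewrite mulmxDl mxE mul_scalar_mx -scalemxAl mxE.
  have -> : (tmap (euclid 1) AP (orbit_map act (z (const_mx t))) (TH (const_mx t)) *m
     sigma (zt (const_mx t))) 0 0 = 1 by exact: pullback1_orbit.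
  rewrite mulr1 -mulmxA.
  have -> : tmap AP AP (act (TH (const_mx t) 0 0)) (z (const_mx t)) *m sigma (zt (const_mx t))
     = sigma (z (const_mx t)) by exact: (conn_invariant pcon).
  rewrite Efe // /f addNr //.
rewrite E1 E2 expr0n mulr0 add0r.
have -> : prj (zt (const_mx t)) = s (const_mx t) by exact: nbhs_singleton (prjzt t t01).
apply: le_trans (ler_wsqrtr (quad_base_le mA pg _ _ bc)) _.
by rewrite sqrtrM ?sqr_ge0 // sqrtr_sqr ger0_norm.
Qed.

Lemma curve_lift (s : 'rV[R]_1 -> prod_topology M) x : C1curve (A := B) s ->
  prj x = s (const_mx 0) ->
  exists x' l, [/\ prj x' = s (const_mx 1), piecewise_path AP hP x x' l &
    (l <= K%:E * curve_length B hB s)%E].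
Proof.
move=> Cs xs.
have [G pG lG] := curve_length_primitive mB (@cB) Cs.
have p0 al be : primitive (fun=> 0 : R) (fun=> 0) al be by move=> t _; exact: is_derive_cst.
have Gmono al be : 0 <= al -> al <= be -> be <= 1 -> G al <= G be.
  move=> al0 ab b1.
  have pGab : primitive (fun t => speed B hB s (const_mx t)) G al be.
    by move=> t /andP[? ?]; apply: pG; apply/andP; split; lra.
  have := primitive_le ab (p0 al be) pGab; rewrite subrr subr_ge0; apply.
  by move=> t _; exact: speed_ge0.
(* The relation quantifies over every starting point above [s (const_mx al)], so that the lift of
   the next piece can begin wherever the previous one ended. *)
pose L (al be : R) := forall x, prj x = s (const_mx al) ->
  exists x' l, [/\ prj x' = s (const_mx be), piecewise_path AP hP x x' l &
    (l <= (K * (G be - G al))%:E)%E].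
suff : L 0 1 by move=> /(_ x xs)[x' [l [h1 h2 h3]]]; exists x', l; split => //; rewrite lG -EFinM.
apply: real_chain => [al be ga _ _ L1 L2 y ys|t t01].
  have [y' [l1 [h1 h2 h3]]] := L1 y ys; have [y'' [l2 [k1 k2 k3]]] := L2 y' h1.
  exists y'', (l1 + l2)%E; split => //; first exact: Path_cat h2 k2.
  have -> : K * (G ga - G al) = K * (G be - G al) + K * (G ga - G be) by ring.
  by rewrite EFinD; exact: leeD.
have [U [sec [oU Ut Csec Hsec]]] := local_section (s (const_mx t)).
have cst_ : {for t, continuous (fun u : R => s (const_mx u))}.
  by apply: continuous_comp; [exact: const_mx_continuous|exact: C1at_continuous (Cs t t01)].
have /nbhs_normP[de /= de0 Hde] := cst_ _ (open_nbhs_nbhs (conj oU Ut)).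
exists de => // al be /andP[al0 ab] b1 ald bed y ys.
have ha : 0 <= al <= 1 by rewrite al0 (le_trans ab b1).
have hb : 0 <= be <= 1 by rewrite b1 (le_trans al0 ab).
have Us u : 0 <= u <= 1 -> U ((s \o affine1 al be) (const_mx u)).
  move=> /andP[u0 u1]; rewrite /= affine1_const; apply: Hde; rewrite /ball_ /= distrC.
  by move: ald bed; rewrite !ltr_norml => /andP[? ?] /andP[? ?]; apply/andP; split; nra.
have [|x' [l [h1 h2 h3]]] := local_lift (C1curve_affine Cs ha hb) oU Us Csec Hsec (x := y).
  by rewrite /= affine1_const mulr0 addr0.
exists x', l; split => //.
  by rewrite h1 /= affine1_const mulr1 addrC subrK.
move: h3; rewrite (C1curve_affine_length mB (@cB) Cs pG ha hb) -EFinM.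
by rewrite ger0_norm // subr_ge0; exact: Gmono.
Qed.

Lemma path_lift y y' l x : piecewise_path B hB y y' l -> prj x = y ->
  exists x' l', [/\ prj x' = y', piecewise_path AP hP x x' l' & (l' <= K%:E * l)%E].
Proof.
move=> p; move: y y' l p x; apply: (path_ind_C1 mB).
  by move=> s Cs x; exact: curve_lift.
move=> y1 y2 y3 l1 l2 p1 H1 p2 H2 x x1.
have [x' [k1 [e1 f1 g1]]] := H1 x x1; have [x'' [k2 [e2 f2 g2]]] := H2 x' e1.
exists x'', (k1 + k2)%E; split => //; first exact: Path_cat f1 f2.
have [r1 r10 q1] := path_real mB (@cB) p1.
have [r2 r20 q2] := path_real mB (@cB) p2.
by rewrite ge0_muleDr ?q1 ?q2 ?lee_fin // -q1 -q2; exact: leeD.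
Qed.

Lemma path_lift_ends x x' l : piecewise_path B hB (prj x) (prj x') l ->
  exists2 l', piecewise_path AP hP x x' l' &
    (l' <= K%:E * l + (2 * pi * Num.sqrt a)%:E)%E.
Proof.
move=> p; have [x1 [l1 [e1 p1 h1]]] := path_lift p erefl.
have [l2 p2 h2] := fibre_path e1.
exists (l1 + l2)%E; first exact: Path_cat p1 p2.
exact: leeD.
Qed.

End Lift.
End FixedCoefficients.
End Bundle.

(** * The backwards Ricci flow *)

Section Flow.
Context {R : realType} {m : nat} {n p : 'I_m -> nat} {q : 'I_m -> int}.
Hypotheses (m0 : (0 < m)%N) (n0 : forall i, (0 < n i)%N) (p0 : forall i, (0 < p i)%N).
Hypothesis q0 : forall i, q i != 0.
Variables (Y : R -> 'I_m -> R) (a0 : R) (a : R -> R) (b : 'I_m -> R -> R).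
Hypothesis Ysol : Ysolution n p q Y.
Hypothesis Ylim : forall i, Y u i @[u --> +oo] --> 0.
Hypothesis a00 : 0 < a0.
Hypothesis cor : corresponding n q Y a0 a b.
Hypothesis flow : ancient_flow n p q a b.

Notation N i := ((n i)%:R : R).
Notation p_ i := ((p i)%:R : R).
Notation q2 i := ((q i)%:~R ^+ 2 : R).

Let N0 i : 0 < N i. Proof. by rewrite ltr0n. Qed.
Let P0 i : 0 < p_ i. Proof. by rewrite ltr0n. Qed.
Let q20 i : 0 < q2 i. Proof. by rewrite exprn_even_gt0 //= intr_eq0. Qed.
Let apos (t : R) : 0 <= t -> 0 < a t. Proof. by case: flow => H _ _ _ /H[]. Qed.
Let bpos i (t : R) : 0 <= t -> 0 < b i t. Proof. by case: flow => H _ _ _ /H[]. Qed.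

Lemma Efun_ge0 (y : 'I_m -> R) : 0 <= Efun n q y.
Proof. by apply: sumr_ge0 => i _; rewrite mulr_ge0 ?sqr_ge0 // mulr_ge0 // ltW. Qed.

Lemma Efun_continuous (U : R) : {within `[0, U], continuous (fun z => Efun n q (Y z))}.
Proof.
move=> x; apply: for_continuous_sum => i; apply: for_continuousM.
  exact: cst_continuous.
have cY : {within `[0, U], continuous (fun z => Y z i)}.
  apply: continuous_subspaceW (Ysol i).1 => z /=.
  by rewrite !in_itv /= => /andP[-> _].
by apply: for_continuousM; exact: cY.
Qed.

(** Rewriting the integral of E by a primitive gives continuity; E >= 0 gives the lower bound [a0],
    from which [tau_of] grows at least linearly. *)
Lemma a_of_within (U : R) : 0 <= U ->
  {within `[0, U], continuous (a_of n q Y a0)} /\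
  forall u, 0 <= u <= U -> a0 <= a_of n q Y a0 u.
Proof.
move=> U0; have [G pG] := primitive_exists U0 (@Efun_continuous U).
have E u : 0 <= u <= U -> a_of n q Y a0 u = a0 * expR (G u - G 0).
  move=> /andP[u0 uU]; rewrite /a_of; congr (_ * expR _).
  move: u0; rewrite le_eqVlt => /predU1P[<-|u0].
    by rewrite set_itv1 Rintegral_set1 subrr.
  rewrite /Rintegral (integral_primitive (G := G) u0) //.
    exact: Efun_continuous.
  by move=> t /andP[t0 tu]; apply: pG; rewrite t0 (le_trans tu).
split.
  apply: (@subspace_eq_continuous _ _ _ (fun u => a0 * expR (G u - G 0))).
    by move=> u; rewrite inE /= in_itv /= => /E/esym.
  apply: for_within_continuous => u /pG dG; apply: for_continuousM; first exact: cst_continuous.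
  apply: (@continuous_comp _ _ _ (fun u => G u - G 0) expR); last exact: continuous_expR.
  by apply: for_continuousD; [exact: is_derive_continuous dG|exact: cst_continuous].
move=> u /[dup] uU /E ->; rewrite ler_pMr // -expR0 ler_expR subr_ge0.
move: uU => /andP[u0 uU].
have pp : primitive (fun=> 0 : R) (fun=> 0) 0 u by move=> t _; exact: is_derive_cst.
have pGu : primitive (fun z => Efun n q (Y z)) G 0 u.
  by move=> t /andP[t0 tu]; apply: pG; rewrite t0 (le_trans tu).
have := primitive_le u0 pp pGu; rewrite subrr subr_ge0; apply => t _.
exact: Efun_ge0.
Qed.

Lemma tau_of0 : tau_of n q Y a0 0 = 0.
Proof. by rewrite /tau_of set_itv1 Rintegral_set1. Qed.

Lemma tau_of_ge (u : R) : 0 <= u -> a0 * u <= tau_of n q Y a0 u.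
Proof.
rewrite le_eqVlt => /predU1P[<-|u0]; first by rewrite mulr0 tau_of0.
have [ca la] := a_of_within (ltW u0).
have [G pG] := primitive_exists (ltW u0) ca.
rewrite /tau_of /Rintegral (integral_primitive (G := G) u0 ca pG) /=.
have pp : primitive (fun=> a0) (fun t => a0 * t) 0 u.
  move=> t _; have := is_deriveZ a0 (is_derive_id t (1 : R)).
  by rewrite /GRing.scale /= mulr1.
have := primitive_le (ltW u0) pp pG; rewrite mulr0 subr0; apply => t.
exact: la.
Qed.

(* Times of the form [tau_of u] are cofinal, so it is enough to know the limit of [Y]. *)
Lemma ratio_small i (T e : R) : 0 < e -> exists2 t, T <= t & 0 < t /\ a t / b i t < e.
Proof.
move=> e0.
have Ye : \forall u \near +oo, Y u i < e.
  by have /cvgr_lt := @Ylim i; apply.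
have Tu : \forall u \near +oo, T <= a0 * u /\ 0 < u.
  near=> u; split.
    by rewrite mulrC -ler_pdivrMr //; near: u; apply: nbhs_pinfty_ge; exact: num_real.
  by near: u; apply: nbhs_pinfty_gt; exact: num_real.
have /filter_ex[u [Yu [Tau u0]]] :
    \forall u \near +oo, Y u i < e /\ (T <= a0 * u /\ 0 < u) by apply: filterI.
have [E1 E2] := cor (ltW u0).
exists (tau_of n q Y a0 u); first exact: le_trans (tau_of_ge (ltW u0)).
split; first by apply: lt_le_trans (tau_of_ge (ltW u0)); rewrite mulr_gt0.
have ne : a_of n q Y a0 u != 0.
  have [_ /(_ u)] := a_of_within (ltW u0); rewrite lexx (ltW u0) => /(_ isT) ha.
  by rewrite gt_eqF // (lt_le_trans a00).
by rewrite E1 E2 invfM invrK mulrA divff // mul1r.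
Unshelve. all: by end_near. Qed.

(** Positive root of 2 p_i y - q_i^2 y^2 - n_i q_i^2 y^2. *)
Let thr i : R := 2 * p_ i / ((N i + 1) * q2 i).

Let adot t : R := \sum_j N j * q2 j * (a t ^+ 2 / b j t ^+ 2).

Lemma is_derive_a (t : R) : 0 < t -> is_derive t 1 a (adot t).
Proof. by case: flow => _ _ H _; exact: H. Qed.

Lemma is_derive_b i (t : R) : 0 < t -> is_derive t 1 (b i) (2 * p_ i - q2 i * (a t / b i t)).
Proof. by case: flow => _ _ _ H; exact: H. Qed.

Lemma continuous_a (t : R) : 0 < t -> {for t, continuous a}.
Proof. by move=> /is_derive_a; exact: is_derive_continuous. Qed.

Lemma continuous_b i (t : R) : 0 < t -> {for t, continuous (b i)}.
Proof. by move=> /(is_derive_b i); exact: is_derive_continuous. Qed.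

Lemma for_continuousV (V : topologicalType) (f : V -> R) x :
  f x != 0 -> {for x, continuous f} -> {for x, continuous (fun z => (f z)^-1)}.
Proof. by move=> fx cf; apply: cvgV => //; exact: cf. Qed.

Let y i t := a t / b i t.
Let w i t := y i t - thr i.
Let k i t := (N i + 1) * q2 i * (y i t / b i t).

Lemma continuous_y i (t : R) : 0 < t -> {for t, continuous (y i)}.
Proof.
move=> t0; apply: for_continuousM; first exact: continuous_a.
by apply: for_continuousV; [rewrite gt_eqF // bpos // ltW|exact: continuous_b].
Qed.

Lemma continuous_k i (t : R) : 0 < t -> {for t, continuous (k i)}.
Proof.
move=> t0; apply: for_continuousM; first exact: cst_continuous.
apply: for_continuousM; first exact: continuous_y.
by apply: for_continuousV; [rewrite gt_eqF // bpos // ltW|exact: continuous_b].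
Qed.

(** Keeping only the i-th term of the derivative of [a], the quotient rule bounds the derivative of
    a / b_i below by (y / b_i) ((n_i + 1) q_i^2 y - 2 p_i), which factors as [k i t * w i t]. *)
Lemma is_derive_w i (t : R) : 0 < t -> exists2 D, is_derive t 1 (w i) D & k i t * w i t <= D.
Proof.
move=> t0; have bt := bpos i (ltW t0); have at_ := apos (ltW t0).
have bn : b i t != 0 by rewrite gt_eqF.
have d1 := is_deriveM (is_derive_a t0) (is_deriveV bn (is_derive_b i t0)).
have d2 := is_deriveB d1 (is_derive_cst (thr i) t 1).
eexists; first exact: d2.
rewrite subr0 /GRing.scale /=.
have adge : N i * q2 i * (a t ^+ 2 / b i t ^+ 2) <= adot t.
  rewrite /adot (bigD1 i) //= lerDl; apply: sumr_ge0 => j _.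
  by rewrite mulr_ge0 ?divr_ge0 ?sqr_ge0 // mulr_ge0 // ltW.
have -> : k i t * w i t = a t * (- b i t ^- 2 * (2 * p_ i - q2 i * (a t / b i t))) +
    (b i t)^-1 * (N i * q2 i * (a t ^+ 2 / b i t ^+ 2)).
  have N1 : N i + 1 != 0 by rewrite gt_eqF // addr_gt0.
  have q1 : (q i)%:~R != 0 :> R by rewrite intr_eq0.
  by rewrite /k /w /y /thr; field; rewrite ?bn ?q1 ?N1.
by rewrite lerD2l ler_wpM2l // invr_ge0 ltW.
Qed.

(** Integrating factor: with [K] a primitive of [k i], the product of [w i] and exp (- K) is
    nondecreasing. *)
Lemma w_stays_positive i (t0 t1 : R) : 0 < t0 -> t0 <= t1 -> 0 < w i t0 -> 0 < w i t1.
Proof.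
move=> h0 h01 wt0.
have [K pK] : exists K, primitive (k i) K t0 t1.
  apply: primitive_exists => //; apply: for_within_continuous => t /andP[t0t _].
  by apply: continuous_k; exact: lt_le_trans t0t.
have [D HD] : exists D : R -> R, forall t : R, 0 < t ->
    is_derive t 1 (w i) (D t) /\ k i t * w i t <= D t.
  have H (t : R) : exists D : R, 0 < t -> is_derive t 1 (w i) D /\ k i t * w i t <= D.
    have [t_0|_] := ltP 0 t; last by exists 0.
    by have [D d1 d2] := is_derive_w i t_0; exists D.
  by have /boolp.choice[D HD] := H; exists D.
have pW : primitive (fun t => expR (- K t) * (D t - k i t * w i t))
    (fun t => w i t * expR (- K t)) t0 t1.
  move=> t /[dup] /andP[t0t _] /pK dK.
  have [dw _] := HD t (lt_le_trans h0 t0t).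
  have dE := is_derive1_comp (f := expR) (g := fun t => - K t) (is_derive_expR _) (is_deriveN dK).
  apply: (is_derive_eq (is_deriveM dw dE)).
  by rewrite /GRing.scale /=; ring.
have pz : primitive (fun=> 0 : R) (fun=> 0) t0 t1 by move=> t _; exact: is_derive_cst.
have := primitive_le h01 pz pW; rewrite subrr subr_ge0 => H.
have : w i t0 * expR (- K t0) <= w i t1 * expR (- K t1).
  apply: H => t /andP[t0t _]; rewrite mulr_ge0 ?expR_ge0 // subr_ge0.
  exact: (HD t (lt_le_trans h0 t0t)).2.
move=> H2; have : 0 < w i t1 * expR (- K t1).
  by apply: lt_le_trans H2; rewrite mulr_gt0 // expR_gt0.
by rewrite pmulr_lgt0 // expR_gt0.
Qed.

Lemma ratio_le i (t : R) : 0 < t -> a t / b i t <= thr i.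
Proof.
move=> t0; rewrite leNgt; apply/negP => H.
have wt : 0 < w i t by rewrite /w subr_gt0.
have th0 : 0 < thr i by rewrite /thr divr_gt0 // mulr_gt0 // addr_gt0.
have [t1 tt1 [t10 yt1]] := ratio_small i t th0.
have := w_stays_positive t0 tt1 wt; rewrite /w /y subr_gt0 => H1.
by have := lt_trans H1 yt1; rewrite ltxx.
Qed.

(** At time 0 the flow is only known to be continuous, so [primitive_le], with its two-sided
    derivatives at the ends, does not apply; the mean value theorem uses interior derivatives
    alone. *)
Lemma slope_bound (f df : R -> R) (s t c : R) : 0 <= s -> s <= t ->
  {within `[0, +oo[, continuous f} -> (forall u : R, 0 < u -> is_derive u 1 f (df u)) ->
  ((forall u, s < u -> c <= df u) -> c * (t - s) <= f t - f s) /\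
  ((forall u, s < u -> df u <= c) -> f t - f s <= c * (t - s)).
Proof.
move=> s0; rewrite le_eqVlt => /predU1P[->|st] cf df_.
  by split=> _; rewrite !subrr mulr0.
have cf' : {within `[s, t], continuous f}.
  apply: continuous_subspaceW cf => z /=; rewrite !in_itv /= andbT => /andP[sz _].
  exact: le_trans sz.
have d' x : x \in `]s, t[ -> is_derive x 1 f (df x).
  by rewrite in_itv /= => /andP[sx _]; apply: df_; exact: le_lt_trans sx.
have [x] := MVT st d' cf'; rewrite in_itv /= => /andP[sx _] ->.
have st' : 0 <= t - s by rewrite subr_ge0 ltW.
by split=> H; rewrite ler_wpM2r //; exact: H.
Qed.

Let ca : {within `[0, +oo[, continuous a}. Proof. by case: flow => _ []. Qed.
Let cb i : {within `[0, +oo[, continuous (b i)}. Proof. by case: flow => _ [] _ H _ _; exact: H. Qed.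

Lemma b_bounds i (t : R) : 0 <= t ->
  2 * N i * p_ i / (N i + 1) * t + b i 0 <= b i t <= 2 * p_ i * t + b i 0.
Proof.
move=> t0; have N1 : 0 < N i + 1 by rewrite addr_gt0.
have [lo _] := slope_bound (2 * N i * p_ i / (N i + 1)) (lexx 0) t0 (@cb i) (@is_derive_b i).
have [_ hi] := slope_bound (2 * p_ i) (lexx 0) t0 (@cb i) (@is_derive_b i).
apply/andP; split.
  rewrite -lerBrDr -[X in _ * X <= _]subr0; apply: lo => u u0.
  have := ratio_le i u0.
  rewrite -(ler_pM2l (q20 i)) => H.
  have E : q2 i * thr i = 2 * p_ i / (N i + 1).
    have q1 : (q i)%:~R != 0 :> R by rewrite intr_eq0.
    by rewrite /thr; field; rewrite ?q1 gt_eqF.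
  rewrite E in H.
  have -> : 2 * N i * p_ i / (N i + 1) = 2 * p_ i - 2 * p_ i / (N i + 1).
    by field; rewrite gt_eqF.
  by rewrite lerD2l lerN2.
rewrite -lerBlDr -[X in _ <= _ * X]subr0; apply: hi => u u0.
rewrite gerDl oppr_le0 mulr_ge0 ?ltW // divr_gt0 //; first exact: apos (ltW u0).
exact: bpos (ltW u0).
Qed.

Lemma a_increasing (s t : R) : 0 <= s -> s < t -> a s < a t.
Proof.
move=> s0 st.
have cf' : {within `[s, t], continuous a}.
  apply: continuous_subspaceW ca => z /=; rewrite !in_itv /= andbT => /andP[sz _].
  exact: le_trans sz.
have d' x : x \in `]s, t[ -> is_derive x 1 a (adot x).
  by rewrite in_itv /= => /andP[sx _]; apply: is_derive_a; exact: le_lt_trans sx.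
have [x] := MVT st d' cf'; rewrite in_itv /= => /andP[sx _] E.
rewrite -subr_gt0 E mulr_gt0 ?subr_gt0 //.
have x0 : 0 < x by exact: le_lt_trans sx.
have tpos j : 0 < N j * q2 j * (a x ^+ 2 / b j x ^+ 2).
  have ax := apos (ltW x0); have bx := bpos j (ltW x0).
  by apply: mulr_gt0; [exact: mulr_gt0|rewrite divr_gt0 // exprn_gt0].
(* Strict growth needs one positive term in the sum, hence at least one factor. *)
rewrite /adot (bigD1 (Ordinal m0)) //=; apply: ltr_pwDl => //.
by apply: sumr_ge0 => j _; exact: ltW.
Qed.

Let Clo i : R := 2 * N i * p_ i / (N i + 1).
Let Clo0 i : 0 < Clo i. Proof. by rewrite /Clo divr_gt0 ?mulr_gt0 // addr_gt0. Qed.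
(** Since b_j > Clo_j t, the derivative of 1/a is at least - KK / t^2. *)
Let KK : R := \sum_j N j * q2 j / Clo j ^+ 2.
Let KK0 : 0 <= KK.
Proof.
by apply: sumr_ge0 => j _; rewrite divr_ge0 ?sqr_ge0 // mulr_ge0 // ltW.
Qed.

Lemma b_lower i (t : R) : 0 <= t -> Clo i * t < b i t.
Proof.
move=> t0; have /andP[H _] := b_bounds i t0.
by apply: lt_le_trans H; rewrite ltrDl bpos.
Qed.

(* [1/a - KK/t] is nondecreasing, since [b i] grows at least linearly. *)
Lemma inv_a_lower (s t : R) : 0 < s -> s <= t -> (a s)^-1 - KK / s <= (a t)^-1.
Proof.
move=> s0 st.
have p1 : primitive (fun u => - (- a u ^- 2 * adot u)) (fun u => - (a u)^-1) s t.
  move=> u /andP[su _]; have u0 := lt_le_trans s0 su.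
  have an : a u != 0 by rewrite gt_eqF // apos // ltW.
  exact: is_deriveN (is_deriveV an (is_derive_a u0)).
have p2 : primitive (fun u => KK * - (- u ^- 2 * 1)) (fun u => KK * - u^-1) s t.
  move=> u /andP[su _]; have u0 := lt_le_trans s0 su.
  have un : u != 0 by rewrite gt_eqF.
  exact: (is_deriveZ KK (is_deriveN (is_deriveV un (is_derive_id u (1 : R))))).
have := primitive_le st p1 p2 => H.
have : - (a t)^-1 - - (a s)^-1 <= KK * - t^-1 - KK * - s^-1.
  apply: H => u /andP[su _]; have u0 := lt_le_trans s0 su.
  have au := apos (ltW u0).
  rewrite mulNr opprK mulr1 opprK /KK mulr_suml /adot mulr_sumr; apply: ler_sum => j _.
  have bj := b_lower j (ltW u0).
  have bj0 := bpos j (ltW u0).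
  have -> : a u ^- 2 * (N j * q2 j * (a u ^+ 2 / b j u ^+ 2)) = N j * q2 j * (b j u ^+ 2)^-1.
    by field; rewrite !gt_eqF.
  have cu : 0 < Clo j * u by rewrite mulr_gt0.
  have -> : N j * q2 j / Clo j ^+ 2 * u ^- 2 = N j * q2 j * ((Clo j * u) ^+ 2)^-1.
    by rewrite -mulrA -invfM -exprMn.
  apply: ler_wpM2l; first exact/ltW/mulr_gt0.
  rewrite lef_pV2 ?posrE ?exprn_gt0 // ler_sqr ?nnegrE; exact: ltW.
have : 0 <= KK * t^-1 by rewrite mulr_ge0 // invr_ge0 (le_trans (ltW s0)).
rewrite !mulrN; lra.
Qed.

Lemma a_bounded : exists2 C, 0 < C & forall t, 0 <= t -> a t <= C.
Proof.
pose i := Ordinal m0.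
(* For t >= b_i(0) the upper bound gives b_i(t) <= c t. Together with a / b_i < 1 / (c (KK + 1))
   this yields 1/a(t) > (KK + 1) / t, which exceeds the bound KK / t on all later losses of 1/a. *)
pose c := 2 * p_ i + 1.
have c0 : 0 < c by rewrite addr_gt0 // mulr_gt0.
have e0 : 0 < (c * (KK + 1))^-1 by rewrite invr_gt0 mulr_gt0 // ltr_wpDl.
have [t tb [t0 yt]] := ratio_small i (b i 0) e0.
have /andP[_ bu] := b_bounds i (ltW t0).
have bc : b i t <= c * t by rewrite /c mulrDl mul1r (le_trans bu) // lerD2l.
have at0 := apos (ltW t0); have bt0 := bpos i (ltW t0).
have aK : a t * (KK + 1) < t.
  move: yt; rewrite ltr_pdivrMr // mulrC ltr_pdivlMr ?mulr_gt0 ?ltr_wpDl // => H.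
  rewrite -(ltr_pM2l c0); apply: lt_le_trans bc.
  by apply: le_lt_trans H; rewrite mulrCA.
have g : 0 < (a t)^-1 - KK / t.
  rewrite subr_gt0 ltr_pdivrMr // mulrC ltr_pdivlMr //.
  by apply: le_lt_trans aK; rewrite mulrDr mulr1 mulrC lerDl ltW.
exists ((a t)^-1 - KK / t)^-1; first by rewrite invr_gt0.
move=> u u0; have [tu|ut] := leP t u.
  rewrite -[a u]invrK lef_pV2 ?posrE ?invr_gt0 ?apos //.
  exact: inv_a_lower.
apply: le_trans (ltW (a_increasing u0 ut)) _.
rewrite -[a t]invrK lef_pV2 ?posrE ?invr_gt0 // ?invrK //.
exact: inv_a_lower.
Qed.

Lemma a_limit : exists2 ainf : R, 0 < ainf & a t @[t --> +oo] --> ainf.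
Proof.
have [C C0 aC] := a_bounded.
(* Monotonicity of [a] is known for nonnegative times only; this extension is monotone on the whole
   line. *)
pose f t := a (Num.max 0 t).
have nf : {homo f : x y / x <= y}.
  move=> x z xz; rewrite /f.
  have : Num.max 0 x <= Num.max 0 z by rewrite ge_max !le_max lexx /= xz orbT.
  rewrite le_eqVlt => /predU1P[->//|H]; apply/ltW/a_increasing => //.
  by rewrite le_max lexx.
have bf : has_ubound (range f).
  by exists C => _ [x _ <-]; apply: aC; rewrite le_max lexx.
exists (sup (range f)).
  apply: (@lt_le_trans _ _ (f 0)); first by rewrite /f maxxx apos.
  by apply: ub_le_sup => //; exists 0.
have := nondecreasing_cvgr nf bf; apply: cvg_trans.
apply: near_eq_cvg; near=> t.
have t0 : 0 <= t by near: t; apply: nbhs_pinfty_ge; exact: num_real.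
by rewrite /f max_r.
Unshelve. all: by end_near. Qed.

Lemma b_ratio_limit i : b i t / t @[t --> +oo] --> 2 * p_ i.
Proof.
have [C C0 aC] := a_bounded.
apply/cvgrPdist_le => e e0.
pose e2 := e / 2; have e20 : 0 < e2 by rewrite divr_gt0.
(* After [T] the bounds a <= C and b_i > Clo_i u make the slope of b_i at least 2 p_i - e/2. The 2
   p_i T lost before [T] is at most (e/2) t once t >= 2 p_i T / (e/2). *)
pose T := q2 i * C / Clo i / e2.
have T0 : 0 < T by rewrite divr_gt0 // divr_gt0 // mulr_gt0.
have low t : T <= t -> (2 * p_ i - e2) * (t - T) <= b i t - b i T.
  move=> Tt; apply: (slope_bound _ (ltW T0) Tt (@cb i) (@is_derive_b i)).1 => u Tu.
  have u0 := lt_trans T0 Tu.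
  rewrite lerD2l lerN2.
  have h1 : a u / b i u <= C / (Clo i * u).
    apply: ler_pM; [exact/ltW/apos/ltW|rewrite invr_ge0; exact/ltW/bpos/ltW|exact/aC/ltW|].
    rewrite lef_pV2 ?posrE ?mulr_gt0 //; first exact/ltW/b_lower/ltW.
    exact/bpos/ltW.
  apply: le_trans (_ : q2 i * (C / (Clo i * u)) <= _); first by apply: ler_wpM2l => //; exact: ltW.
  have : q2 i * C / Clo i <= e2 * u.
    have ET : T * e2 = q2 i * C / Clo i by rewrite /T divfK // gt_eqF.
    by rewrite -ET [e2 * u]mulrC ler_wpM2r //; exact: ltW.
  by move=> H; rewrite invfM !mulrA ler_pdivrMr.
near=> t.
have t0 : 0 < t by near: t; apply: nbhs_pinfty_gt; exact: num_real.
have tT : T <= t by near: t; apply: nbhs_pinfty_ge; exact: num_real.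
have tb : b i 0 / e <= t by near: t; apply: nbhs_pinfty_ge; exact: num_real.
have tT2 : (2 * p_ i * T) / e2 <= t by near: t; apply: nbhs_pinfty_ge; exact: num_real.
have /andP[_ hi] := b_bounds i (ltW t0).
have lo := low t tT.
have bT := bpos i (ltW T0).
rewrite ler_pdivrMr // in tb; rewrite ler_pdivrMr // in tT2.
have E2 : e2 + e2 = e by rewrite /e2; lra.
have et : e * t = e2 * t + e2 * t by rewrite -mulrDl E2.
have eT : 0 <= e2 * T by rewrite mulr_ge0 ?ltW.
rewrite ler_norml; apply/andP; split.
  rewrite lerBrDr addrC lerBlDr ler_pdivrMr // mulrDl; move: hi tb; rewrite [e * t]mulrC; lra.
rewrite lerBlDr -lerBlDl ler_pdivlMr //; move: lo; rewrite mulrBl mulrBr !mulrBl.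
rewrite [t * e2]mulrC in tT2; lra.
Unshelve. all: by end_near. Qed.

Lemma sqrt_b_ratio_limit i : exists2 l : R, 0 < l &
  Num.sqrt (b i t) / Num.sqrt t @[t --> +oo] --> l.
Proof.
exists (Num.sqrt (2 * p_ i)); first by rewrite sqrtr_gt0 mulr_gt0.
have H : Num.sqrt (b i t / t) @[t --> +oo] --> Num.sqrt (2 * p_ i).
  by apply: continuous_cvg; [exact: sqrt_continuous|exact: b_ratio_limit].
apply: cvg_trans H; apply: near_eq_cvg; near=> t.
have t0 : 0 <= t by near: t; apply: nbhs_pinfty_ge; exact: num_real.
by rewrite sqrtrM ?sqrtrV // ltW // bpos.
Unshelve. all: by end_near. Qed.

End Flow.

(** * The Einstein metric of the base *)

Section LocalRicci.
Context {R : realType}.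

Lemma near_eq_christoffel n (G H : 'rV[R]_n -> 'M[R]_n) k i j (y0 : 'rV[R]_n) :
  (\forall y \near y0, G y = H y) ->
  \forall y \near y0, christoffel G k i j y = christoffel H k i j y.
Proof.
move=> /nbhs_interior; apply: filterS => y GH; rewrite /christoffel (nbhs_singleton GH).
have E a s t : pd a (fun z => G z s t) y = pd a (fun z => H z s t) y.
  by apply: near_eq_derive; apply: filterS GH => z ->.
by congr (_ * _); apply: eq_bigr => l _; rewrite !E.
Qed.

(** Ricci sees the metric only through its Christoffel symbols; agreement near the point also
    controls their derivatives. *)
Lemma eq_christoffel_ricci n (G H : 'rV[R]_n -> 'M[R]_n) (y0 : 'rV[R]_n) :
  (forall k i j, \forall y \near y0, christoffel G k i j y = christoffel H k i j y) ->
  ricci_coord G y0 = ricci_coord H y0.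
Proof.
move=> E; have E0 k i j := nbhs_singleton (E k i j).
have E1 a k i j : pd a (christoffel G k i j) y0 = pd a (christoffel H k i j) y0.
  exact: near_eq_derive.
apply/matrixP => i j; rewrite [LHS]mxE [RHS]mxE; apply: f_equal2.
  by apply: eq_bigr => k _; rewrite !E1.
by apply: eq_bigr => k _; apply: eq_bigr => l _; rewrite !E0.
Qed.

Lemma near_eq_ricci_coord n (G H : 'rV[R]_n -> 'M[R]_n) (y0 : 'rV[R]_n) :
  (\forall y \near y0, G y = H y) -> ricci_coord G y0 = ricci_coord H y0.
Proof. by move=> E; apply: eq_christoffel_ricci => k i j; exact: near_eq_christoffel. Qed.

(** The constant [c] from the derivatives of the metric cancels against its inverse from the inverse
    metric, so the Christoffel symbols are unchanged. *)
Lemma ricci_coordZ n (G : 'rV[R]_n -> 'M[R]_n) (c : R) (y0 : 'rV[R]_n) : c != 0 ->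
  (\forall y \near y0, G y \in unitmx /\ forall i j, differentiable (fun z => G z i j) y) ->
  ricci_coord (fun y => c *: G y) y0 = ricci_coord G y0.
Proof.
move=> c0 HG; apply: eq_christoffel_ricci => k i j; apply: filterS HG => y [uG dG].
rewrite /christoffel; congr (_ * _); apply: eq_bigr => l _.
have E a s t : pd a (fun z => (c *: G z) s t) y = c * pd a (fun z => G z s t) y.
  rewrite /pd (_ : (fun z => _) = c \*: (fun z => G z s t)); last first.
    by apply/funext => z; rewrite mxE.
  by rewrite deriveZ //; apply: diff_derivable; exact: dG.
rewrite !E invmxZ; last by rewrite unitmxZ ?unitfE.
by rewrite mxE -mulrDr -mulrBr mulrACA mulVf // mul1r.
Qed.

End LocalRicci.

(** * The Ricci tensor of a block-diagonal metric *)

Section BlockDiagonal.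
Context {R : realType} {m : nat} {d : 'I_m -> nat}.
Notation rk := (@tagnat.Rank m d).

Lemma mxdiagE (B : forall i, 'M[R]_(d i)) i k l :
  (\mxdiag_i B i) (rk i k) (rk i l) = B i k l.
Proof. by have /matrixP/(_ k l) <- := submxblock_diag B i; rewrite [RHS]mxE. Qed.

Lemma mxdiagE0 (B : forall i, 'M[R]_(d i)) i j k l : i != j ->
  (\mxdiag_i B i) (rk i k) (rk j l) = 0.
Proof.
move=> ij; have := mxblockK (fun i j => if i == j then conform_mx 0 (B i) else (0 : 'M[R]_(d i, d j))) i j.
by rewrite (negbTE ij) => /matrixP/(_ k l); rewrite [LHS]mxE => ->; rewrite mxE.
Qed.

Lemma mxrow_submx1 : \mxrow_i (submxrow (1%:M : 'M[R]_(\sum_i d i)) i) = 1%:M.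
Proof. exact: submxrowK. Qed.

(** This is the shape in which [base_metric] arises: a sum of pullbacks along the projections, whose
    tangent maps are blocks of the identity. *)
Lemma mxdiag_pull (B : forall i, 'M[R]_(d i)) :
  \mxdiag_i B i = \sum_i submxrow 1%:M i *m B i *m (submxrow 1%:M i)^T.
Proof.
rewrite -mul_mxrow_mxcol -tr_mxrow mxrow_submx1 trmx1 mulmx1.
by rewrite -mul_mxrow_mxdiag mxrow_submx1 mul1mx.
Qed.

Lemma mxdiagM (B C : forall i, 'M[R]_(d i)) :
  \mxdiag_i B i *m \mxdiag_i C i = \mxdiag_i (B i *m C i).
Proof.
have E (D : forall i, 'M[R]_(d i)) : \mxdiag_i D i = \mxrow_i (submxrow 1%:M i *m D i).
  by rewrite -mul_mxrow_mxdiag mxrow_submx1 mul1mx.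
rewrite (E B) mul_mxrow_mxdiag (E (fun i => B i *m C i)).
by apply: eq_mxrow => i; rewrite mulmxA.
Qed.

Lemma invmx_mxdiag (B : forall i, 'M[R]_(d i)) : (forall i, B i \in unitmx) ->
  invmx (\mxdiag_i B i) = \mxdiag_i (invmx (B i)).
Proof.
move=> uB; have E : \mxdiag_i B i *m \mxdiag_i (invmx (B i)) = 1%:M.
  by rewrite mxdiagM -mxdiagZ; apply: eq_mxdiag => i; rewrite mulmxV.
have [u _] := mulmx1_unit E.
by rewrite -[RHS]mul1mx -(mulVmx u) -mulmxA E mulmx1.
Qed.

Lemma sum_rank (F : 'I_(\sum_i d i) -> R) : \sum_K F K = \sum_i \sum_k F (rk i k).
Proof.
rewrite (reindex _ (@tagnat.rank_bij_on m d)) /=.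
rewrite (sig_big_dep _ (fun=> xpredT) (fun i k => F (rk i k))) /=.
by apply: eq_bigr => s _; rewrite tagnat.rankE.
Qed.

Lemma sum_rank1 i (F : 'I_(\sum_i d i) -> R) : (forall j k, j != i -> F (rk j k) = 0) ->
  \sum_K F K = \sum_k F (rk i k).
Proof.
move=> F0; rewrite sum_rank (bigD1 i) //= [X in _ + X]big1 ?addr0 // => j ji.
by apply: big1 => k _; exact: F0.
Qed.

Lemma submxrow_delta i k : submxrow (delta_mx 0 (rk i k) : 'rV[R]_(\sum_i d i)) i = delta_mx 0 k.
Proof.
apply/rowP => l; rewrite !mxE !eqxx /=; congr (_%:R); congr nat_of_bool.
apply/eqP/eqP => [|-> //] /(congr1 (@tagnat.sig m d)).
by rewrite /tagnat.Rank !tagnat.rankK => /eqP; rewrite eq_Tagged /= => /eqP.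
Qed.

Lemma submxrow_delta0 i j k : i != j ->
  submxrow (delta_mx 0 (rk i k) : 'rV[R]_(\sum_i d i)) j = 0.
Proof.
move=> ij; apply/rowP => l; rewrite !mxE !eqxx /= (_ : (_ == _) = false) //.
apply/negP => /eqP /(congr1 (@tagnat.sig1 m d)); rewrite !tagnat.Rank1K => E.
by rewrite E eqxx in ij.
Qed.

Lemma submxrowZ i (a : R) (y : 'rV[R]_(\sum_i d i)) : submxrow (a *: y) i = a *: submxrow y i.
Proof. by apply/rowP => l; rewrite !mxE. Qed.

(** The two difference quotients are the same function of the increment. *)
Lemma pd_block i k (f : 'rV[R]_(d i) -> R) (y : 'rV[R]_(\sum_i d i)) :
  pd (rk i k) (fun z => f (submxrow z i)) y = pd k f (submxrow y i).
Proof.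
rewrite /pd /derive (_ : (fun h => _) = fun h : R => h^-1 *:
  ((f \o shift (submxrow y i)) (h *: delta_mx 0 k) - f (submxrow y i))) //.
apply/funext => h /=.
by rewrite submxrowD submxrowZ submxrow_delta.
Qed.

Lemma pd_block0 i j k (f : 'rV[R]_(d j) -> R) (y : 'rV[R]_(\sum_i d i)) : i != j ->
  pd (rk i k) (fun z => f (submxrow z j)) y = 0.
Proof.
move=> ij; rewrite /pd /derive (_ : (fun h => _) = cst 0) ?lim_cst //.
apply/funext => h /=.
by rewrite submxrowD submxrowZ submxrow_delta0 // scaler0 add0r subrr scaler0.
Qed.

Lemma pd_cst n (i : 'I_n) (c : R) y : pd i (fun=> c) y = 0.
Proof. exact: derive_cst. Qed.

Section Metric.
Variable H : forall i, 'rV[R]_(d i) -> 'M[R]_(d i).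
Let G (y : 'rV[R]_(\sum_i d i)) := \mxdiag_i @H i (submxrow y i).

Lemma pd_mxdiag i k s t y :
  pd (rk i k) (fun z => G z (rk i s) (rk i t)) y = pd k (fun z => H z s t) (submxrow y i).
Proof.
rewrite -pd_block; congr (pd _ _ y); apply/funext => z.
by rewrite /G (mxdiagE (fun i => H (submxrow z i))).
Qed.

Lemma pd_mxdiag0 i j l k s t y : ~ (i = j /\ j = l) ->
  pd (rk i k) (fun z => G z (rk j s) (rk l t)) y = 0.
Proof.
move=> N; have [E|jl] := eqVneq j l; last first.
  rewrite (_ : (fun z => _) = fun=> 0); first exact: pd_cst.
  by apply/funext => z; rewrite /G mxdiagE0.
rewrite E in s N *; rewrite (_ : (fun z => _) = fun z => H (submxrow z l) s t).
  by apply: (pd_block0 _ (fun z => H z s t)); apply/eqP => il; apply: N.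
by apply/funext => z; rewrite /G (mxdiagE (fun i => H (submxrow z i))).
Qed.

Lemma christoffel_mxdiag i k s t y : (forall i, H (submxrow y i) \in unitmx) ->
  christoffel G (rk i k) (rk i s) (rk i t) y = christoffel (@H i) k s t (submxrow y i).
Proof.
move=> uH; rewrite /christoffel invmx_mxdiag // (sum_rank1 (i := i)) => [|j l ji].
  by congr (_ * _); apply: eq_bigr => l _; rewrite mxdiagE !pd_mxdiag.
by rewrite mxdiagE0 1?eq_sym // mul0r.
Qed.

(** The inverse metric confines the summation index to block [i]; each of the three derivatives then
    needs all its indices in one block. *)
Lemma christoffel_mxdiag0 i j l k s t y : (forall i, H (submxrow y i) \in unitmx) ->
  ~ (i = j /\ j = l) -> christoffel G (rk i k) (rk j s) (rk l t) y = 0.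
Proof.
move=> uH N; rewrite /christoffel invmx_mxdiag // (sum_rank1 (i := i)) => [|a b ji].
  rewrite big1 ?mulr0 // => b _.
  rewrite !pd_mxdiag0 ?addr0 ?subrr ?mulr0 // => -[E1 E2]; apply: N; rewrite ?E1 ?E2 -?E1 -?E2 //.
by rewrite mxdiagE0 1?eq_sym // mul0r.
Qed.

(** Invertibility is required near [y], so that mixed Christoffel symbols vanish on a neighbourhood
    and their derivatives vanish too; unmixed ones depend on the variables of their own block
    only. *)
Lemma ricci_mxdiag y : (\forall z \near y, forall i, H (submxrow z i) \in unitmx) ->
  ricci_coord G y = \mxdiag_i ricci_coord (@H i) (submxrow y i).
Proof.
move=> uH; have uH0 := nbhs_singleton uH.
have C0 i j l k s t := @christoffel_mxdiag0 i j l k s t y uH0.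
have C1 i k s t := @christoffel_mxdiag i k s t y uH0.
have P0 K i j l k s t : ~ (i = j /\ j = l) ->
    pd K (christoffel G (rk i k) (rk j s) (rk l t)) y = 0.
  move=> N; rewrite -(pd_cst K 0 y); apply: near_eq_derive.
  by apply: filterS uH => z uz; exact: christoffel_mxdiag0.
have PE K i k s t : pd K (christoffel G (rk i k) (rk i s) (rk i t)) y =
    pd K (fun z => christoffel (@H i) k s t (submxrow z i)) y.
  by apply: near_eq_derive; apply: filterS uH => z uz; exact: christoffel_mxdiag.
have P1 i a k s t : pd (rk i a) (christoffel G (rk i k) (rk i s) (rk i t)) y =
    pd a (christoffel (@H i) k s t) (submxrow y i).
  by rewrite PE pd_block.
have P2 j i a k s t : j != i -> pd (rk j a) (christoffel G (rk i k) (rk i s) (rk i t)) y = 0.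
  by move=> ji; rewrite PE pd_block0.
apply/matrixP => I J; rewrite -(tagnat.sig2K I) -(tagnat.sig2K J).
move: (tagnat.sig1 I) (tagnat.sig2 I) (tagnat.sig1 J) (tagnat.sig2 J) => i s j t.
rewrite [LHS]mxE; have [E|ij] := eqVneq i j.
  move: t; rewrite -E => t {E j}.
  rewrite mxdiagE mxE (sum_rank1 (i := i)) => [|j k ji]; last first.
    by rewrite !P0 ?subrr // => -[E _]; rewrite E eqxx in ji.
  (* Contributions with the contracted index in another block: the second factor of each product of
     symbols, or else the first, is mixed. *)
  rewrite (sum_rank1 (i := i)) => [|j k ji]; last first.
    rewrite big1 // => L _; rewrite -(tagnat.sig2K L).
    move: (tagnat.sig1 L) (tagnat.sig2 L) => l u.
    have [li|li] := eqVneq l i; last first.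
      rewrite [X in _ * X]C0 ?mulr0 ?sub0r; last by move=> [E _]; rewrite E eqxx in li.
      by rewrite C0 ?mul0r ?oppr0 // => -[E _]; rewrite E eqxx in ji.
    rewrite C0 ?mul0r ?sub0r; last by move=> [_ E]; rewrite E li eqxx in ji.
    by rewrite C0 ?mul0r ?oppr0 // => -[E _]; rewrite E eqxx in ji.
  apply: f_equal2.
    by apply: eq_bigr => k _; rewrite !P1.
  apply: eq_bigr => k _; rewrite (sum_rank1 (i := i)) => [|j l ji]; last first.
    rewrite [X in _ * X]C0 ?mulr0 ?sub0r; last by move=> [E _]; rewrite E eqxx in ji.
    by rewrite C0 ?mul0r ?oppr0 // => -[_ E]; rewrite E eqxx in ji.
  by apply: eq_bigr => l _; rewrite !C1.
(* Off-diagonal block: a nonzero derivative term could only be that of a symbol of block [i] along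
   block [j], which is 0. A nonzero product would put both [i] and [j] in the block of the
   contracted indices. *)
rewrite mxdiagE0 // [X in X + _]big1 ?add0r => [|K _]; last first.
  rewrite -(tagnat.sig2K K); move: (tagnat.sig1 K) (tagnat.sig2 K) => k u.
  rewrite P0 ?sub0r; last by move=> [_ E]; rewrite E eqxx in ij.
  have [ki|ki] := eqVneq k i; first by move: u; rewrite ki => u; rewrite P2 ?oppr0 // eq_sym.
  by rewrite P0 ?oppr0 // => -[E _]; rewrite E eqxx in ki.
apply: big1 => K _; apply: big1 => L _.
rewrite -(tagnat.sig2K K) -(tagnat.sig2K L).
move: (tagnat.sig1 K) (tagnat.sig2 K) (tagnat.sig1 L) (tagnat.sig2 L) => k u l v.
rewrite [X in _ * X]C0 ?mulr0 ?sub0r; last by move=> [_ E]; rewrite E eqxx in ij.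
have [kj|kj] := eqVneq k j; last first.
  by rewrite C0 ?mul0r ?oppr0 // => -[E _]; rewrite E eqxx in kj.
rewrite [X in _ * X]C0 ?mulr0 ?oppr0 // => -[_ E].
by rewrite E kj eqxx in ij.
Qed.

End Metric.
End BlockDiagonal.

(** * The Einstein equation for the product metric on the base *)

Section EinsteinProduct.
Unset Implicit Arguments.
Context {R : realType} {m : nat} {M : 'I_m -> topologicalType} {d : 'I_m -> nat}.
Context {A : forall i, @atlas R (M i) (d i)} {g : forall i, M i -> 'M[R]_(d i)}.
Set Implicit Arguments.
Hypothesis mA : forall i, C1_manifold (A i).
Hypothesis pg : forall i x v, v != 0 -> 0 < quad (g i x) v.

Lemma posdef_unitmx n (G : 'M[R]_n) : (forall v, v != 0 -> 0 < quad G v) -> G \in unitmx.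
Proof.
move=> pG; rewrite -row_free_unit -kermx_eq0; apply/rowV0P => v /sub_kermxP vG.
apply/eqP; apply/negPn/negP => /pG.
by rewrite /quad vG mul0mx mxE ltxx.
Qed.

Lemma coord2_unitmx (T : topologicalType) n (A0 : @atlas R T n) h c y : C1_manifold A0 ->
  charts A0 c -> cimg c y -> (forall x v, v != 0 -> 0 < quad (h x) v) ->
  coord2 A0 c h y \in unitmx.
Proof.
move=> m0 Ac [x cx <-] ph; apply: posdef_unitmx => v v0.
rewrite /coord2 quad_pull; apply: ph; apply: contra v0 => /eqP vc.
by rewrite -[v](mulmxK (change_mx_unit m0 Ac cx)) vc mul0mx.
Qed.

Lemma base_metricE b x : base_metric A g b x = \mxdiag_i (b i *: g i (x i)).
Proof.
rewrite /base_metric mxdiag_pull; apply: eq_bigr => i _.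
by rewrite /pullback2 (tmap_proj mA) -scalemxAr -scalemxAl.
Qed.

Lemma coord2_base b (c : forall i, @chart R (M i) (d i)) y : (forall i, charts (A i) (c i)) ->
  cimg (bigprod_chart c) y ->
  coord2 (bigprod_atlas A) (bigprod_chart c) (base_metric A g b) y =
  \mxdiag_i (b i *: coord2 (A i) (c i) (g i) (submxrow y i)).
Proof.
move=> Ac [x cx <-]; rewrite mxdiag_pull {1}/coord2 /base_metric mulmx_sumr mulmx_suml.
apply: eq_bigr => i _; rewrite -!scalemxAr -!scalemxAl; congr (_ *: _).
have hc i : is_chart (c i) := c1_chart (mA i) (Ac i).
have Bc : charts (bigprod_atlas A) (bigprod_chart c) by exists c.
rewrite -[LHS]/(coord2 _ _ _ _).
rewrite (coord2_pullback (bigprod_manifold mA) (mA i) (C1at_proj mA i x) _ Bc (Ac i)) //.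
by rewrite (locm_proj _ hc cx) /= mxrowK.
Qed.

(* The Ricci tensor is invariant under scaling, so the factors [2 * lam i] have Einstein constant [1/2]. *)
Lemma base_einstein (lam : 'I_m -> R) : (forall i, lam i != 0) ->
  (forall i, smooth2 (A i) (g i)) -> (forall i, einstein (A i) (g i) (lam i)) ->
  einstein (bigprod_atlas A) (base_metric A g (fun i => 2 * lam i)) 2^-1.
Proof.
move=> l0 sg eg x; set c := chart_at (bigprod_atlas A) x.
pose ci i := chart_at (A i) (x i).
have [Ac cx] : (forall i, charts (A i) (ci i)) /\ forall i, cdom (ci i) (x i).
  by split=> i; have [] := c1_at (mA i) (x i).
have hc i : is_chart (ci i) := c1_chart (mA i) (Ac i).
have near_c := cimg_nbhs (bigprod_is_chart hc) cx.
have uG i y : cimg (ci i) y -> coord2 (A i) (ci i) (g i) y \in unitmx.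
  by move=> cy; apply: coord2_unitmx (mA i) (Ac i) cy _; exact: pg.
have l2 i : 2 * lam i != 0 by rewrite mulf_neq0.
rewrite /ricci (near_eq_ricci_coord (H := fun y =>
  \mxdiag_i ((2 * lam i) *: coord2 (A i) (ci i) (g i) (submxrow y i)))); last first.
  by apply: filterS near_c => y cy; exact: coord2_base.
rewrite (ricci_mxdiag (H := fun i y => (2 * lam i) *: coord2 (A i) (ci i) (g i) y)); last first.
  apply: filterS near_c => y; rewrite cimg_bigprod_chart => cy i.
  by rewrite unitmxZ ?unitfE // uG.
rewrite base_metricE -[RHS]mul_scalar_mx -mxdiagZ mxdiagM; apply: eq_mxdiag => i.
rewrite mul_scalar_mx scalerA mulKf // /c /= mxrowK ricci_coordZ //.
  exact: eg.
apply: filterS (cimg_nbhs (hc i) (cx i)) => y cy; split; first exact: uG.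
by move=> k l; have [H _] := sg i _ (Ac i) 1%N k l; exact: H.
Qed.

End EinsteinProduct.

(** * Gromov-Hausdorff distance *)

Section Gluing.
Context {R : realType}.

Record is_metric (X : Type) (dX : X -> X -> R) : Prop := {
  metric_xx : forall x, dX x x = 0;
  metric_eq : forall x y, dX x y = 0 -> x = y;
  metric_symm : forall x y, dX x y = dX y x;
  metric_tri : forall y x z, dX x z <= dX x y + dX y z
}.

Lemma metricType_of (X : choiceType) (dX : X -> X -> R) : is_metric dX ->
  exists (Z : metricType R) (f : X -> Z), forall x y, mdist (f x) (f y) = dX x y.
Proof.
case: X dX => T cT dT [/= d1 d2 d3 d4].
pose Z : metricType R := HB.pack T cT (isMetric.Build R (Choice.Pack cT) d1 d2 d3 d4).
by exists Z, id.
Qed.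

Lemma metric_ge0 (X : Type) (dX : X -> X -> R) x y : is_metric dX -> 0 <= dX x y.
Proof.
move=> dm; have := metric_tri dm y x x; rewrite (metric_xx dm) (metric_symm dm y x).
by rewrite -mulr2n pmulrn_lge0.
Qed.

Variables (X Y : choiceType) (dX : X -> X -> R) (dY : Y -> Y -> R).
Hypotheses (mX : is_metric dX) (mY : is_metric dY).
Variables (pr : X -> Y) (r : R).
Hypothesis r0 : 0 < r.
Hypothesis dXY : forall x x', `|dX x x' - dY (pr x) (pr x')| <= 2 * r.

Definition bridge (x : X) (y : Y) : R := inf [set dX x x' + r + dY (pr x') y | x' in setT].

Lemma bridge_le x y x' : bridge x y <= dX x x' + r + dY (pr x') y.
Proof.
apply: ge_inf; last by exists x'.
by exists 0 => _ [z _ <-]; rewrite !addr_ge0 ?metric_ge0 // ltW.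
Qed.

Lemma le_bridge x y c : (forall x', c <= dX x x' + r + dY (pr x') y) -> c <= bridge x y.
Proof.
move=> H; apply: lb_le_inf; first by exists (dX x x + r + dY (pr x) y), x.
by move=> _ [x' _ <-]; exact: H.
Qed.

Definition glue (z w : X + Y) : R :=
  match z, w with
  | inl x, inl x' => dX x x'
  | inl x, inr y => bridge x y
  | inr y, inl x => bridge x y
  | inr y, inr y' => dY y y'
  end.

(** Positivity of [r] separates the two pieces. Mixed triangle inequalities cross the bridge once,
    and follow from those of [dX] and [dY], or twice, where the distortion of [pr] enters. *)
Lemma glue_metric : is_metric glue.
Proof.
have b0 x y : 0 < bridge x y.
  apply: lt_le_trans r0 _; apply: le_bridge => x'.
  by rewrite addrAC lerDr addr_ge0 // metric_ge0.
have T1 x x' y : bridge x y <= dX x x' + bridge x' y.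
  rewrite -lerBlDl; apply: le_bridge => z.
  have := bridge_le x y z; have := metric_tri mX x' x z; lra.
have T2 x y y' : bridge x y <= bridge x y' + dY y' y.
  rewrite -lerBlDr; apply: le_bridge => z.
  have := bridge_le x y z; have := metric_tri mY y' (pr z) y; lra.
(* Crossing twice costs at least 2 r, exactly the allowed gap between [dX] and the distance of the
   projections; [T4] is symmetric. *)
have T3 x x' y : dX x x' <= bridge x y + bridge x' y.
  rewrite -lerBlDr; apply: le_bridge => z.
  rewrite lerBlDr -lerBlDl; apply: le_bridge => z'.
  have := metric_tri mX z x x'; have := metric_tri mX z' z x'; rewrite (metric_symm mX z' x').
  have := metric_tri mY y (pr z) (pr z'); rewrite (metric_symm mY y).
  by have /ler_normlP[_] := dXY z z'; lra.
have T4 x y y' : dY y y' <= bridge x y + bridge x y'.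
  rewrite -lerBlDr; apply: le_bridge => z.
  rewrite lerBlDr -lerBlDl; apply: le_bridge => z'.
  have := metric_tri mY (pr z) y y'; have := metric_tri mY (pr z') (pr z) y'.
  rewrite (metric_symm mY y (pr z)).
  have := metric_tri mX x z z'; rewrite (metric_symm mX z x).
  by have /ler_normlP[+ _] := dXY z z'; lra.
split.
- by move=> [x|y] /=; [exact: metric_xx mX x|exact: metric_xx mY y].
- move=> [x|y] [x'|y'] /=; [by move=> /(metric_eq mX) ->| | |by move=> /(metric_eq mY) ->].
    by move=> E; have := b0 x y'; rewrite E ltxx.
  by move=> E; have := b0 x' y; rewrite E ltxx.
- by move=> [x|y] [x'|y'] //=; [exact: metric_symm mX _ _|exact: metric_symm mY _ _].
- move=> [x'|y'] [x|y] [x''|y''] /=; first exact: metric_tri mX _ _ _.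
  + exact: T1.
  + by rewrite addrC (metric_symm mX); exact: T1.
  + exact: T4.
  + exact: T3.
  + exact: T2.
  + by rewrite addrC (metric_symm mY); exact: T2.
  + exact: metric_tri mY _ _ _.
Qed.

Hypothesis pr_surj : forall y, exists x, pr x = y.

Lemma GH_dist_le (eX : X -> X -> \bar R) (eY : Y -> Y -> \bar R) :
  (forall x x', eX x x' = (dX x x')%:E) -> (forall y y', eY y y' = (dY y y')%:E) ->
  (GH_dist eX eY <= r%:E)%E.
Proof.
move=> EX EY; apply: ereal_inf_lbound; exists r => //; split; first exact: ltW.
have [Z [f Hf]] := metricType_of glue_metric.
have fr x : mdist (f (inl x)) (f (inr (pr x))) <= r.
  rewrite Hf /=; have := bridge_le x (pr x) x.
  by rewrite (metric_xx mX) (metric_xx mY) addr0 add0r.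
exists Z, (f \o inl), (f \o inr); split=> [x x'|y y'|].
- by rewrite EX /= Hf.
- by rewrite EY /= Hf.
split=> [_ [x _ <-]|_ [y _ <-]].
  by exists (f (inr (pr x))); [exists (pr x)|exact: fr].
by have [x <-] := pr_surj y; exists (f (inl x)); [exists x|exact: fr].
Qed.

End Gluing.

Lemma GH_dist_ge0 (R : realType) (X Y : Type) (eX : X -> X -> \bar R) (eY : Y -> Y -> \bar R) :
  (0 <= GH_dist eX eY)%E.
Proof. by apply: le_ereal_inf_tmp => _ [r [r0 _] <-]; rewrite lee_fin. Qed.

Section RiemannianMetric.
Context {R : realType} {T : topologicalType} {n : nat}.
Context {A : @atlas R T n} {h : T -> 'M[R]_n}.
Hypothesis mA : C1_manifold A.
Hypothesis ch : forall x, C0tensor2 A h x.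
Hypothesis hT : hausdorff_space T.
Hypothesis ph : forall x v, v != 0 -> 0 < quad (h x) v.
Hypothesis pT : forall x y, exists l, piecewise_path A h x y l.

Lemma riem_distE x y : riem_dist A h x y = (fine (riem_dist A h x y))%:E.
Proof. by have [l p] := pT x y; rewrite fineK //; exact: dist_path_finite p. Qed.

Lemma riem_dist_metric : is_metric (fun x y => fine (riem_dist A h x y)).
Proof.
split=> [x|x y E|x y|y x z].
- by rewrite (dist_refl mA ch).
- apply: contrapT => xy; have yx : y <> x by move=> /esym.
  have := dist_gt0 mA ch hT (@ph x) yx.
  by rewrite riem_distE E ltxx.
- by rewrite (dist_sym mA ch).
- by rewrite -lee_fin EFinD -!riem_distE; exact: dist_triangle.
Qed.

End RiemannianMetric.

(** * Collapse of the rescaled bundle onto its base *)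

Section BundleCollapse.
Unset Implicit Arguments.
Context {R : realType} {m : nat} {M : 'I_m -> topologicalType} {d : 'I_m -> nat}.
Context {A : forall i, @atlas R (M i) (d i)} {g : forall i, M i -> 'M[R]_(d i)}.
Context {P : topologicalType} {AP : @atlas R P (\sum_i d i).+1}.
Context {prj : P -> prod_topology M} {act : R -> P -> P}.
Context {sigma : P -> 'cV[R]_(\sum_i d i).+1}.
Set Implicit Arguments.
Hypothesis mA : forall i, C1_manifold (A i).
Hypothesis hM : forall i, hausdorff_space (M i).
Hypothesis cM : forall i, connected [set: M i].
Hypothesis kM : forall i, compact [set: M i].
Hypothesis cg : forall i x, C0tensor2 (A i) (g i) x.
Hypothesis pg : forall i x v, v != 0 -> 0 < quad (g i x) v.
Notation B := (bigprod_atlas A).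
Hypothesis pcb : principal_circle_bundle AP B prj act.
Hypothesis pcon : principal_connection AP act sigma.
Variable c : 'I_m -> R.
Hypothesis c0 : forall i, 0 < c i.
Notation hB := (base_metric A g c).
Notation hP := (bundle_metric AP A prj sigma g).

Let mP : C1_manifold AP := is_manifold_C1 (pcb_manifold pcb).
Let mB : C1_manifold B := bigprod_manifold mA.
Let cB y : C0tensor2 B hB y. Proof. exact: (base_C0 mA cg). Qed.
Let pB y v : v != 0 -> 0 < quad (hB y) v. Proof. exact: (quad_base_gt0 mA pg). Qed.
Let cP a b x : C0tensor2 AP (hP a b) x. Proof. exact: (bundle_C0 mA cg pcb pcon). Qed.
Let pathB := path_connected mB (@cB) (prod_connected cM).

Lemma base_dist_bounded : exists2 D : R, 0 < D & forall y y', fine (riem_dist B hB y y') <= D.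
Proof.
have [D HD] := dist_bounded mB (@cB) (prod_connected cM) (prod_compact kM).
exists (Num.max D 1) => [|y y']; first by rewrite lt_max ltr01 orbT.
by rewrite -lee_fin -(riem_distE mB (@cB) pathB) (le_trans (HD y y')) // lee_fin le_max lexx.
Qed.

Lemma base_dist_contract a b K : 0 < a -> 0 <= K -> (forall i, c i <= K ^+ 2 * b i) ->
  forall x x' l, piecewise_path AP (hP a b) x x' l ->
  (riem_dist B hB (prj x) (prj x') <= K%:E * l)%E.
Proof.
move=> a0 K0 cb; apply: (dist_map mP mB (@cP a b) (@cB) K0 (C1at_prj mA pcb)) => x v.
rewrite /pullback2 quad_pull (quad_bundle mA pcb).
apply: le_trans (quad_base_le mA pg _ _ cb) _.
by rewrite ler_wpM2l ?sqr_ge0 // lerDr mulr_ge0 ?sqr_ge0 // ltW.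
Qed.

(** Lifting gives dP <= (1 + de) dB + 2 pi sqrt a, and projecting gives (1 - de) dB <= dP. With dB
    <= D, the two distances differ by at most de D + 2 pi sqrt a <= 2 r, as the gluing requires. *)
Lemma bundle_GH a b (de D r : R) : 0 < a -> (forall i, 0 < b i) -> 0 <= de -> de < 1 ->
  (forall i, c i <= ((1 - de)^-1) ^+ 2 * b i) -> (forall i, b i <= (1 + de) ^+ 2 * c i) ->
  (forall y y', fine (riem_dist B hB y y') <= D) -> 0 < r -> de * D <= r ->
  2 * pi * Num.sqrt a <= r ->
  (GH_dist (riem_dist AP (hP a b)) (riem_dist B hB) <= r%:E)%E.
Proof.
move=> a0 b0 de0 de1 cb bc HD r0 deD ar.
have K0 : 0 <= 1 + de by rewrite addr_ge0.
have lift := path_lift_ends mA cg pg pcb pcon a K0 bc.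
have pathP x x' : exists l, piecewise_path AP (hP a b) x x' l.
  by have [l p] := pathB (prj x) (prj x'); have [l' p' _] := lift _ _ _ p; exists l'.
have pP x v : v != 0 -> 0 < quad (hP a b x) v by exact: (quad_bundle_gt0 mA pg pcb pcon x a0 b0).
have hausP := mfd_hausdorff (pcb_manifold pcb).
have EP := riem_distE mP (@cP a b) pathP; have EB := riem_distE mB (@cB) pathB.
have metP := riem_dist_metric mP (@cP a b) hausP pP pathP.
have metB := riem_dist_metric mB (@cB) (prod_hausdorff hM) pB pathB.
have GH := @GH_dist_le R P (prod_topology M) _ _ metP metB prj r r0.
apply: (GH _ (prj_surjective mA pcb) _ _ EP EB) => x x'.
set dP := fine _; set dB := fine _.
have up : dP <= (1 + de) * dB + 2 * pi * Num.sqrt a.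
  have K1 : 0 < 1 + de by rewrite ltr_pwDl.
  rewrite -lerBlDr -ler_pdivrMl // -lee_fin -EB; apply: le_dist => l p.
  have [l' p' ll] := lift _ _ _ p.
  have [s s0 E] := path_real mB (@cB) p; rewrite E in ll *.
  rewrite lee_fin ler_pdivrMl // lerBlDr -lee_fin EFinD EFinM -EP.
  by apply: le_trans ll; exact: dist_le_path p'.
have lo : (1 - de) * dB <= dP.
  have k0 : 0 < 1 - de by rewrite subr_gt0.
  rewrite -lee_fin -EP; apply: le_dist => l p.
  have := base_dist_contract a0 _ cb p; rewrite invr_ge0 => /(_ (ltW k0)).
  have [s s0 ->] := path_real mP (@cP a b) p.
  by rewrite EB -EFinM !lee_fin ler_pdivlMl.
have dB0 : 0 <= dB by rewrite -lee_fin -EB; exact: dist_ge0.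
have : de * dB <= de * D by rewrite ler_wpM2l // HD.
rewrite mulrDl mul1r in up; rewrite mulrBl mul1r in lo.
by move=> H; rewrite ler_norml; apply/andP; split; lra.
Qed.

(* The metrics [tau^-1 *: hP] have fibres of length [2 pi sqrt (a / tau)], which tends to 0. *)
Lemma bundle_collapse (a : R -> R) (b : R -> 'I_m -> R) (C : R) :
  (forall t, 0 <= t -> 0 < a t <= C) -> (forall t i, 0 <= t -> 0 < b t i) ->
  (forall i, b t i / t @[t --> +oo] --> c i) ->
  GH_dist (riem_dist AP (fun x => t^-1 *: hP (a t) (b t) x)) (riem_dist B hB)
    @[t --> +oo] --> 0%E.
Proof.
move=> aC b0 lim_b; have [D D0 HD] := base_dist_bounded.
have scaleP t : (fun x => t^-1 *: hP (a t) (b t) x) = hP (a t / t) (fun i => b t i / t).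
  apply/funext => x; rewrite /bundle_metric scalerDr scalerA mulrC scaler_sumr.
  by congr (_ + _); apply: eq_bigr => i _; rewrite scalerA mulrC.
have small (e : R) : 0 < e -> \forall t \near +oo,
    (GH_dist (riem_dist AP (fun x => t^-1 *: hP (a t) (b t) x)) (riem_dist B hB) <= e%:E)%E.
  (* e / D bounds the distortion de D by e; 1/2 keeps 1 - de positive. *)
  move=> e0; pose de := Num.min (e / D) (2^-1).
  have de0 : 0 < de by rewrite lt_min divr_gt0 //= invr_gt0.
  have de1 : de < 1 by rewrite gt_min; apply/orP; right; lra.
  have deD : de * D <= e by rewrite -ler_pdivlMr // ge_min lexx.
  have k0 : 0 < 1 - de by rewrite subr_gt0.
  have H1 i : \forall t \near +oo, (1 - de) ^+ 2 * c i < b t i / t.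
    have := lim_b i => /cvgr_gt; apply; rewrite gtr_pMl // expr_lt1 // ?ltW //.
    by rewrite ltrBlDr ltrDl.
  have H2 i : \forall t \near +oo, b t i / t < (1 + de) ^+ 2 * c i.
    have := lim_b i => /cvgr_lt; apply; rewrite ltr_pMl // expr_gt1 //; last by rewrite addr_ge0 ?ltW.
    by rewrite ltrDl.
  have H12 : \forall t \near +oo, forall i, (1 - de) ^+ 2 * c i < b t i / t < (1 + de) ^+ 2 * c i.
    apply: filter_forall => i; have := H1 i; have := H2 i; apply: filterS2 => t h2 h1.
    by rewrite h1.
  (* Chosen so that a / t <= E means that the fibres have length at most e; t >= C / E ensures
     this. *)
  pose E := (e / (2 * pi)) ^+ 2.
  have p2 : 0 < 2 * pi :> R by rewrite mulr_gt0 // pi_gt0.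
  have E0 : 0 < E by rewrite exprn_gt0 // divr_gt0.
  near=> t.
  have t0 : 0 < t by near: t; apply: nbhs_pinfty_gt; exact: num_real.
  have tC : C / E <= t by near: t; apply: nbhs_pinfty_ge; exact: num_real.
  have Ht : forall i, (1 - de) ^+ 2 * c i < b t i / t < (1 + de) ^+ 2 * c i by near: t.
  have /andP[at0 atC] := aC t (ltW t0).
  rewrite scaleP; apply: (bundle_GH (de := de) (D := D)) => //.
  - by rewrite divr_gt0.
  - by move=> i; rewrite divr_gt0 // b0 // ltW.
  - exact: ltW.
  - move=> i; have /andP[h _] := Ht i.
    by rewrite exprVn mulrC ler_pdivlMr ?exprn_gt0 // mulrC; exact: ltW.
  - by move=> i; have /andP[_ h] := Ht i; exact: ltW.
  - rewrite mulrC -ler_pdivlMr // -(ger0_norm (ltW (divr_gt0 e0 p2))) -sqrtr_sqr.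
    apply: ler_wsqrtr; rewrite ler_pdivrMr //.
    by apply: le_trans atC _; rewrite mulrC -ler_pdivrMr.
(* The Gromov-Hausdorff distance is an extended real; the bound for e = 1 makes it eventually
   finite, after which the limit is taken in the reals. *)
apply/fine_cvgP; split.
  have := small 1 ltr01; apply: filterS => t h.
  by rewrite ge0_fin_numE ?GH_dist_ge0 // (le_lt_trans h) // ltey.
apply/cvgrPdist_le => e e0; have := small e e0; apply: filterS => t h.
have G0 := @GH_dist_ge0 R P (prod_topology M)
  (riem_dist AP (fun x => t^-1 *: hP (a t) (b t) x)) (riem_dist B hB).
rewrite sub0r normrN ger0_norm ?fine_ge0 // -lee_fin fineK //.
by rewrite ge0_fin_numE // (le_lt_trans h) // ltey.
Unshelve. all: by end_near. Qed.

End BundleCollapse.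

(** * The asymptotics of the flow combined with the geometry of the bundle *)

Theorem theorem3p7 (R : realType) (m : nat)
    (n p : 'I_m -> nat) (q : 'I_m -> int)
    (M : 'I_m -> topologicalType)
    (A : forall i, @atlas R (M i) (n i + n i))
    (g : forall i, M i -> 'M[R]_(n i + n i))
    (P : topologicalType) (AP : @atlas R P (\sum_i (n i + n i)).+1)
    (prj : P -> prod_topology M) (act : R -> P -> P)
    (sigma : P -> 'cV[R]_(\sum_i (n i + n i)).+1)
    (c0 : R) (Y : R -> 'I_m -> R) (a0 : R)
    (a : R -> R) (b : 'I_m -> R -> R) :
  let B := bigprod_atlas A in
  let gP (tau : R) := bundle_metric AP A prj sigma g (a tau) (b^~ tau) in
  let gB := base_metric A g (fun i => 2 * (p i)%:R) in
  (0 < m)%N ->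
  (forall i, (0 < n i)%N) ->
  (forall i, (0 < p i)%N) ->
  (forall i, q i != 0) ->
  (forall i, kahler_einstein (A i) (g i) (p i)%:R) ->
  (forall i, integral_indivisible (A i)
     (fun x => (2 * pi)^-1 *: kahler_form (g i) x)) ->
  principal_circle_bundle AP B prj act ->
  principal_connection AP act sigma ->
  (forall x, dform1 AP sigma x =
     \sum_i (q i)%:~R *:
       pullback2 AP (A i) (fun z => prj z i) (kahler_form (g i)) x) ->
  admissible_constant n p q c0 ->
  Ysolution n p q Y ->
  (forall u i, 0 <= u -> 0 < Y u i) ->
  \sum_i Y 0 i <= c0 ->
  0 < a0 ->
  corresponding n q Y a0 a b ->
  [/\ forall i tau, 0 <= tau ->
        2 * (n i)%:R * (p i)%:R / ((n i)%:R + 1) * tau + b i 0 <= b i tau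
          <= 2 * (p i)%:R * tau + b i 0,
      [/\ exists2 ainf : R, 0 < ainf & a tau @[tau --> +oo] --> ainf,
          forall x tau1 tau2, 0 <= tau1 -> tau1 < tau2 ->
            (fibre_radius AP act (gP tau1) x
               < fibre_radius AP act (gP tau2) x)%E,
          exists2 r : R, 0 < r & forall x,
            fibre_radius AP act (gP tau) x @[tau --> +oo] --> r%:E &
          forall i, exists2 l : R, 0 < l &
            Num.sqrt (b i tau) / Num.sqrt tau @[tau --> +oo] --> l] &
      (exists lam : R, einstein B gB lam) /\
      GH_dist (riem_dist AP (fun x => tau^-1 *: gP tau x)) (riem_dist B gB)
        @[tau --> +oo] --> 0%E].
Proof.
move=> B gP gB m0 n0 p0 q0 KE _ pcb pcon _ [_ adm] Ysol Ypos Yc a00 cor.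
(* The constant [c0] supplies both inputs of the analysis: Y -> 0 in the variable u, and the flow
   equations in the variable tau. *)
have [Ylim anc] := adm Y Ysol (fun u i u0 => ltW (Ypos u i u0)) Yc.
have flow := anc Ypos a0 a b a00 cor.
have mKE i : is_manifold (A i) := (ke_complex (KE i)).1.
have mA i := is_manifold_C1 (mKE i).
have sg i : smooth2 (A i) (g i) by case: (ke_riemannian (KE i)).
have cg i x : C0tensor2 (A i) (g i) x by exact: smooth2_C0.
have pg i x (v : 'rV[R]_(n i + n i)) : v != 0 -> 0 < quad (g i x) v.
  by case: (ke_riemannian (KE i)) => _ _; exact.
have apos t : 0 <= t -> 0 < a t by case: flow => H _ _ _ /H[].
have bpos t i : 0 <= t -> 0 < b i t by case: flow => H _ _ _ /H[].
have p_gt0 i : 0 < (p i)%:R :> R by rewrite ltr0n.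
have radius t x : 0 <= t -> fibre_radius AP act (gP t) x = (Num.sqrt (a t))%:E.
  by move=> t0; apply: (fibre_radiusE mA cg pcb pcon).
have [ainf ainf0 lim_a] := a_limit m0 n0 p0 q0 Ysol Ylim a00 cor flow.
split; first by move=> i t t0; exact: (b_bounds n0 p0 q0 Ysol Ylim a00 cor flow).
  split.
  - by exists ainf.
  - move=> x t1 t2 t10 t12; rewrite !radius ?lte_fin //; last exact: ltW (le_lt_trans t10 t12).
    rewrite ltr_sqrt; first exact: (a_increasing m0 n0 q0 flow).
    exact/apos/ltW/(le_lt_trans t10).
  - exists (Num.sqrt ainf) => [|x]; first by rewrite sqrtr_gt0.
    have H : (Num.sqrt (a t))%:E @[t --> +oo] --> (Num.sqrt ainf)%:E.
      apply: cvg_EFin; first exact: nearW.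
      by apply: continuous_cvg; [exact: sqrt_continuous|exact: lim_a].
    apply: cvg_trans H; apply: near_eq_cvg; near=> t.
    have t0 : 0 <= t by near: t; apply: nbhs_pinfty_ge; exact: num_real.
    by rewrite radius.
  - exact: (sqrt_b_ratio_limit m0 n0 p0 q0 Ysol Ylim a00 cor flow).
split.
  exists 2^-1; apply: (base_einstein mA pg) => // i; first by rewrite gt_eqF.
  exact: ke_einstein (KE i).
have [C _ aC] := a_bounded m0 n0 p0 q0 Ysol Ylim a00 cor flow.
apply: (bundle_collapse mA _ _ _ cg pg pcb pcon _ (C := C) (b := fun t i => b i t)).
- by move=> i; exact: mfd_hausdorff (mKE i).
- by move=> i; exact: ke_connected (KE i).
- by move=> i; exact: ke_compact (KE i).
- by move=> i; rewrite mulr_gt0.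
- by move=> t t0; rewrite apos // aC.
- exact: bpos.
- by move=> i; exact: (b_ratio_limit m0 n0 p0 q0 Ysol Ylim a00 cor flow).
Unshelve. all: by end_near. Qed.
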